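(* Let $n\ge1$ and let $f$ be continuous on $[a,b]$. Suppose that $f$ has a Peano $(n-1)^{\text{th}}$ derivative at every point of $[a,b]$, with Peano derivatives $f_0=f,f_1,\dots,f_{n-1}$. Furthermore, assume that there is a denumerable set $E$ such that for all $x\in[a,b]\setminus E$ $$f(x+h)=f(x)+f_1(x)h+\dots+f_{n-1}(x)\frac{h^{n-1}}{(n-1)!}+O(h^n),\qquad\text{as }h\to0 .$$ If the Peano $n^{\text{th}}$ derivative $f_n(x)$ of $f$ exists almost everywhere in $[a,b]$, then $f_n$ is distributionally integrable over $[a,b]$ and, for $x\in[a,b]$, $$f(x)=\sum_{j=0}^{n-1}\frac{f_j(a)}{j!}(x-a)^j+(\mathfrak{dist})\int_a^x\int_a^{t_n}\cdots\int_a^{t_2}f_n(t_1)\,dt_1\cdots dt_{n-1}\,dt_n ,$$ where the right-hand side is an $n$-times iterated distributional integral. In particular, if $f_n(x)=0$ a.e., then $f$ is a polynomial of degree at most $n-1$.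
   Context: Peano derivatives. A continuous $f$ on $[a,b]$ has a Peano $k^{\text{th}}$ derivative at $x\in(a,b)$ if there are numbers $f_1(x),\dots,f_k(x)$ with $f(x+h)=f(x)+f_1(x)h+\dots+f_k(x)\frac{h^k}{k!}+o(h^k)$ as $h\to0$; $f_j(x)$ is the Peano $j^{\text{th}}$ derivative at $x$, and $f_0=f$. At $x=a$ (resp. $x=b$) the expansion is only required as $h\to0^+$ (resp. $h\to0^-$). Distributions are real. Notation: $\overline{\mathbb R}=\mathbb R\cup\{-\infty,\infty\}$; $\mathcal E'[a,b]$ is the space of distributions on $\mathbb R$ with support contained in $[a,b]$; $\langle \mathsf g(x+ty),\phi(y)\rangle:=|t|^{-1}\langle \mathsf g(y),\phi((y-x)/t)\rangle$ for $t\ne0$. Point values. For $\mathsf g\in\mathcal D'(\mathbb R)$, the distributional (Łojasiewicz) point value $\mathsf g(x_0)$ exists and equals $\gamma\in\mathbb R$ if $\lim_{\varepsilon\to0}\langle \mathsf g(x_0+\varepsilon y),\phi(y)\rangle=\gamma\int_{-\infty}^\infty\phi(y)\,dy$ for every $\phi\in\mathcal D(\mathbb R)$. A Łojasiewicz distribution is one having a point value at every point of $\mathbb R$. Test classes. $\mathcal T_0$: functions $\phi\in C^\infty(\mathbb R)$, $\phi\ge0$, $\int\phi=1$, such that for some $\alpha<-1$, $\phi^{(m)}(x)=O(|x|^{\alpha-m})$ as $|x|\to\infty$ for all $m\ge0$. $\mathcal T_1$: those $\phi\in\mathcal T_0$ with $x\phi'(x)\le0$ for all $x$. For $\mathsf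 g\in\mathcal E'(\mathbb R)$, $\phi\in\mathcal T_0$: $\mathsf g^{+}_{\phi,0}(x)=\limsup_{t\to0^+}\langle \mathsf g(x+ty),\phi(y)\rangle$ and $\mathsf g^{-}_{\phi,0}(x)=\liminf_{t\to0^+}\langle \mathsf g(x+ty),\phi(y)\rangle$. Integral. Let $g:[a,b]\to\overline{\mathbb R}$. A major distributional pair $(\mathsf u,\mathsf U)$ for $g$ consists of $\mathsf u\in\mathcal E'[a,b]$ and a Łojasiewicz distribution $\mathsf U$ with $\mathsf U'=\mathsf u$, $\mathsf U(a)=0$, such that there exist a countable set $E$ and a Lebesgue null set $Z$ with $\mathsf u^-_{\phi,0}(x)\ge g(x)$ for all $x\in[a,b]\setminus Z$, $\phi\in\mathcal T_0$, and $\mathsf u^-_{\phi,0}(x)>-\infty$ for all $x\in[a,b]\setminus E$, $\phi\in\mathcal T_1$. A minor distributional pair $(\mathsf v,\mathsf V)$ for $g$ consists of $\mathsf v\in\mathcal E'[a,b]$ and a Łojasiewicz distribution $\mathsf V$ with $\mathsf V'=\mathsf v$, $\mathsf V(a)=0$, such that there exist a countable set $E$ and a null set $Z$ with $\mathsf v^+_{\phi,0}(x)\le g(x)$ for all $x\in[a,b]\setminus Z$, $\phi\in\mathcal T_0$, and $\mathsf v^+_{\phi,0}(x)<\infty$ for all $x\in[a,b]\setminus E$, $\phi\in\mathcal T_1$. The function $g$ is distributionally integrable over $[a,b]$ if it has both major and minor pairs and $\sup\mathsf V(b)=\inf\mathsf U(b)$ (sup over minor pairs, inf over major pairs); the common value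 is $(\mathfrak{dist})\int_a^bg(x)\,dx$. Integrability and the integral do not change if $g$ is modified on a null set, so functions defined almost everywhere may be integrated. *)

(* Defs.v *)
From HB Require Import structures.
From mathcomp Require Export all_boot all_order all_algebra.
From mathcomp Require Export all_classical all_reals all_analysis.
Export Order.TTheory GRing.Theory Num.Theory.
Export numFieldNormedType.Exports.

Set Implicit Arguments.
Unset Strict Implicit.
Unset Printing Implicit Defensive.

Local Open Scope ring_scope.
Local Open Scope classical_set_scope.

Definition smooth (R : realType) (phi : R -> R) : Prop :=
  forall (m : nat) (x : R), derivable (phi^`(m)) x 1.

Definition fsupport (R : realType) (phi : R -> R) : set R :=
  closure [set x | phi x != 0].

(* The space D(R). *)
Definition test_function (R : realType) (phi : R -> R) : Prop :=
  smooth phi /\ compact (fsupport phi).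

(* A distribution is carried by a total functional on R -> R; only its values
   on test functions are meaningful. The continuity clause says that on the
   test functions supported in K, |T phi| <= C * max_(k <= N) sup |phi^(k)|. *)
Definition distribution (R : realType) (T : (R -> R) -> R) : Prop :=
  (forall (c : R) (phi psi : R -> R), test_function phi -> test_function psi ->
     T (fun x => c * phi x + psi x) = c * T phi + T psi) /\
  (forall K : set R, compact K -> exists (C : R) (N : nat),
     forall (phi : R -> R) (M : R), test_function phi -> fsupport phi `<=` K ->
       (forall (k : nat) (x : R), (k <= N)%N -> `|phi^`(k) x| <= M) ->
       `|T phi| <= C * M).

Definition vanishes_on (R : realType) (T : (R -> R) -> R) (O : set R) : Prop :=
  forall phi, test_function phi -> fsupport phi `<=` O -> T phi = 0.

Definition dsupport (R : realType) (T : (R -> R) -> R) : set R :=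
  ~` \bigcup_(O in [set O | open O /\ vanishes_on T O]) O.

(* The space E'[a,b]. *)
Definition supported_distribution (R : realType) (a b : R)
    (T : (R -> R) -> R) : Prop :=
  distribution T /\ dsupport T `<=` `[a, b].

(* The pairing of a compactly supported distribution with a smooth function:
   <T, phi> := T (chi * phi) where the test function chi equals 1 near the
   support of T; the value does not depend on chi. *)
Definition smooth_pairing (R : realType) (T : (R -> R) -> R)
    (phi : R -> R) : R :=
  get [set y | exists2 chi : R -> R,
    test_function chi /\
      (forall x, dsupport T x -> \forall z \near x, chi z = 1) &
    y = T (fun x => chi x * phi x)].

(* <T(x + t y), phi(y)>, for t != 0 *)
Definition dilate (R : realType) (T : (R -> R) -> R) (x t : R)
    (phi : R -> R) : R :=
  `|t|^-1 * T (fun y => phi ((y - x) / t)).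

Definition point_value (R : realType) (T : (R -> R) -> R) (x0 gamma : R) :
    Prop :=
  forall phi, test_function phi ->
    dilate T x0 eps phi @[eps --> 0^'] -->
      gamma * (\int[@lebesgue_measure R]_y phi y).

Definition Lojasiewicz (R : realType) (T : (R -> R) -> R) : Prop :=
  distribution T /\ forall x, exists gamma, point_value T x gamma.

Definition ddistr (R : realType) (T S : (R -> R) -> R) : Prop :=
  forall phi, test_function phi -> S phi = - T (phi^`()).

Definition testT0 (R : realType) (phi : R -> R) : Prop :=
  [/\ smooth phi,
      forall x, 0 <= phi x,
      (\int[@lebesgue_measure R]_x (phi x)%:E = 1)%E &
      exists2 alpha : R, alpha < -1 & forall m : nat, exists C : R,
        (\forall x \near +oo, `|phi^`(m) x| <= C * `|x| `^ (alpha - m%:R)) /\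
        (\forall x \near -oo, `|phi^`(m) x| <= C * `|x| `^ (alpha - m%:R))].

Definition testT1 (R : realType) (phi : R -> R) : Prop :=
  testT0 phi /\ forall x : R, x * (phi^`())%classic x <= 0.

Definition upper_value (R : realType) (T : (R -> R) -> R) (phi : R -> R)
    (x : R) : \bar R :=
  limf_esup (fun t => (dilate (smooth_pairing T) x t phi)%:E) 0^'+.

Definition lower_value (R : realType) (T : (R -> R) -> R) (phi : R -> R)
    (x : R) : \bar R :=
  limf_einf (fun t => (dilate (smooth_pairing T) x t phi)%:E) 0^'+.

(* The values of g outside [a,b] are irrelevant throughout. *)
Definition major_pair (R : realType) (a b : R) (g : R -> \bar R)
    (u U : (R -> R) -> R) : Prop :=
  [/\ supported_distribution a b u, Lojasiewicz U, ddistr U u,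
      point_value U a 0 &
      exists E Z : set R, [/\ countable E,
        (@lebesgue_measure R).-negligible Z,
        (forall x phi, a <= x <= b -> ~ Z x -> testT0 phi ->
           (g x <= lower_value u phi x)%E) &
        (forall x phi, a <= x <= b -> ~ E x -> testT1 phi ->
           (-oo < lower_value u phi x)%E)]].

Definition minor_pair (R : realType) (a b : R) (g : R -> \bar R)
    (v V : (R -> R) -> R) : Prop :=
  [/\ supported_distribution a b v, Lojasiewicz V, ddistr V v,
      point_value V a 0 &
      exists E Z : set R, [/\ countable E,
        (@lebesgue_measure R).-negligible Z,
        (forall x phi, a <= x <= b -> ~ Z x -> testT0 phi ->
           (upper_value v phi x <= g x)%E) &
        (forall x phi, a <= x <= b -> ~ E x -> testT1 phi ->
           (upper_value v phi x < +oo)%E)]].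

(* The values U(b), resp. V(b), over the major, resp. minor, pairs. *)
Definition major_values (R : realType) (a b : R) (g : R -> \bar R) :
    set (\bar R) :=
  [set c%:E | c in
    [set c | exists u U, major_pair a b g u U /\ point_value U b c]].

Definition minor_values (R : realType) (a b : R) (g : R -> \bar R) :
    set (\bar R) :=
  [set c%:E | c in
    [set c | exists v V, minor_pair a b g v V /\ point_value V b c]].

(* For a = b this makes every g integrable over [a,a], with integral 0. *)
Definition dist_integrable (R : realType) (a b : R) (g : R -> \bar R) : Prop :=
  [/\ exists u U, major_pair a b g u U,
      exists v V, minor_pair a b g v V &
      ereal_sup (minor_values a b g) = ereal_inf (major_values a b g)].

Definition dist_integral (R : realType) (a b : R) (g : R -> \bar R) : R :=
  fine (ereal_inf (major_values a b g)).

(* iter_dist_integral a g k x =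
   int_a^x int_a^(t_k) ... int_a^(t_2) g(t_1) dt_1 ... dt_k *)
Fixpoint iter_dist_integral (R : realType) (a : R) (g : R -> R) (k : nat)
    (x : R) : R :=
  if k is k'.+1 then
    dist_integral a x (fun t => (iter_dist_integral a g k' t)%:E)
  else g x.

Definition peano_poly (R : realType) (k : nat) (c : nat -> R) (h : R) : R :=
  \sum_(j < k.+1) c j * (h ^+ j / j`!%:R).

(* h tends to 0 with x + h in [a,b]: two-sided inside, one-sided at a and b. *)
Definition increments (R : realType) (a b x : R) : set_system R :=
  within [set h | a <= x + h <= b] 0^'.

(* c 0, ..., c k are the Peano derivatives at x of f : [a,b] -> R. *)
Definition peano_derivatives (R : realType) (a b : R) (f : R -> R) (k : nat)
    (x : R) (c : nat -> R) : Prop :=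
  c 0%N = f x /\
  forall eps : R, 0 < eps -> \forall h \near increments a b x,
    `|f (x + h) - peano_poly k c h| <= eps * `|h| ^+ k.

(* Main.v *)
(* Proof idea. Normalize f to vanish to order n - 1 at a by subtracting its Taylor
   polynomial there, extend it by its Taylor polynomials beyond the endpoints, and
   let V and v be its (n-1)-st and n-th distributional derivatives. The Peano
   expansions make V a Lojasiewicz distribution with point values f_(n-1), and make
   the means of v converge to f_n almost everywhere and stay bounded off a countable
   set; so (v, V) is both a major and a minor pair.
   That no other major or minor pair does better is a monotonicity theorem: if the
   lower means of w = W' are nonnegative almost everywhere and > -oo off a countable
   set, then W(a) <= W(b). Hence integration lowers the order of the Peano derivative
   by one, and n steps give the formula.

   For the monotonicity theorem only the Gaussian kernel is needed, whose means
   h(x, t) solve a heat equation. A small positive measure with infinite density on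
   the exceptional null set reduces to h(x, t) >= 0 for small t, for all x outside a
   countable set. Let S be the set of points near which w is not positive. As W has
   point values, w has no point masses, so S has no isolated points; by Baire
   category, h >= 0 on (S meet I) x (0, t0) for some interval I meeting S. On a
   complementary gap of S, w is positive, and the maximum principle, with barriers
   for the initial layer at the corners, extends h >= 0 to I x (0, t0). Letting t
   tend to 0 makes w positive on I, a contradiction. *)
Require Import Defs.
From mathcomp Require Import measurable_realfun zify ring lra.
Set Implicit Arguments.
Unset Strict Implicit.
Unset Printing Implicit Defensive.
Local Open Scope ring_scope.
Local Open Scope classical_set_scope.

(* A private notation: [^`(m)] is also the derivative of polynomials. *)
Local Notation "f ^[ m ]" := (derive1n m f) (at level 8, format "f ^[ m ]").

(** * Smooth functions *)

Section Calculus.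
Context {R : realType}.
Implicit Types (f g : R -> R) (x y : R).

(** The obstacle is the initial layer. The means h(x, t) of a distribution need not converge
    pointwise as t tends to 0, and positivity inside a gap says nothing about w beyond its corners.
    Absence of a point mass only says that w, paired with a test function rescaled by r, tends to 0
    for each fixed profile. A gliding hump makes this uniform: the pairings are bounded by a
    seminorm of the profile that does not depend on r, where the definition of a distribution allows
    a loss of r^-N. At time s and distance r from the corner the negative part is then at most of
    order s^-1 exp(-(r/s)^2/4), up to a small error. A delayed and shifted x-derivative of the heat
    kernel has size s^-2 in this layer but stays bounded at later times, so s times it dominates the
    layer and disappears as s tends to 0. The way back from h to w uses Riemann sums of heat
    kernels, which approximate a test function together with the finitely many derivatives that w
    sees. After the first integration the integrand is a Peano derivative at every point, so the
    later steps run with empty exceptional sets. *)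

Lemma derive1nSr (m : nat) f : f^[m.+1] = (f^[1])^[m].
Proof. by rewrite /derive1n iterSr. Qed.

Lemma derive1nD (m k : nat) f : f^[m + k] = (f^[k])^[m].
Proof. by rewrite /derive1n iterD. Qed.

Lemma is_derive_derive1 f x d : is_derive x 1 f d -> f^[1] x = d.
Proof. by move=> h; rewrite derive1n1 derive1E; apply: derive_val. Qed.

Lemma derivable_is_derive f x : derivable f x 1 -> is_derive x 1 f (f^[1] x).
Proof. by move=> h; rewrite derive1n1 derive1E; apply: DeriveDef. Qed.

Lemma is_derive_eq1 f x d d' : is_derive x 1 f d -> d = d' -> is_derive x 1 f d'.
Proof. by move=> h <-. Qed.

Lemma is_derive_continuous f x d : is_derive x 1 f d -> {for x, continuous f}.
Proof. by move=> [h _]; apply/differentiable_continuous/derivable1_diffP. Qed.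

Lemma is_derive_add f g x d e : is_derive x 1 f d -> is_derive x 1 g e ->
  is_derive x 1 (fun y => f y + g y) (d + e).
Proof. exact: is_deriveD. Qed.

Lemma is_derive_mul f g x d e : is_derive x 1 f d -> is_derive x 1 g e ->
  is_derive x 1 (fun y => f y * g y) (d * g x + f x * e).
Proof.
move=> hf hg; apply: (is_derive_eq1 (is_deriveM hf hg)).
by rewrite /GRing.scale /= addrC [g x * _]mulrC.
Qed.

Lemma is_derive_scale (c : R) f x d : is_derive x 1 f d ->
  is_derive x 1 (fun y => c * f y) (c * d).
Proof. exact: is_deriveZ. Qed.

Lemma is_derive_chain f g x d e : is_derive (g x) 1 f d -> is_derive x 1 g e ->
  is_derive x 1 (fun y => f (g y)) (d * e).
Proof. exact: is_derive1_comp. Qed.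

Lemma is_derive_ext f g x d : f =1 g -> is_derive x 1 f d -> is_derive x 1 g d.
Proof. by move=> /funext ->. Qed.

Lemma derive1n_family (G : nat -> R -> R) :
  (forall m x, is_derive x 1 (G m) (G m.+1 x)) -> forall m, (G 0%N)^[m] = G m.
Proof.
move=> h; elim=> [//|m IH]; rewrite derive1nS IH; apply/funext => x.
exact: is_derive_derive1.
Qed.

Lemma smooth_family (G : nat -> R -> R) :
  (forall m x, is_derive x 1 (G m) (G m.+1 x)) -> smooth (G 0%N).
Proof. by move=> h m x; rewrite (derive1n_family h); case: (h m x). Qed.

Lemma smooth_is_derive f m x : smooth f -> is_derive x 1 (f^[m]) (f^[m.+1] x).
Proof. by move=> sf; rewrite derive1nS; exact: derivable_is_derive. Qed.

Lemma smooth_derive1n f k : smooth f -> smooth (f^[k]).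
Proof. by move=> sf m x; rewrite -derive1nD. Qed.

Lemma smooth_derive1 f : smooth f -> smooth (f^[1]).
Proof. exact: (@smooth_derive1n f 1). Qed.

Lemma smooth_continuous f k : smooth f -> continuous (f^[k]).
Proof. by move=> sf x; exact: is_derive_continuous (smooth_is_derive k x sf). Qed.

(** Differentiability m times, without continuity of the last derivative. The recursion passes to
    the first derivative, the form in which the product rule allows induction on m. *)
Fixpoint Ck (m : nat) f : Prop :=
  if m is m'.+1 then (forall x, derivable f x 1) /\ Ck m' (f^[1]) else True.

Lemma smoothP f : smooth f <-> forall m, Ck m f.
Proof.
split=> [sf m|h].
  elim: m f sf => [//|m IH] f sf /=; split; first exact: (sf 0%N).
  exact/IH/smooth_derive1.
move=> m; elim: m f h => [|m IH] f h x; first by case: (h 1%N).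
by rewrite derive1nSr; apply: IH => k; case: (h k.+1).
Qed.

Lemma derive1_addE f g : (forall x, derivable f x 1) -> (forall x, derivable g x 1) ->
  (fun x => f x + g x)^[1] = (fun x => f^[1] x + g^[1] x).
Proof.
move=> df dg; apply/funext => x; apply: is_derive_derive1.
by apply: is_deriveD; exact: derivable_is_derive.
Qed.

Lemma derive1_mulE f g : (forall x, derivable f x 1) -> (forall x, derivable g x 1) ->
  (fun x => f x * g x)^[1] =
  (fun x => f^[1] x * g x + f x * g^[1] x).
Proof.
move=> df dg; apply/funext => x; apply: is_derive_derive1.
apply: is_derive_eq1.
  by apply: is_deriveM; exact: derivable_is_derive.
by rewrite /GRing.scale /= addrC [g x * _]mulrC.
Qed.

Lemma CkS m f : Ck m.+1 f -> Ck m f.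
Proof. by elim: m f => [//|m IH] f [df h]; split=> //; exact: IH. Qed.

Lemma Ck_add m f g : Ck m f -> Ck m g -> Ck m (fun x => f x + g x).
Proof.
elim: m f g => [//|m IH] f g [df cf] [dg cg]; split=> [x|].
  by apply: derivableD.
by rewrite derive1_addE//; exact: IH.
Qed.

Lemma Ck_mul m f g : Ck m f -> Ck m g -> Ck m (fun x => f x * g x).
Proof.
elim: m f g => [//|m IH] f g cf cg; have [df cf'] := cf; have [dg cg'] := cg.
split=> [x|]; first by apply: derivableM.
by rewrite derive1_mulE//; apply: Ck_add; apply: IH => //; exact: CkS.
Qed.

Lemma smooth_add f g : smooth f -> smooth g -> smooth (fun x => f x + g x).
Proof. by move=> /smoothP hf /smoothP hg; apply/smoothP => m; exact: Ck_add. Qed.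

Lemma smooth_mul f g : smooth f -> smooth g -> smooth (fun x => f x * g x).
Proof. by move=> /smoothP hf /smoothP hg; apply/smoothP => m; exact: Ck_mul. Qed.

Lemma smooth_cst (c : R) : smooth (fun _ : R => c).
Proof.
apply: (@smooth_family (fun m x => if m is 0%N then c else 0)) => -[|m] x; exact: is_derive_cst.
Qed.

Lemma smooth_id : smooth (fun x : R => x).
Proof.
apply: (@smooth_family (fun m x => match m with 0%N => x | 1%N => 1 | _ => 0 end)).
by move=> [|[|m]] x; [exact: is_derive_id|exact: is_derive_cst|exact: is_derive_cst].
Qed.

Lemma smooth_scale (c : R) f : smooth f -> smooth (fun x => c * f x).
Proof. by move=> sf; exact: smooth_mul (@smooth_cst c) sf. Qed.

Lemma smooth_opp f : smooth f -> smooth (fun x => - f x).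
Proof.
move=> /(@smooth_scale (-1)); congr smooth; apply/funext => x; by rewrite mulN1r.
Qed.

Lemma smooth_sub f g : smooth f -> smooth g -> smooth (fun x => f x - g x).
Proof. by move=> sf sg; exact: smooth_add sf (smooth_opp sg). Qed.

Lemma smooth_exp f k : smooth f -> smooth (fun x => f x ^+ k).
Proof.
move=> sf; elim: k => [|k IH]; first exact: smooth_cst.
have -> : (fun x => f x ^+ k.+1) = (fun x => f x * f x ^+ k).
  by apply/funext => x; rewrite exprS.
exact: smooth_mul.
Qed.

Lemma smooth_sum (I : Type) (r : seq I) (P : pred I) (F : I -> R -> R) :
  (forall i, smooth (F i)) -> smooth (fun x => \sum_(i <- r | P i) F i x).
Proof.
move=> sF; elim: r => [|i r IH].
  have -> : (fun x => \sum_(i <- [::] | P i) F i x) = (fun=> 0).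
    by apply/funext => x; rewrite big_nil.
  exact: smooth_cst.
have -> : (fun x => \sum_(j <- i :: r | P j) F j x) =
    (fun x => (if P i then F i x else 0) + \sum_(j <- r | P j) F j x).
  by apply/funext => x; rewrite big_cons; case: ifP => // _; rewrite add0r.
apply: (smooth_add _ IH); case: (P i); [exact: sF|exact: smooth_cst].
Qed.

Lemma derive1n_add f g m : smooth f -> smooth g ->
  (fun x => f x + g x)^[m] = (fun x => f^[m] x + g^[m] x).
Proof.
move=> sf sg.
apply: (@derive1n_family (fun m x => f^[m] x + g^[m] x)) => {}m x.
by apply: is_deriveD; exact: smooth_is_derive.
Qed.

Lemma derive1n_scale (c : R) f m : smooth f ->
  (fun x => c * f x)^[m] = (fun x => c * f^[m] x).
Proof.
move=> sf.
apply: (@derive1n_family (fun m x => c * f^[m] x)) => {}m x.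
by apply: is_deriveZ; exact: smooth_is_derive.
Qed.

Lemma derive1n_opp f m : smooth f -> (fun x => - f x)^[m] = (fun x => - f^[m] x).
Proof.
move=> sf; have := @derive1n_scale (-1) f m sf.
have -> : (fun x => -1 * f x) = (fun x => - f x) by apply/funext => x; rewrite mulN1r.
by move=> ->; apply/funext => x; rewrite mulN1r.
Qed.

Lemma derive1n_sub f g m : smooth f -> smooth g ->
  (fun x => f x - g x)^[m] = (fun x => f^[m] x - g^[m] x).
Proof.
move=> sf sg; rewrite (derive1n_add m sf (smooth_opp sg)).
by rewrite derive1n_opp.
Qed.

Lemma derive1n_sum (I : Type) (r : seq I) (P : pred I) (F : I -> R -> R) m :
  (forall i, smooth (F i)) ->
  (fun x => \sum_(i <- r | P i) F i x)^[m] =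
  (fun x => \sum_(i <- r | P i) (F i)^[m] x).
Proof.
move=> sF; apply: (@derive1n_family
  (fun m x => \sum_(i <- r | P i) (F i)^[m] x)) => {}m x.
elim: r => [|i r IH].
  rewrite big_nil (_ : (fun x => _) = (fun=> 0)); first exact: is_derive_cst.
  by apply/funext => y; rewrite big_nil.
rewrite big_cons; case: ifP => Pi.
  rewrite (_ : (fun x => _) = (fun x => (F i)^[m] x + \sum_(j <- r | P j) (F j)^[m] x)).
    exact: is_derive_add (smooth_is_derive m x (sF i)) IH.
  by apply/funext => y; rewrite big_cons Pi.
rewrite (_ : (fun x => _) = (fun x => \sum_(j <- r | P j) (F j)^[m] x))//.
by apply/funext => y; rewrite big_cons Pi.
Qed.

Lemma derive1n_mulS f g m : smooth f -> smooth g ->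
  (fun x => f x * g x)^[m.+1] = (fun x =>
    (fun x => f^[1] x * g x)^[m] x + (fun x => f x * g^[1] x)^[m] x).
Proof.
move=> sf sg; rewrite derive1nSr derive1_mulE; [|exact: (sf 0%N)|exact: (sg 0%N)].
by rewrite (derive1n_add m (smooth_mul (smooth_derive1 sf) sg) (smooth_mul sf (smooth_derive1 sg))).
Qed.

(** A crude Leibniz rule: the 2^m terms produced by m applications of the product rule are each at
    most A B. *)
Lemma derive1n_mul_bound m f g x (A B : R) : smooth f -> smooth g ->
  (forall i, (i <= m)%N -> `|f^[i] x| <= A) ->
  (forall i, (i <= m)%N -> `|g^[i] x| <= B) ->
  `|(fun x => f x * g x)^[m] x| <= 2 ^+ m * (A * B).
Proof.
elim: m f g => [|m IH] f g sf sg hf hg.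
  by rewrite expr0 mul1r /= normrM ler_pM// ?(hf 0%N)// (hg 0%N).
rewrite derive1n_mulS// (le_trans (ler_normD _ _))// exprS -mulrA mulr2n mulrDl mul1r.
have sf' := smooth_derive1 sf; have sg' := smooth_derive1 sg.
apply: lerD; apply: IH => // i im; rewrite ?hf ?hg ?(leq_trans im)//.
  by rewrite -derive1nD addn1 hf.
by rewrite -derive1nD addn1 hg.
Qed.

Lemma is_derive_affine1 (al r x : R) : is_derive x 1 (fun y => (y - al) * r) r.
Proof.
have h := is_derive_mul (is_derive_add (is_derive_id x 1) (is_derive_cst (- al) x 1))
  (is_derive_cst r x 1).
by apply: is_derive_eq1 h _; rewrite addr0 mul1r mulr0 addr0.
Qed.

Lemma is_derive_affine f (al r : R) m x : smooth f ->
  is_derive x 1 (fun y => r ^+ m * f^[m] ((y - al) * r))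
    (r ^+ m.+1 * f^[m.+1] ((x - al) * r)).
Proof.
move=> sf; apply: is_derive_eq1.
  apply: is_derive_scale; apply: is_derive_chain (is_derive_affine1 _ _ _).
  exact: smooth_is_derive.
by rewrite exprSr -mulrA [_ * r]mulrC.
Qed.

Lemma derive1n_affine f (al r : R) m : smooth f ->
  (fun y => f ((y - al) * r))^[m] = (fun y => r ^+ m * f^[m] ((y - al) * r)).
Proof.
move=> sf; rewrite -(derive1n_family (fun m x => is_derive_affine al r m x sf)).
by congr (derive1n m); apply/funext => y; rewrite mul1r.
Qed.

Lemma smooth_affine f (al r : R) : smooth f -> smooth (fun y => f ((y - al) * r)).
Proof.
move=> sf; have := smooth_family (fun m x => is_derive_affine al r m x sf).
by congr smooth; apply/funext => y; rewrite mul1r.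
Qed.

(** Two applications of the mean value theorem. The constant M instead of M / 2 suffices, as only
    the quadratic order matters afterwards. *)
Lemma taylor2 f (f1 f2 : R -> R) (a x M : R) :
  (forall z, `|z - a| <= `|x - a| -> is_derive z 1 f (f1 z)) ->
  (forall z, `|z - a| <= `|x - a| -> is_derive z 1 f1 (f2 z)) ->
  (forall z, `|z - a| <= `|x - a| -> `|f2 z| <= M) ->
  `|f x - f a - (x - a) * f1 a| <= M * (x - a) ^+ 2.
Proof.
have mvt : forall (h h' : R -> R) (p q : R), p <= q ->
    (forall z, p <= z <= q -> is_derive z 1 h (h' z)) ->
    exists2 c, p <= c <= q & h q - h p = h' c * (q - p).
  move=> h h' p q pq hd.
  have [||c cpq ->] := @MVT_segment R h h' p q pq.
  - move=> z; rewrite in_itv/= => /andP[pz zq]; apply: hd.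
    by rewrite (ltW pz) (ltW zq).
  - apply: derivable_within_continuous => z; rewrite in_itv/= => hz.
    by have [] := hd _ hz.
  by exists c => //; move: cpq; rewrite in_itv.
have mvt' : forall (h h' : R -> R) (p q : R),
    (forall z, `|z - p| <= `|q - p| -> is_derive z 1 h (h' z)) ->
    exists2 c, `|c - p| <= `|q - p| & h q - h p = h' c * (q - p).
  move=> h h' p q hd; have [pq|qp] := leP p q.
    have [z /andP[z1 z2]|c /andP[c1 c2] e] := mvt h h' p q pq.
      by apply: hd; rewrite (ger0_norm (x := q - p)) ?subr_ge0// ler_norml; lra.
    by exists c => //; rewrite (ger0_norm (x := q - p)) ?subr_ge0// ler_norml; lra.
  have [z /andP[z1 z2]|c /andP[c1 c2] e] := mvt h h' q p (ltW qp).
    by apply: hd; rewrite (distrC q) (gtr0_norm (x := p - q)) ?subr_gt0// ler_norml; lra.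
  exists c.
    by rewrite (distrC q) (gtr0_norm (x := p - q)) ?subr_gt0// ler_norml; lra.
  by rewrite -opprB e -mulrN opprB.
move=> h1 h2 hM.
have [c hc ->] := mvt' f f1 a x h1.
have [z hz|e he E] := mvt' f1 f2 a c; first by apply: h2; exact: le_trans hz hc.
rewrite [_ * f1 a]mulrC -mulrBl E !normrM.
have -> : (x - a) ^+ 2 = `|x - a| * `|x - a| by rewrite -expr2 real_normK// num_real.
rewrite -mulrA; apply: ler_pM => //; rewrite ?mulr_ge0//.
  by apply: hM; exact: le_trans he hc.
by rewrite ler_wpM2r.
Qed.

(** A quadratic remainder survives the action of a distribution and the passage to a limit, so
    derivatives of pairings and of series are obtained in this form. *)
Lemma is_derive_quadratic f x (d C e : R) : 0 < e ->
  (forall h, `|h| < e -> `|f (x + h) - f x - h * d| <= C * h ^+ 2) ->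
  is_derive x 1 f d.
Proof.
move=> e0 H.
have C0 : 0 <= C.
  have := H (e / 2); rewrite gtr0_norm ?divr_gt0// ltr_pdivrMr// ltr_pMr ?ltr1n//.
  move=> /(_ isT) /(le_trans (normr_ge0 _)).
  by rewrite pmulr_lge0// exprn_gt0// divr_gt0.
suff lim : h^-1 *: (f (h *: 1 + x) - f x) @[h --> 0^'] --> d.
  apply: DeriveDef; first by apply/cvg_ex; exists d.
  exact: cvg_lim lim.
apply/cvgrPdist_le => /= eps eps0.
near=> h.
have h0 : h != 0 by near: h; exact: nbhs_dnbhs_neq.
rewrite /GRing.scale/= mulr1 [h + x]addrC.
have -> : d - h^-1 * (f (x + h) - f x) = - (h^-1 * (f (x + h) - f x - h * d)).
  by field.
rewrite normrN normrM normfV.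
rewrite ler_pdivrMl ?normr_gt0//.
apply: le_trans (H h _) _.
  near: h; apply: dnbhs0_lt => //.
rewrite -real_normK ?num_real// expr2 mulrA mulrC ler_wpM2l//.
have C1 : 0 < C + 1 by rewrite ltr_wpDl.
apply: (@le_trans _ _ ((C + 1) * `|h|)); first by rewrite ler_wpM2r// lerDl.
rewrite -ler_pdivlMl//; near: h; apply: dnbhs0_le; rewrite mulr_gt0// invr_gt0 ltr_wpDl.
Unshelve. all: by end_near.
Qed.

End Calculus.

(** * Test functions *)

Section Bump.
Context {R : realType}.
Implicit Types (f g : R -> R) (x y : R).

Lemma is_derive_near f g x d : (\forall y \near x, f y = g y) ->
  is_derive x 1 f d -> is_derive x 1 g d.
Proof. exact: near_eq_is_derive. Qed.

Lemma is_derive_inv g x d : g x != 0 -> is_derive x 1 g d ->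
  is_derive x 1 (fun y => (g y)^-1) (- d * ((g x)^-1 * (g x)^-1)).
Proof.
move=> gx0 hg; apply: (is_derive_eq1 (is_deriveV gx0 hg)).
by rewrite /GRing.scale /= expr2 invfM mulNr mulrC mulNr.
Qed.

Lemma smooth_inv g : (forall x, g x != 0) -> smooth g -> smooth (fun x => (g x)^-1).
Proof.
move=> g0 sg; apply/smoothP => m.
elim: m => [//|m IH]; split=> [x|].
  by have [] := is_derive_inv (g0 x) (smooth_is_derive 0 x sg).
have -> : (fun x => (g x)^-1)^[1] = (fun x => - g^[1] x * ((g x)^-1 * (g x)^-1)).
  apply/funext => x; apply: is_derive_derive1.
  exact: is_derive_inv (g0 x) (smooth_is_derive 0 x sg).
apply: Ck_mul; last exact: Ck_mul.
by have /smoothP := smooth_opp (smooth_derive1 sg).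
Qed.

(** Differentiation maps the family into its own linear combinations, so all members are smooth by
    one induction; [flat 0] is the classical exp(-1/x). *)
Definition flat (k : nat) x : R := if 0 < x then x^-1 ^+ k * expR (- x^-1) else 0.

(** From exp(1/x) >= x^-(k+2) / (k+2)!. The quadratic bound gives derivative 0 at the origin. *)
Lemma flat_bound k x : 0 <= flat k x /\ (0 < x -> flat k x <= (k.+2)`!%:R * x ^+ 2).
Proof.
rewrite /flat; case: ifPn => x0; last by split.
have xV0 : 0 < x^-1 by rewrite invr_gt0.
split=> [|_]; first by rewrite mulr_ge0 ?expR_ge0// exprn_ge0// ltW.
rewrite expRN ler_pdivrMr ?expR_gt0//.
have := expR_ge1Dxn k.+1 (ltW xV0).
rewrite -(@ler_pM2l _ ((k.+2)`!%:R * x ^+ 2)); last first.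
  by rewrite mulr_gt0 ?exprn_gt0// ltr0n fact_gt0.
apply: le_trans; rewrite mulrDr mulr1 -[leLHS]add0r lerD//.
  by rewrite mulr_ge0// ?exprn_ge0 ?ltW.
have F0 : (k.+2)`!%:R != 0 :> R by rewrite pnatr_eq0 -lt0n fact_gt0.
rewrite (exprS _ k.+1) (exprS _ k) le_eqVlt; apply/orP; left; apply/eqP.
move: F0 (x^-1 ^+ k) => + v; move: ((k.+2)`!%:R : R) => F F0.
by field; rewrite F0 gt_eqF.
Qed.

Lemma is_derive_flat k x :
  is_derive x 1 (flat k) (- k%:R * flat k.+1 x + flat k.+2 x).
Proof.
have [x0|x0|x0] := ltgtP 0 x.
- apply: (@is_derive_near (fun x => x^-1 ^+ k * expR (- x^-1))).
    have : \forall y \near x, 0 < y by exact: lt_nbhsr.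
    by apply: filterS => y y0; rewrite /flat y0.
  have hv : is_derive x 1 (fun y : R => y^-1) (- (x^-1 * x^-1)).
    have := @is_derive_inv (fun y => y) x 1 (lt0r_neq0 x0) (is_derive_id x 1).
    by rewrite mulN1r.
  have hp : is_derive x 1 (fun y : R => y^-1 ^+ k) (- k%:R * x^-1 ^+ k.+1).
    have {hv}hv' := hv; elim: k => [|k IH].
      apply: (@is_derive_ext _ (fun=> 1)); first by move=> y; rewrite expr0.
      by rewrite oppr0 mul0r; exact: is_derive_cst.
    apply: (@is_derive_ext _ (fun y => y^-1 * y^-1 ^+ k)); first by move=> y; rewrite exprS.
    apply: (is_derive_eq1 (is_derive_mul hv' IH)).
    by rewrite [in RHS]mulrS !exprS; ring.
  have he : is_derive x 1 (fun y : R => expR (- y^-1)) (expR (- x^-1) * (x^-1 * x^-1)).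
    apply: (is_derive_chain (is_derive_expR _)).
    apply: (@is_derive_ext _ (fun y => -1 * y^-1)); first by move=> y; rewrite mulN1r.
    by apply: (is_derive_eq1 (is_derive_scale (-1) hv)); rewrite mulN1r opprK.
  apply: (is_derive_eq1 (is_derive_mul hp he)).
  by rewrite /flat x0 !exprS; ring.
- apply: (@is_derive_near (fun=> 0)).
    have : \forall y \near x, y < 0 by exact: lt_nbhsl.
    by apply: filterS => y y0; rewrite /flat ltNge ltW.
  by apply: (is_derive_eq1 (is_derive_cst 0 x 1)); rewrite /flat ltNge ltW//= mulr0 addr0.
- rewrite -x0; apply: (@is_derive_quadratic _ _ _ _ (k.+2)`!%:R 1) => // h _.
  rewrite add0r {2 3 4}/flat ltxx mulr0 addr0 mulr0 !subr0.
  have [f0 f1] := flat_bound k h; rewrite ger0_norm//.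
  have [/f1//|h0] := ltP 0 h; rewrite /flat ltNge h0 /=.
  by rewrite mulr_ge0// ?sqr_ge0.
Qed.

Lemma smooth_flat k : smooth (flat k).
Proof.
apply/smoothP => m; elim: m k => [//|m IH] k; split=> [x|].
  by have [] := is_derive_flat k x.
have -> : (flat k)^[1] = (fun x => - k%:R * flat k.+1 x + flat k.+2 x).
  apply/funext => x; exact: is_derive_derive1 (is_derive_flat k x).
apply: Ck_add => //; apply: Ck_mul => //.
by have /smoothP := @smooth_cst R (- k%:R).
Qed.

(** A smooth transition from 0 on x <= 0 to 1 on x >= 1; every cutoff below is built from it. *)
Definition step x : R := flat 0 x * (flat 0 x + flat 0 (1 - x))^-1.

Lemma flat_gt0 k x : 0 < x -> 0 < flat k x.
Proof. by move=> x0; rewrite /flat x0 mulr_gt0 ?expR_gt0// exprn_gt0 ?invr_gt0. Qed.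

Lemma flat_eq0 k x : x <= 0 -> flat k x = 0.
Proof. by move=> x0; rewrite /flat ltNge x0. Qed.

Lemma flat_ge0 k x : 0 <= flat k x.
Proof. by have [] := flat_bound k x. Qed.

Lemma step_den_gt0 x : 0 < flat 0 x + flat 0 (1 - x).
Proof.
have [x0|x0] := ltP 0 x; first by rewrite ltr_wpDr ?flat_ge0 ?flat_gt0.
by rewrite ltr_wpDl ?flat_ge0// flat_gt0//; lra.
Qed.

Lemma smooth_step : smooth step.
Proof.
have s1 : smooth (fun x : R => flat 0 (1 - x)).
  have := @smooth_affine R (flat 0) 1 (-1) (@smooth_flat 0).
  by congr smooth; apply/funext => x; rewrite mulrN1 opprB.
apply: smooth_mul; first exact: smooth_flat.
apply: smooth_inv; first by move=> x; rewrite gt_eqF// step_den_gt0.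
exact: smooth_add (@smooth_flat 0) s1.
Qed.

Lemma step_ge0 x : 0 <= step x.
Proof. by rewrite mulr_ge0 ?flat_ge0// invr_ge0 ltW// step_den_gt0. Qed.

Lemma step_le1 x : step x <= 1.
Proof. by rewrite ler_pdivrMr ?step_den_gt0// mul1r lerDl flat_ge0. Qed.

Lemma step_eq0 x : x <= 0 -> step x = 0.
Proof. by move=> x0; rewrite /step flat_eq0// mul0r. Qed.

Lemma step_eq1 x : 1 <= x -> step x = 1.
Proof.
move=> x1; rewrite /step [flat 0 (1 - x)]flat_eq0 ?subr_le0// addr0 mulfV//.
by rewrite gt_eqF// flat_gt0//; lra.
Qed.

Definition bump (c d e x : R) : R :=
  step ((x - (c - e)) * e^-1) * step ((x - (d + e)) * - e^-1).

Lemma smooth_bump c d e : smooth (bump c d e).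
Proof. by apply: smooth_mul; apply: smooth_affine; exact: smooth_step. Qed.

Lemma bump_ge0 c d e x : 0 <= bump c d e x.
Proof. by rewrite mulr_ge0 ?step_ge0. Qed.

Lemma bump_le1 c d e x : bump c d e x <= 1.
Proof. by rewrite -[leRHS]mulr1 ler_pM ?step_ge0 ?step_le1. Qed.

Lemma bump_eq1 c d e x : 0 < e -> c <= x <= d -> bump c d e x = 1.
Proof.
move=> e0 /andP[cx xd]; rewrite /bump !step_eq1 ?mulr1//.
  by rewrite mulrN -mulNr ler_pdivlMr//; lra.
by rewrite ler_pdivlMr//; lra.
Qed.

Lemma bump_eq0 c d e x : 0 < e -> ~~ (c - e <= x <= d + e) -> bump c d e x = 0.
Proof.
move=> e0; rewrite negb_and -!ltNge => /orP[h|h]; rewrite /bump.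
  by rewrite step_eq0 ?mul0r// pmulr_lle0 ?invr_gt0//; lra.
by rewrite mulrC step_eq0 ?mul0r// mulrN oppr_le0 pmulr_lge0 ?invr_gt0//; lra.
Qed.

End Bump.

(** * Supports and closure properties of test functions *)

Section TestFunctions.
Context {R : realType}.
Implicit Types (f g phi : R -> R) (p q : R).

(** A pointwise substitute for inclusion of [fsupport]; if q < p it forces [phi] to vanish
    identically. *)
Definition supp_in p q phi : Prop := forall x, ~~ (p <= x <= q) -> phi x = 0.

Lemma supp_in_bump c d e : 0 < e -> supp_in (c - e) (d + e) (bump c d e).
Proof. by move=> e0 x; exact: bump_eq0. Qed.

Lemma supp_in_mull p q f phi : supp_in p q phi -> supp_in p q (fun x => f x * phi x).
Proof. by move=> h x /h ->; rewrite mulr0. Qed.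

Lemma supp_in_mulr p q f phi : supp_in p q phi -> supp_in p q (fun x => phi x * f x).
Proof. by move=> h x /h ->; rewrite mul0r. Qed.

Lemma supp_in_le p q p' q' phi : p' <= p -> q <= q' -> supp_in p q phi ->
  supp_in p' q' phi.
Proof.
move=> hp hq h x hx; apply: h; apply: contra hx => /andP[px xq].
by rewrite (le_trans hp px) (le_trans xq hq).
Qed.

Lemma supp_in_fsupport p q phi : supp_in p q phi -> fsupport phi `<=` `[p, q].
Proof.
move=> h; have /closure_id -> : closed (`[p, q]%classic : set R).
  exact: interval_closed.
apply: closureS => x /= hx; rewrite in_itv/=.
by apply: contraNT hx => /h ->.
Qed.

Lemma supp_in_test p q phi : smooth phi -> supp_in p q phi -> test_function phi.
Proof.
move=> sf h; split=> //; apply: (subclosed_compact _ (@segment_compact _ p q)).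
  exact: closed_closure.
exact: supp_in_fsupport.
Qed.

Lemma fsupport_notin phi x : ~ fsupport phi x -> phi x = 0.
Proof.
move=> h; apply/eqP; apply: contra_notT h => hx.
exact: subset_closure.
Qed.

Lemma test_supp_in phi : test_function phi -> exists2 A, 0 < A & supp_in (- A) A phi.
Proof.
move=> [sf /compact_bounded[M [Mr hM]]].
exists (`|M| + 1); first by rewrite ltr_wpDl.
move=> x hx; apply: fsupport_notin => fx; move/negP: hx; apply.
rewrite -ler_norml; apply: (hM (`|M| + 1)) => //.
by rewrite (le_lt_trans (ler_norm M))// ltrDl.
Qed.

Lemma test_smooth phi : test_function phi -> smooth phi. Proof. by case. Qed.

Lemma derive1n_near0 phi x m : (\forall y \near x, phi y = 0) -> phi^[m] x = 0.
Proof.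
move=> h; apply: (@nbhs_singleton R x (fun y => phi^[m] y = 0)).
elim: m => [//|m IH].
have /near_join := IH; apply: filterS => y hy.
apply: (@is_derive_derive1 R (phi^[m])).
apply: (@is_derive_near _ (fun=> 0)).
by apply: filterS hy.
Qed.

Lemma derive1n_near_eq f g x m : smooth f -> smooth g ->
  (\forall y \near x, f y = g y) -> f^[m] x = g^[m] x.
Proof.
move=> sf sg h; apply/eqP; rewrite -subr_eq0; apply/eqP.
have := derive1n_sub m sf sg => /(congr1 (fun k => k x)) <-.
by apply: derive1n_near0; apply: filterS h => y ->; rewrite subrr.
Qed.

Lemma supp_in_derive1n p q phi m : supp_in p q phi -> supp_in p q (phi^[m]).
Proof.
move=> h x; rewrite negb_and -!ltNge => /orP[hx|hx]; apply: derive1n_near0.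
  have : \forall y \near x, y < p by exact: lt_nbhsl.
  by apply: filterS => y yp; apply: h; rewrite negb_and -ltNge yp.
have : \forall y \near x, q < y by exact: lt_nbhsr.
by apply: filterS => y yp; apply: h; rewrite negb_and -!ltNge yp orbT.
Qed.

Lemma test_add f g : test_function f -> test_function g ->
  test_function (fun x => f x + g x).
Proof.
move=> tf tg; have [A A0 hA] := test_supp_in tf; have [B B0 hB] := test_supp_in tg.
apply: (@supp_in_test (- (A + B)) (A + B)).
  by apply: smooth_add; exact: test_smooth.
move=> x hx; rewrite hA ?hB ?addr0//; apply: contra hx; lra.
Qed.

Lemma test_mull f g : smooth f -> test_function g -> test_function (fun x => f x * g x).
Proof.
move=> sf tg; have [A A0 hA] := test_supp_in tg.
apply: (@supp_in_test (- A) A); last exact: supp_in_mull.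
exact: smooth_mul sf (test_smooth tg).
Qed.

Lemma test_mulr f g : test_function f -> smooth g -> test_function (fun x => f x * g x).
Proof.
move=> tf sg; have := test_mull sg tf.
by congr test_function; apply/funext => x; rewrite mulrC.
Qed.

Lemma test_scale (c : R) f : test_function f -> test_function (fun x => c * f x).
Proof. by apply: test_mull; exact: smooth_cst. Qed.

Lemma test_opp f : test_function f -> test_function (fun x => - f x).
Proof.
move=> /(@test_scale (-1)); congr test_function.
by apply/funext => x; rewrite mulN1r.
Qed.

Lemma test_sub f g : test_function f -> test_function g ->
  test_function (fun x => f x - g x).
Proof. by move=> tf tg; apply: test_add => //; exact: test_opp. Qed.

Lemma test_derive1n f m : test_function f -> test_function (f^[m]).
Proof.
move=> tf; have [A A0 hA] := test_supp_in tf.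
apply: (@supp_in_test (- A) A); last exact: supp_in_derive1n.
exact/smooth_derive1n/test_smooth.
Qed.

Lemma test_cst0 : test_function (fun _ : R => 0).
Proof. by apply: (@supp_in_test 0 0); [exact: smooth_cst|move=> x]. Qed.

Lemma supp_in_affine p q f (al r : R) : r != 0 -> supp_in p q f ->
  exists p' q', supp_in p' q' (fun y => f ((y - al) * r)).
Proof.
move=> r0 h; exists (al - (`|p| + `|q|) / `|r|), (al + (`|p| + `|q|) / `|r|) => x hx.
apply: h; apply: contra hx => hx.
rewrite -ler_distl ler_pdivlMr ?normr_gt0// -normrM ler_norml.
case/andP: hx => h1 h2; apply/andP; split.
  by apply: le_trans h1; have := ler_norm (- p); rewrite normrN; have := normr_ge0 q; lra.
by apply: le_trans h2 _; have := ler_norm q; have := normr_ge0 p; lra.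
Qed.

Lemma test_affine f (al r : R) : r != 0 -> test_function f ->
  test_function (fun y => f ((y - al) * r)).
Proof.
move=> r0 tf; have [A _ hA] := test_supp_in tf.
have [p [q h]] := supp_in_affine al r0 hA.
by apply: (@supp_in_test p q) => //; exact/smooth_affine/test_smooth.
Qed.

Lemma test_sum (I : Type) (r : seq I) (P : pred I) (F : I -> R -> R) :
  (forall i, test_function (F i)) ->
  test_function (fun x => \sum_(i <- r | P i) F i x).
Proof.
move=> tF; elim: r => [|i r IH].
  by rewrite (_ : (fun x => _) = (fun=> 0)); [exact: test_cst0|apply/funext => x; rewrite big_nil].
rewrite (_ : (fun x => _) =
    (fun x => (if P i then F i x else 0) + \sum_(j <- r | P j) F j x)); last first.
  by apply/funext => x; rewrite big_cons; case: ifP => // _; rewrite add0r.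
by apply: test_add => //; case: (P i) => //; exact: test_cst0.
Qed.

Lemma supp_in_bounded p q f : continuous f -> supp_in p q f ->
  exists2 M, 0 <= M & forall x, `|f x| <= M.
Proof.
move=> cf h; have [pq|qp] := leP p q; last first.
  exists 0 => // x; rewrite h ?normr0//; apply/negP => /andP[px xq].
  by have := le_lt_trans (le_trans px xq) qp; rewrite ltxx.
have cn : {within `[p, q], continuous (fun x => `|f x|)}.
  apply: continuous_subspaceT => x; apply: continuous_comp; first exact: cf.
  exact: norm_continuous.
have [c _ hc] := EVT_max pq cn; exists `|f c| => // x.
have [hx|hx] := boolP (p <= x <= q); first by apply: hc; rewrite in_itv.
by rewrite h// normr0.
Qed.

Lemma test_bounded f N : test_function f ->
  exists2 M, 0 <= M & forall k x, (k <= N)%N -> `|f^[k] x| <= M.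
Proof.
move=> tf; have [A _ hA] := test_supp_in tf.
elim: N => [|N [M M0 hM]].
  have [M M0 hM] := supp_in_bounded (smooth_continuous (k := 0) (test_smooth tf)) hA.
  by exists M => // -[|//] x _; exact: hM.
have [M' M'0 hM'] := supp_in_bounded (smooth_continuous (k := N.+1) (test_smooth tf))
  (supp_in_derive1n N.+1 hA).
exists (Num.max M M'); first by rewrite le_max M0.
move=> k x; rewrite leq_eqVlt ltnS => /orP[/eqP ->|kN]; rewrite le_max.
  by rewrite hM' orbT.
by rewrite hM.
Qed.

End TestFunctions.

(** * Distributions *)

Section Distributions.
Context {R : realType}.
Implicit Types (f g phi psi : R -> R) (p q : R) (T : (R -> R) -> R).

Lemma dist_scaleD T (c : R) f g : distribution T -> test_function f -> test_function g ->
  T (fun x => c * f x + g x) = c * T f + T g.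
Proof. by case=> + _; exact. Qed.

Lemma dist_add T f g : distribution T -> test_function f -> test_function g ->
  T (fun x => f x + g x) = T f + T g.
Proof.
move=> hT tf tg; have := dist_scaleD 1 hT tf tg; rewrite mul1r => <-.
by congr T; apply/funext => x; rewrite mul1r.
Qed.

Lemma dist0 T : distribution T -> T (fun=> 0) = 0.
Proof.
move=> hT; have := dist_add hT (@test_cst0 R) (@test_cst0 R).
rewrite (_ : (fun x => 0 + 0) = fun=> 0); last by apply/funext => x; rewrite addr0.
by move=> /eqP; rewrite -subr_eq0 opprD addNKr oppr_eq0 => /eqP.
Qed.

Lemma dist_scale T (c : R) f : distribution T -> test_function f ->
  T (fun x => c * f x) = c * T f.
Proof.
move=> hT tf; have := dist_scaleD c hT tf (@test_cst0 R).
rewrite dist0// addr0 => <-.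
by congr T; apply/funext => x; rewrite addr0.
Qed.

Lemma dist_opp T f : distribution T -> test_function f -> T (fun x => - f x) = - T f.
Proof.
move=> hT tf; rewrite -mulN1r -dist_scale//.
by congr T; apply/funext => x; rewrite mulN1r.
Qed.

Lemma dist_sub T f g : distribution T -> test_function f -> test_function g ->
  T (fun x => f x - g x) = T f - T g.
Proof. by move=> hT tf tg; rewrite dist_add ?dist_opp//; exact: test_opp. Qed.

Lemma dist_sum T (I : Type) (r : seq I) (F : I -> R -> R) : distribution T ->
  (forall i, test_function (F i)) ->
  T (fun x => \sum_(i <- r) F i x) = \sum_(i <- r) T (F i).
Proof.
move=> hT tF; elim: r => [|i r IH].
  rewrite big_nil (_ : (fun x => _) = fun=> 0) ?dist0//.
  by apply/funext => x; rewrite big_nil.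
rewrite big_cons -IH -dist_add//; last exact: test_sum.
by congr T; apply/funext => x; rewrite big_cons.
Qed.

Lemma dist_bound T p q : distribution T -> exists (C : R) (N : nat), 0 <= C /\
  forall phi M, smooth phi -> supp_in p q phi ->
    (forall k x, (k <= N)%N -> `|phi^[k] x| <= M) -> `|T phi| <= C * M.
Proof.
move=> hT; have [_ /(_ _ (@segment_compact R p q))[C [N h]]] := hT.
exists C, N; split.
  (* The zero function with M = 1 shows 0 <= C. *)
  have := h (fun=> 0) 1 (@test_cst0 R).
  rewrite dist0// normr0 mulr1; apply.
    by apply: supp_in_fsupport => x.
  move=> k x _; rewrite (@derive1n_near0 R (fun=> 0) x k) ?normr0//.
  exact: filterE.
move=> phi M sphi hphi; apply: h; first exact: supp_in_test hphi.
exact: supp_in_fsupport.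
Qed.

(** The Leibniz rule moves the support condition onto [chi], so a smooth A is measured by its
    derivatives on [p, q] alone. This is how T acts on heat kernels, whose support is not
    compact. *)
Lemma dist_chi_bound T chi p q : p <= q -> distribution T -> smooth chi -> supp_in p q chi ->
  exists (C : R) (N : nat), 0 <= C /\
  forall A M, smooth A ->
    (forall k x, (k <= N)%N -> p <= x <= q -> `|A^[k] x| <= M) ->
    `|T (fun x => chi x * A x)| <= C * M.
Proof.
move=> pq hT schi hchi; have [C [N [C0 h]]] := dist_bound p q hT.
have tchi := supp_in_test schi hchi.
have [B B0 hB] := test_bounded N tchi.
exists (C * (2 ^+ N * B)), N; split; first by rewrite !mulr_ge0// exprn_ge0.
move=> A M sA hA; rewrite -mulrA; apply: h.
- exact: smooth_mul.
- exact: supp_in_mulr.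
move=> k x kN.
have M0 : 0 <= M by apply: le_trans (hA 0%N p _ _); rewrite ?lexx.
have [hx|hx] := boolP (p <= x <= q); last first.
  rewrite (supp_in_derive1n k (supp_in_mulr A hchi) hx) normr0.
  by rewrite !mulr_ge0// exprn_ge0.
apply: le_trans (derive1n_mul_bound schi sA _ _) _.
- by move=> i ik; apply: hB; exact: leq_trans ik kN.
- by move=> i ik; apply: hA => //; exact: leq_trans ik kN.
rewrite mulrA; apply: ler_wpM2r; first exact: M0.
by rewrite ler_wpM2r// ler_weXn2l ?ler1n.
Qed.

(** Localisation of [psi] near x by nonnegative weights; the sign restriction lets positivity be
    localised as well as vanishing. *)
Definition good_radius (Q : (R -> R) -> Prop) psi (x e : R) : Prop :=
  forall phi, smooth phi -> (forall y, 0 <= phi y) -> supp_in (x - e) (x + e) phi ->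
    Q (fun y => phi y * psi y).

(** Compactness of [p, q] in the form of a Lebesgue number: near each point half of its own radius
    works. *)
Lemma good_radius_uniform Q psi p q :
  (forall x, p <= x <= q -> exists2 e, 0 < e & good_radius Q psi x e) ->
  exists2 e, 0 < e & forall x, p <= x <= q -> good_radius Q psi x e.
Proof.
move=> h; have /compact_near_coveringP cov := @segment_compact R p q.
have /filter_ex[e [e0 he]] : \forall e \near (0 : R)^'+,
    0 < e /\ `[p, q] `<=` good_radius Q psi ^~ e.
  apply: filterI; first exact: nbhs_right_gt.
  apply: (cov R (0 : R)^'+ (fun e x => good_radius Q psi x e)) => x /=.
  rewrite in_itv/= => /h[e e0 he].
  exists (ball x (e / 2), [set e' | e' <= e / 2]) => /=.
    split; first by apply: nbhsx_ballx; rewrite divr_gt0.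
    by apply: nbhs_right_le; rewrite divr_gt0.
  move=> [x' e'] /= [+ he'] phi sphi phi0 hphi.
  rewrite /ball/= ltr_norml => /andP[h1 h2].
  by apply: he => //; apply: supp_in_le hphi; lra.
by exists e => // x hx; apply: he; rewrite /= in_itv.
Qed.

(** Properties stable under sums are local. The weights are differences of consecutive translates of
    [step]; they telescope, so no normalising quotient arises. *)
Lemma partition_of_unity (Q : (R -> R) -> Prop) psi p q :
  (forall f g, test_function f -> test_function g -> Q f -> Q g ->
     Q (fun x => f x + g x)) -> Q (fun=> 0) ->
  smooth psi -> supp_in p q psi ->
  (forall x, p <= x <= q -> exists2 e, 0 < e & good_radius Q psi x e) -> Q psi.
Proof.
move=> Qadd Q0 spsi hpsi hg; have [pq|qp] := leP p q; last first.
  rewrite (_ : psi = fun=> 0)//; apply/funext => x; apply: hpsi.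
  by apply/negP => /andP[px xq]; have := le_lt_trans (le_trans px xq) qp; rewrite ltxx.
have [e e0 he] := good_radius_uniform hg.
pose h := e / 2; have h0 : 0 < h by rewrite divr_gt0.
(* [th i] rises from 0 to 1 on [p + (i-1)h, p + ih]. Hence [th i - th i.+1] is nonnegative, lives
   within h of p + ih, and the sum over i is 1 on [p, q]. *)
pose th (i : nat) y := step ((y - (p - h + i%:R * h)) * h^-1).
pose n := (Num.truncn ((q - p) / h)).+1.
have nh : q - p < n%:R * h.
  by rewrite -ltr_pdivrMr// truncnS_gt.
have nh' : n%:R * h <= q - p + h.
  rewrite /n -natr1 mulrDl mul1r lerD2r -ler_pdivlMr//.
  by rewrite truncn_le divr_ge0 ?subr_ge0// ltW.
have sth i : smooth (th i) by apply: smooth_affine; exact: smooth_step.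
pose pc i y := th i y - th i.+1 y.
have spc i : smooth (pc i) := smooth_sub (sth i) (sth i.+1).
have th1 i y : p + i%:R * h <= y -> th i y = 1.
  by move=> hy; rewrite /th step_eq1// ler_pdivlMr//; lra.
have th0 i y : y <= p - h + i%:R * h -> th i y = 0.
  by move=> hy; rewrite /th step_eq0// pmulr_lle0 ?invr_gt0//; lra.
have pc0 i y : 0 <= pc i y.
  rewrite subr_ge0; have [hy|hy] := leP (p + i%:R * h) y.
    by rewrite [leRHS]th1// step_le1.
  rewrite [leLHS]th0 ?step_ge0//; move: hy; rewrite -natr1 mulrDl mul1r; lra.
have hpc i : supp_in (p + i%:R * h - h) (p + i%:R * h + h) (pc i).
  move=> y; rewrite negb_and -!ltNge => /orP[hy|hy]; rewrite /pc.
    by rewrite !th0 ?subrr// -?natr1; lra.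
  by rewrite !th1 ?subrr// -?natr1; lra.
have tpsi := supp_in_test spsi hpsi.
have tpc i : test_function (fun y => pc i y * psi y) := test_mull (spc i) tpsi.
have Qpc i : (i <= n)%N -> Q (fun y => pc i y * psi y).
  move=> iN; have [hi|hi] := leP (p + i%:R * h) q.
    apply: (he (p + i%:R * h) _ (pc i) (spc i) (pc0 i)).
      by rewrite hi andbT lerDl mulr_ge0// ltW.
    by apply: supp_in_le (hpc i); rewrite /h; lra.
  (* A centre beyond q exceeds it by at most h, so the radius e = 2h about q covers this piece. *)
  apply: (he q _ (pc i) (spc i) (pc0 i)); first by rewrite pq lexx.
  have : i%:R * h <= n%:R * h by rewrite ler_wpM2r ?ler_nat// ltW.
  by move=> hin; apply: supp_in_le (hpc i); move: hin nh' hi; rewrite /h; lra.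
have Qsum k : (k <= n.+1)%N -> Q (fun y => \sum_(i < k) (pc i y * psi y)).
  elim: k => [_|k IH kn].
    by rewrite (_ : (fun y => _) = fun=> 0)//; apply/funext => y; rewrite big_ord0.
  rewrite (_ : (fun y => _) = (fun y => \sum_(i < k) (pc i y * psi y) + pc k y * psi y)).
    apply: Qadd; [exact: (@test_sum R _ _ _ (fun (i : 'I_k) y => pc i y * psi y))|exact: tpc|exact/IH/ltnW|].
    exact: Qpc.
  by apply/funext => y; rewrite big_ord_recr.
have := Qsum n.+1 (leqnn _).
rewrite (_ : (fun y => _) = psi)//; apply/funext => y.
rewrite -mulr_suml.
have [hy|hy] := boolP (p <= y <= q); last by rewrite hpsi ?mulr0.
rewrite -(big_mkord xpredT (fun i => pc i y)) /=.
have -> : \sum_(0 <= i < n.+1) pc i y = - \sum_(0 <= i < n.+1) (th i.+1 y - th i y).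
  by rewrite -sumrN; apply: eq_bigr => i _; rewrite opprB.
rewrite telescope_sumr// opprB; case/andP: hy => py yq.
rewrite th1 ?mul0r ?addr0// th0 ?subr0 ?mul1r//.
by move: nh; rewrite -natr1; lra.
Qed.

(** Positivity of T on the open interval ]c, d[: the supports stay in a compact [p, q] inside it. *)
Definition posd T (c d : R) : Prop := forall psi p q, smooth psi ->
  (forall x, 0 <= psi x) -> c < p -> q < d -> supp_in p q psi -> 0 <= T psi.

Lemma posd_local T c d : distribution T ->
  (forall x, c < x < d -> exists2 e, 0 < e & posd T (x - e) (x + e)) -> posd T c d.
Proof.
move=> hT h psi p q spsi psi0 cp qd hpsi.
apply: (@partition_of_unity (fun f => 0 <= T f) psi p q) => //.
- by move=> f g tf tg Tf Tg; rewrite dist_add// addr_ge0.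
- by rewrite dist0.
move=> x /andP[px xq]; have [|e e0 he] := h x; first by rewrite (lt_le_trans cp)//= (le_lt_trans xq).
exists (e / 2); first by rewrite divr_gt0.
move=> phi sphi phi0 hphi; apply: (he _ (x - e / 2) (x + e / 2)).
- exact: smooth_mul.
- by move=> y; rewrite mulr_ge0.
- lra.
- lra.
- exact: supp_in_mulr.
Qed.

(** Near each point either [psi] vanishes, if the point is in the support of T, or T does; a
    partition of unity glues the two cases. *)
Lemma dist_vanish T psi : distribution T -> test_function psi ->
  (forall x, dsupport T x -> \forall y \near x, psi y = 0) -> T psi = 0.
Proof.
move=> hT tpsi h; have [A A0 hA] := test_supp_in tpsi.
apply: (@partition_of_unity (fun f => T f = 0) psi (- A) A) => //.
- by move=> f g tf tg Tf Tg; rewrite dist_add// Tf Tg addr0.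
- exact: dist0.
- exact: test_smooth.
move=> x hx; have [/h|] := pselect (dsupport T x).
  move=> /nbhs_ballP[e /= e0 he]; exists (e / 2); first by rewrite divr_gt0.
  move=> phi sphi phi0 hphi.
  rewrite (_ : (fun y => _) = fun=> 0) ?dist0//; apply/funext => y.
  have [hy|hy] := boolP (x - e / 2 <= y <= x + e / 2); last by rewrite hphi// mul0r.
  rewrite he ?mulr0//; rewrite /ball/= ltr_norml; lra.
rewrite /dsupport /setC /= => /contrapT[V [oV vV] Vx].
have /nbhs_ballP[e /= e0 he] : nbhs x V by exact: open_nbhs_nbhs.
exists (e / 2); first by rewrite divr_gt0.
move=> phi sphi phi0 hphi; apply: vV; first exact: test_mull.
have /supp_in_fsupport hs := supp_in_mulr psi hphi.
apply: (subset_trans hs) => y /=; rewrite in_itv/= => hy; apply: he.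
rewrite /ball/= ltr_norml; lra.
Qed.

(** Two admissible cutoffs differ by a function vanishing near the support of T, and T is 0 on such
    functions. So the value picked by [get] may be computed with any of them. *)
Lemma smooth_pairingE a b T chi phi : supported_distribution a b T ->
  test_function chi -> (forall x, a <= x <= b -> \forall y \near x, chi y = 1) ->
  smooth phi -> smooth_pairing T phi = T (fun x => chi x * phi x).
Proof.
move=> [hT sT] tchi chi1 sphi; rewrite /smooth_pairing; set S := [set y | _].
have chi1' : forall x, dsupport T x -> \forall y \near x, chi y = 1.
  by move=> x /sT /=; rewrite in_itv/= => /chi1.
have : S (get S).
  by apply: (@getPex _ S); exists (T (fun x => chi x * phi x)), chi.
move=> [chi' [tchi' chi'1] ->]; apply/eqP; rewrite -subr_eq0; apply/eqP.
have t1 := test_mulr tchi' sphi; have t2 := test_mulr tchi sphi.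
rewrite -(dist_sub hT t1 t2); apply: (dist_vanish hT (test_sub t1 t2)).
move=> x hx; apply: filterS2 (chi1' x hx) (chi'1 x hx) => y -> ->.
by rewrite subrr.
Qed.

(** Differentiation in a parameter under T. Against [chi] the distribution has finite order N, so
    finitely many y-derivatives of the remainder enter, and C and e may depend on j. *)
Lemma dist_derive T chi (A : R -> R -> R) (B : R -> R) (x : R) :
  distribution T -> test_function chi -> (forall e, smooth (A e)) -> smooth B ->
  (forall j, exists (C e : R), 0 < e /\ forall h, `|h| < e -> forall y,
     `|(A (x + h))^[j] y - (A x)^[j] y - h * B^[j] y| <= C * h ^+ 2) ->
  is_derive x 1 (fun e => T (fun y => chi y * A e y)) (T (fun y => chi y * B y)).
Proof.
move=> hT tchi sA sB H.
have [D D0 hD] := test_supp_in tchi.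
have DD : - D <= D by lra.
have [K [N [K0 hK]]] := dist_chi_bound DD hT (test_smooth tchi) hD.
have [C [e [e0 hC]]] : exists (C e : R), 0 < e /\ forall h, `|h| < e ->
    forall j y, (j <= N)%N ->
     `|(A (x + h))^[j] y - (A x)^[j] y - h * B^[j] y| <= C * h ^+ 2.
  elim: N {K K0 hK} => [|N [C [e [e0 hC]]]].
    have [C [e [e0 hC]]] := H 0%N; exists C, e; split=> // h he [|//] y _.
    exact: hC.
  have [C' [e' [e'0 hC']]] := H N.+1.
  exists (Num.max C C'), (Num.min e e'); split; first by rewrite lt_min e0.
  move=> h; rewrite lt_min => /andP[he he'] j y.
  rewrite leq_eqVlt ltnS => /orP[/eqP ->|jN].
    by apply: le_trans (hC' h he' y) _; rewrite ler_wpM2r ?sqr_ge0// le_max lexx orbT.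
  by apply: le_trans (hC h he j y jN) _; rewrite ler_wpM2r ?sqr_ge0// le_max lexx.
apply: (@is_derive_quadratic _ _ _ _ (K * C) e) => // h he.
have -> : T (fun y => chi y * A (x + h) y) - T (fun y => chi y * A x y) -
    h * T (fun y => chi y * B y) =
    T (fun y => chi y * (A (x + h) y - A x y - h * B y)).
  have t1 := test_mulr tchi (sA (x + h)); have t2 := test_mulr tchi (sA x).
  have t3 := test_mulr tchi sB.
  rewrite -(dist_scale h hT t3) -(dist_sub hT t1 t2).
  rewrite -(dist_sub hT (test_sub t1 t2) (test_scale h t3)).
  by congr T; apply/funext => y; ring.
have s1 : smooth (fun y => A (x + h) y - A x y) := smooth_sub (sA (x + h)) (sA x).
have s2 : smooth (fun y => h * B y) := @smooth_scale R h B sB.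
rewrite -mulrA; apply: hK; first exact: smooth_sub s1 s2.
move=> j y jN _.
have := derive1n_sub j s1 s2 => /(congr1 (fun k => k y)) /= ->.
rewrite derive1n_scale//.
have := derive1n_sub j (sA (x + h)) (sA x) => /(congr1 (fun k => k y)) /= ->.
exact: hC.
Qed.

End Distributions.

(** * The heat kernel *)

Section Gaussian.
Context {R : realType}.
Implicit Types (x y w z t : R).

Definition gk y : R := (Num.sqrt pi)^-1 * gauss_fun y.

Lemma gk_gt0 y : 0 < gk y.
Proof. by rewrite mulr_gt0 ?expR_gt0// invr_gt0 sqrtr_gt0 pi_gt0. Qed.

Lemma gk_ge0 y : 0 <= gk y. Proof. exact/ltW/gk_gt0. Qed.

Lemma gkN y : gk (- y) = gk y.
Proof. by rewrite /gk /gauss_fun sqrrN. Qed.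

Lemma is_derive_gk y : is_derive y 1 gk (- (2 * y) * gk y).
Proof.
have h : is_derive y 1 (fun z : R => - (z ^+ 2)) (- (2 * y)).
  apply: (@is_derive_ext _ (fun z => -1 * (z * z))).
    by move=> z; rewrite mulN1r expr2.
  apply: (is_derive_eq1 (is_derive_scale (-1)
    (is_derive_mul (is_derive_id y 1) (is_derive_id y 1)))).
  by ring.
apply: (is_derive_eq1 (is_derive_scale _ (is_derive_chain (is_derive_expR _) h))).
by rewrite /gk /gauss_fun; ring.
Qed.

Lemma smooth_gk : smooth gk.
Proof.
apply/smoothP => m; elim: m => [//|m IH]; split=> [y|].
  by have [] := is_derive_gk y.
have -> : gk^[1] = (fun y => - (2 * y) * gk y).
  by apply/funext => y; exact: is_derive_derive1 (is_derive_gk y).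
apply: Ck_mul => //.
by have /smoothP := smooth_opp (@smooth_scale _ 2 _ (@smooth_id R)).
Qed.

(** The Hermite recurrence, obtained by differentiating g' = -2 y g repeatedly. *)
Lemma gk_rec m y : gk^[m.+2] y = - (2 * y) * gk^[m.+1] y - 2 * m.+1%:R * gk^[m] y.
Proof.
have h1 z : is_derive z 1 (fun z : R => - (2 * z)) (-2).
  apply: (@is_derive_ext _ (fun z => -2 * z)); first by move=> u; rewrite mulNr.
  by apply: (is_derive_eq1 (is_derive_scale (-2) (is_derive_id z 1))); rewrite mulr1.
elim: m y => [|m IH] y; rewrite derive1nS -derive1n1; apply: is_derive_derive1.
  have -> : gk^[1] = (fun y => - (2 * y) * gk y).
    by apply/funext => z; exact: is_derive_derive1 (is_derive_gk z).
  by apply: (is_derive_eq1 (is_derive_mul (h1 y) (is_derive_gk y))); rewrite derive1n0; ring.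
apply: (@is_derive_ext _ (fun y => - (2 * y) * gk^[m.+1] y + - (2 * m.+1%:R) * gk^[m] y)).
  by move=> z; rewrite IH mulNr.
have d k := smooth_is_derive k y smooth_gk.
apply: (is_derive_eq1 (is_derive_add (is_derive_mul (h1 y) (d m.+1))
  (is_derive_scale _ (d m)))).
by rewrite -[m.+2%:R]natr1; ring.
Qed.

Lemma norm_le_expR (d w : R) : 0 < d -> `|w| <= (1 + d^-1) * expR (d * w ^+ 2).
Proof.
move=> d0; have e1 : 1 + d * w ^+ 2 <= expR (d * w ^+ 2) by exact: expR_ge1Dx.
apply: (@le_trans _ _ ((1 + d^-1) * (1 + d * w ^+ 2))); last first.
  by rewrite ler_wpM2l// addr_ge0// invr_ge0 ltW.
rewrite mulrDr mulr1 [(_ + _) * (d * _)]mulrDl mul1r mulrA mulVf ?gt_eqF// mul1r.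
have : `|w| <= 1 + w ^+ 2.
  rewrite -[w ^+ 2]real_normK ?num_real//.
  have : 0 <= (`|w| - 1) ^+ 2 by exact: sqr_ge0.
  rewrite sqrrB mulr1 expr1n; have := normr_ge0 w; lra.
have : 0 <= d^-1 by rewrite invr_ge0 ltW.
have : 0 <= d * w ^+ 2 by rewrite mulr_ge0 ?sqr_ge0// ltW.
lra.
Qed.

(** Each factor w produced by differentiation is paid for by a small part of the Gaussian exponent;
    using d / 2 for one term of the recurrence leaves room for one factor. *)
Lemma gk_derive_expR m (d : R) : 0 < d ->
  exists2 B, 0 <= B & forall w, `|gk^[m] w| <= B * expR (- (1 - d) * w ^+ 2).
Proof.
move: d; have [n] := ubnP m; elim: n m => [//|n IH] [_|[_|m hm]] d d0.
- exists (Num.sqrt pi)^-1 => [|w]; first by rewrite invr_ge0 sqrtr_ge0.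
  rewrite /= ger0_norm ?gk_ge0// /gk ler_wpM2l ?invr_ge0 ?sqrtr_ge0//.
  by rewrite ler_expR mulNr lerN2 ler_piMl ?sqr_ge0//; lra.
- exists (2 * (1 + d^-1) * (Num.sqrt pi)^-1) => [|w].
    by rewrite !mulr_ge0 ?invr_ge0 ?sqrtr_ge0// addr_ge0// invr_ge0 ltW.
  rewrite (is_derive_derive1 (is_derive_gk w)) normrM normrN normrM.
  rewrite (ger0_norm (gk_ge0 _)) (ger0_norm (ler0n _ 2)) -!mulrA ler_wpM2l//.
  rewrite /gk /gauss_fun mulrCA [leRHS]mulrCA ler_wpM2l ?invr_ge0 ?sqrtr_ge0//.
  have -> : - (1 - d) * w ^+ 2 = d * w ^+ 2 + - w ^+ 2 by ring.
  by rewrite expRD mulrA ler_wpM2r ?expR_ge0// norm_le_expR.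
have d2 : 0 < d / 2 by rewrite divr_gt0.
have [B1 B10 h1] := IH m.+1 hm _ d2.
have [B0 B00 h0] := IH m (ltnW hm) _ d0.
exists (2 * (1 + (d / 2)^-1) * B1 + 2 * m.+1%:R * B0) => [|w].
  by rewrite addr_ge0// !mulr_ge0// addr_ge0// invr_ge0 ltW.
rewrite gk_rec; apply: le_trans (ler_normB _ _) _; rewrite [leRHS]mulrDl; apply: lerD.
  rewrite normrM normrN normrM (ger0_norm (ler0n _ 2)).
  have -> : - (1 - d) * w ^+ 2 = d / 2 * w ^+ 2 + - (1 - d / 2) * w ^+ 2 by field.
  rewrite expRD.
  have := ler_pM (normr_ge0 w) (normr_ge0 (gk^[m.+1] w)) (norm_le_expR w d2) (h1 w).
  move: (expR _) (expR _) (_^-1) => u v c hw; rewrite -!mulrA ler_wpM2l//.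
  by apply: le_trans hw _; rewrite le_eqVlt; apply/orP; left; apply/eqP; ring.
rewrite normrM ger0_norm ?mulr_ge0// -!mulrA ler_wpM2l// ler_wpM2l//.
Qed.

Lemma expr_expR_bounded (k : nat) (d : R) : 0 < d ->
  exists2 B, 0 <= B & forall w, `|w| ^+ k * expR (- (d * w ^+ 2)) <= B.
Proof.
elim: k d => [|k IH] d d0.
  exists 1 => // w; rewrite expr0 mul1r -expR0 ler_expR oppr_le0.
  by rewrite mulr_ge0 ?sqr_ge0// ltW.
have d2 : 0 < d / 2 by rewrite divr_gt0.
have [B B0 h] := IH _ d2; exists ((1 + (d / 2)^-1) * B) => [|w].
  by rewrite mulr_ge0// addr_ge0// invr_ge0 ltW.
have -> : - (d * w ^+ 2) = - (d / 2 * w ^+ 2) + - (d / 2 * w ^+ 2) by field.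
rewrite expRD exprS mulrACA; apply: ler_pM; rewrite ?mulr_ge0 ?expR_ge0 ?exprn_ge0//.
by rewrite expRN ler_pdivrMr ?expR_gt0// norm_le_expR.
Qed.

Lemma gk_derive_decay m k :
  exists2 B, 0 <= B & forall w, `|w| ^+ k * `|gk^[m] w| <= B.
Proof.
have h2 : 0 < (2^-1 : R) by rewrite invr_gt0.
have [B B0 hB] := gk_derive_expR m h2; have [D D0 hD] := expr_expR_bounded k h2.
exists (B * D) => [|w]; first by rewrite mulr_ge0.
apply: le_trans (ler_wpM2l _ (hB w)) _; first by rewrite exprn_ge0.
rewrite mulrCA ler_wpM2l//; apply: le_trans (hD w); rewrite ler_wpM2l ?exprn_ge0//.
by rewrite ler_expR; lra.
Qed.

Lemma gk_bounded m : exists2 B, 0 <= B & forall w, `|gk^[m] w| <= B.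
Proof.
have [B B0 hB] := gk_derive_decay m 0; exists B => // w.
by rewrite -[leLHS]mul1r -[1](expr0 `|w|).
Qed.

Lemma gk_testT1 : testT1 gk.
Proof.
split; last first.
  move=> y; rewrite -derive1n1 (is_derive_derive1 (is_derive_gk y)).
  rewrite mulrA mulrN mulNr oppr_le0 mulr_ge0 ?gk_ge0// mulrCA mulr_ge0//.
  by rewrite -expr2 sqr_ge0.
split; [exact: smooth_gk|exact: gk_ge0| |].
  under eq_integral do rewrite /gk EFinM.
  rewrite integralZl//; last exact: integrableT_gauss.
  by rewrite integralT_gauss -EFinM mulVf// gt_eqF// sqrtr_gt0 pi_gt0.
(* With alpha = -2 the exponent alpha - m is the integer -(m + 2), matched by decay of order m +
   2. *)
exists (-2) => [|m]; first by lra.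
have [B B0 hB] := gk_derive_decay m (m + 2); exists B.
have main x : x != 0 -> `|gk^[m] x| <= B * `|x| `^ (-2 - m%:R).
  move=> x0; have -> : -2 - m%:R = - (m + 2)%:R :> R by rewrite natrD; ring.
  rewrite powR_invn// ler_pdivlMr ?exprn_gt0 ?normr_gt0// mulrC.
  exact: hB.
split.
- have : \forall x \near (+oo : set_system R), 0 < x by exact: nbhs_pinfty_gt.
  by apply: filterS => x x0; apply: main; rewrite gt_eqF.
- have : \forall x \near (-oo : set_system R), x < 0 by exact: nbhs_ninfty_lt.
  by apply: filterS => x x0; apply: main; rewrite lt_eqF.
Qed.

(* The m-th derivative in y of the heat kernel t^-1 gk ((y - x) / t). *)
Definition hker m x t y : R := t^-1 ^+ m.+1 * gk^[m] ((y - x) * t^-1).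

Lemma smooth_hker m x t : smooth (hker m x t).
Proof.
by apply: smooth_scale; apply: smooth_affine; exact/smooth_derive1n/smooth_gk.
Qed.

Lemma derive1n_hker m j x t : (hker m x t)^[j] = hker (m + j) x t.
Proof.
rewrite /hker derive1n_scale; last by apply: smooth_affine; exact/smooth_derive1n/smooth_gk.
rewrite derive1n_affine; last exact/smooth_derive1n/smooth_gk.
apply/funext => y; rewrite -derive1nD mulrA -exprD addSn [in RHS]addnC.
by rewrite [(j + m)%N]addnC.
Qed.

Lemma hker_bounded m (t0 : R) : 0 < t0 ->
  exists2 B, 0 <= B & forall x t y, t0 <= t -> `|hker m x t y| <= B.
Proof.
move=> t00; have [B B0 hB] := gk_bounded m.
exists (t0^-1 ^+ m.+1 * B) => [|x t y tt].
  by rewrite mulr_ge0// exprn_ge0// invr_ge0 ltW.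
have t0' : 0 < t by exact: lt_le_trans tt.
rewrite normrM; apply: ler_pM => //.
have v0 : 0 <= t^-1 by rewrite invr_ge0 ltW.
have w0 : 0 <= t0^-1 by rewrite invr_ge0 ltW.
by rewrite normrX (ger0_norm v0) lerXn2r ?nnegrE// lef_pV2 ?posrE.
Qed.

(** Decay of order m + 2 of the profile turns the factor t^-(m+1) into t / r^(m+2). *)
Lemma hker_far m (r e : R) : 0 < r -> 0 < e ->
  exists2 t0, 0 < t0 & forall x t y, 0 < t < t0 -> r <= `|y - x| ->
    `|hker m x t y| <= e.
Proof.
move=> r0 e0; have [B B0 hB] := gk_derive_decay m m.+2.
have B1 : 0 < B + 1 by lra.
exists (e * r ^+ m.+2 / (B + 1)) => [|x t y /andP[t0 ht] hr].
  by rewrite divr_gt0// mulr_gt0// exprn_gt0.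
have := hB ((y - x) * t^-1).
have v0 : 0 <= t^-1 by rewrite invr_ge0 ltW.
rewrite normrM (ger0_norm v0) exprMn => h.
rewrite /hker normrM normrX (ger0_norm v0).
have rm : 0 < r ^+ m.+2 by rewrite exprn_gt0.
rewrite -(ler_pM2l rm).
apply: (@le_trans _ _ (t * B)); last first.
  apply: (@le_trans _ _ (t * (B + 1))); first by rewrite ler_wpM2l ?(ltW t0)// lerDl.
  by rewrite -ler_pdivlMr// [r ^+ _ * e]mulrC ltW.
apply: le_trans (ler_wpM2l (ltW t0) h).
have tv : t * t^-1 = 1 by rewrite mulfV ?gt_eqF.
have -> : t * (`|y - x| ^+ m.+2 * t^-1 ^+ m.+2 * `|gk^[m] ((y - x) * t^-1)|) =
    `|y - x| ^+ m.+2 * (t^-1 ^+ m.+1 * `|gk^[m] ((y - x) * t^-1)|).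
  rewrite (exprS t^-1 m.+1); transitivity ((t * t^-1) *
    (`|y - x| ^+ m.+2 * (t^-1 ^+ m.+1 * `|gk^[m] ((y - x) * t^-1)|))); first by ring.
  by rewrite tv mul1r.
apply: ler_pM => //; first exact: ltW.
  by rewrite mulr_ge0// exprn_ge0// invr_ge0 ltW.
by rewrite lerXn2r ?nnegrE ?(ltW r0).
Qed.

Lemma is_derive_hker_x m x t y :
  is_derive x 1 (fun x => hker m x t y) (- hker m.+1 x t y).
Proof.
have h : is_derive x 1 (fun x => (y - x) * t^-1) (- t^-1).
  apply: (@is_derive_ext _ (fun x => (x - y) * - t^-1)).
    by move=> z; rewrite mulrN -mulNr opprB.
  exact: is_derive_affine1.
apply: (is_derive_eq1 (is_derive_scale _
  (is_derive_chain (smooth_is_derive m _ smooth_gk) h))).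
by rewrite /hker !exprS; ring.
Qed.

(** The heat equation with t as a length scale, physical time being proportional to t^2; it is the
    Hermite recurrence rescaled. *)
Lemma is_derive_hker_t m x t y : 0 < t ->
  is_derive t 1 (fun t => hker m x t y) (t / 2 * hker m.+2 x t y).
Proof.
move=> t0; have tn0 := lt0r_neq0 t0.
have hv : is_derive t 1 (fun u : R => u^-1) (- (t^-1 * t^-1)).
  by have := @is_derive_inv _ (fun u => u) t 1 tn0 (is_derive_id t 1); rewrite mulN1r.
have hp k : is_derive t 1 (fun u : R => u^-1 ^+ k) (- k%:R * t^-1 ^+ k.+1).
  elim: k => [|k IH].
    apply: (@is_derive_ext _ (fun=> 1)); first by move=> u; rewrite expr0.
    by rewrite oppr0 mul0r; exact: is_derive_cst.
  apply: (@is_derive_ext _ (fun u => u^-1 * u^-1 ^+ k)); first by move=> u; rewrite exprS.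
  apply: (is_derive_eq1 (is_derive_mul hv IH)).
  by rewrite [in RHS]mulrS !exprS; ring.
have hz := is_derive_scale (y - x) hv.
apply: (is_derive_eq1 (is_derive_mul (hp m.+1)
  (is_derive_chain (smooth_is_derive m _ smooth_gk) hz))).
rewrite /hker gk_rec; set v := t^-1.
have tv : t = v^-1 by rewrite invrK.
rewrite tv !exprS; have v0 : v != 0 by rewrite invr_eq0.
by field.
Qed.

(* Convolution of a distribution with the heat kernel and its derivatives, up to sign. *)
Definition hconv (T : (R -> R) -> R) (chi : R -> R) m x t : R :=
  T (fun y => chi y * hker m x t y).

Lemma is_derive_hconv_x T chi m x t : distribution T -> test_function chi -> 0 < t ->
  is_derive x 1 (fun x => hconv T chi m x t) (- hconv T chi m.+1 x t).
Proof.
move=> hT tchi t0.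
have -> : - hconv T chi m.+1 x t = T (fun y => chi y * - hker m.+1 x t y).
  rewrite /hconv -dist_opp//; last by apply: test_mulr => //; exact: smooth_hker.
  by congr T; apply/funext => y; rewrite mulrN.
apply: (@dist_derive R T chi (fun x y => hker m x t y)) => //.
- by move=> e; exact: smooth_hker.
- by apply: smooth_opp; exact: smooth_hker.
move=> j; have [B B0 hB] := hker_bounded (m + j).+2 t0.
exists B, 1; split=> // h _ y.
rewrite derive1n_opp; last exact: smooth_hker.
rewrite !derive1n_hker addSn.
have := @taylor2 R (fun x => hker (m + j) x t y) (fun x => - hker (m + j).+1 x t y)
  (fun x => hker (m + j).+2 x t y) x (x + h) B.
rewrite addrC addKr; apply.
- by move=> z _; exact: is_derive_hker_x.
- move=> z _; apply: (@is_derive_ext _ (fun x => -1 * hker (m + j).+1 x t y)).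
    by move=> u; rewrite mulN1r.
  apply: (is_derive_eq1 (is_derive_scale (-1) (is_derive_hker_x _ _ _ _))).
  by rewrite mulN1r opprK.
- by move=> z _; exact: hB.
Qed.

Lemma is_derive_hconv_t T chi m x t : distribution T -> test_function chi -> 0 < t ->
  is_derive t 1 (fun t => hconv T chi m x t) (t / 2 * hconv T chi m.+2 x t).
Proof.
move=> hT tchi t0.
have -> : t / 2 * hconv T chi m.+2 x t = T (fun y => chi y * (t / 2 * hker m.+2 x t y)).
  rewrite /hconv -dist_scale//; last by apply: test_mulr => //; exact: smooth_hker.
  by congr T; apply/funext => y; rewrite mulrCA.
apply: (@dist_derive R T chi (fun t y => hker m x t y)) => //.
- by move=> e; exact: smooth_hker.
- by apply: smooth_scale; exact: smooth_hker.
have t2 : 0 < t / 2 by rewrite divr_gt0.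
move=> j; have [B B0 hB] := hker_bounded (m + j).+2 t2.
have [D D0 hD] := hker_bounded (m + j).+4 t2.
(* The second t-derivative of the kernel of order k is half of the one of order k + 2 plus (t/2)^2
   times the one of order k + 4. Increments below t / 2 keep the scale between t / 2 and 2t, where
   both are bounded. *)
exists (2^-1 * B + t ^+ 2 * D), (t / 2); split=> // h ht y.
rewrite derive1n_scale; last exact: smooth_hker.
rewrite !derive1n_hker !addSn.
have := @taylor2 R (fun t => hker (m + j) x t y) (fun t => t / 2 * hker (m + j).+2 x t y)
  (fun t => 2^-1 * hker (m + j).+2 x t y + (t / 2) ^+ 2 * hker (m + j).+4 x t y) t (t + h)
  (2^-1 * B + t ^+ 2 * D).
have hz z : `|z - t| <= `|h| -> t / 2 <= z <= 2 * t.
  by move=> /le_lt_trans/(_ ht); rewrite ltr_norml; lra.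
rewrite [t + h]addrC addrK [h + t]addrC; apply.
- by move=> z /hz hzt; apply: is_derive_hker_t; lra.
- move=> z /hz hzt; have z0 : 0 < z by lra.
  have h1 : is_derive z 1 (fun t : R => t / 2) 2^-1.
    apply: (@is_derive_ext _ (fun t => 2^-1 * t)); first by move=> u; rewrite mulrC.
    by apply: (is_derive_eq1 (is_derive_scale 2^-1 (is_derive_id z 1))); rewrite mulr1.
  apply: (is_derive_eq1 (is_derive_mul h1 (is_derive_hker_t (m + j).+2 x y z0))) => /=.
  by move: (hker (m + j).+4 x z y) (hker (m + j).+2 x z y) => u1 u2; ring.
- move=> z /hz hzt; apply: le_trans (ler_normD _ _) _; apply: lerD.
    rewrite normrM ger0_norm ?invr_ge0// ler_wpM2l ?invr_ge0//.
    by apply: hB; lra.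
  rewrite normrM; apply: ler_pM => //; last by apply: hD; lra.
  rewrite normrX lerXn2r ?nnegrE//; first by lra.
  by rewrite ger0_norm; lra.
Qed.

End Gaussian.

(** * Smooth sums of rapidly decreasing test functions *)

Section TestSeries.
Context {R : realType}.
Variables (N : nat) (th : nat -> R -> R) (e : nat -> R).
Hypothesis th_smooth : forall k, smooth (th k).
Hypothesis th_supp : forall k, supp_in (-1) 1 (th k).
Hypothesis e_gt0 : forall k, 0 < e k.
Hypothesis e_half : forall k, e k.+1 <= e k / 2.
Hypothesis th_le : forall k j x, (j <= N + k)%N -> `|(th k)^[j] x| <= e k.

Let S (j K : nat) (x : R) : R := \sum_(k < K) (th k)^[j] x.

(** As e (K'+1) <= e K' / 2, the term e K' is at most 2 e K' - 2 e (K'+1), and these bounds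
    telescope. *)
Let S_cauchy j K K' x : (j <= N + K)%N -> (K <= K')%N ->
  `|S j K' x - S j K x| <= 2 * e K - 2 * e K'.
Proof.
move=> jK; elim: K' => [|K' IH]; first by rewrite leqn0 => /eqP ->; rewrite !subrr normr0.
rewrite leq_eqVlt => /orP[/eqP ->|]; first by rewrite !subrr normr0.
rewrite ltnS => KK'; have {IH} := IH KK'.
have : `|(th K')^[j] x| <= e K'.
  by apply: th_le; rewrite (leq_trans jK)// leq_add2l.
rewrite /S big_ord_recr /=; set a := \sum_(_ < _) _; set b := \sum_(_ < _) _.
set c := (th K')^[j] x => hc hab.
have -> : a + c - b = a - b + c by ring.
apply: le_trans (ler_normD _ _) _; have := e_half K'; lra.
Qed.

(** The limit of the partial sums, written as the supremum of the lower bounds that the geometric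
    tails provide. *)
Let G (j : nat) (x : R) : R := sup [set S j K x - 2 * e K | K in [set K | (j <= N + K)%N]].

Let G_dist j K x : (j <= N + K)%N -> `|G j x - S j K x| <= 2 * e K.
Proof.
move=> jK; rewrite /G; set A := (X in sup X).
have ub K' : (j <= N + K')%N -> ubound A (S j K' x + 2 * e K').
  move=> jK' _ [K'' /= jK'' <-]; have e1 := e_gt0 K'; have e2 := e_gt0 K''.
  have [h|h] := leqP K' K''.
    by have := S_cauchy x jK' h; rewrite ler_norml; lra.
  by have := S_cauchy x jK'' (ltnW h); rewrite ler_norml; lra.
have A0 : A !=set0 by exists (S j K x - 2 * e K), K.
rewrite ler_distlC; apply/andP; split.
  by rewrite lerBlDr; apply: ge_sup => //; exact: ub.
rewrite -lerBlDr; apply: ub_le_sup; last by exists K.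
by exists (S j K x + 2 * e K); exact: ub.
Qed.

Let e_small (d : R) : 0 < d -> exists K, forall K', (K <= K')%N -> e K' <= d.
Proof.
move=> d0; have eK K : e K <= e 0%N / (K.+1)%:R.
  elim: K => [|K IH]; first by rewrite divr1.
  apply: le_trans (e_half K) _.
  apply: (@le_trans _ _ (e 0%N / K.+1%:R / 2)); first by rewrite ler_wpM2r.
  rewrite -mulrA ler_wpM2l ?(ltW (e_gt0 _))//.
  by rewrite -invfM lef_pV2 ?posrE// -natrM ler_nat; lia.
exists (Num.truncn (e 0%N / d)) => K' hK'; apply: le_trans (eK K') _.
rewrite ler_pdivrMr// -ler_pdivrMl// mulrC ltW//.
by apply: lt_le_trans (truncnS_gt _) _; rewrite ler_nat.
Qed.

Let sS j K : smooth (S j K).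
Proof. by apply: smooth_sum => i; exact: smooth_derive1n. Qed.

Let is_derive_S j K (x : R) : is_derive x 1 (S j K) (S j.+1 K x).
Proof.
apply: (is_derive_eq1 (smooth_is_derive 0 x (@sS j K))).
rewrite /S derive1n_sum; last by move=> i; exact: smooth_derive1n.
by apply: eq_bigr => i _; rewrite derive1n1 derive1nS.
Qed.

(** The second derivatives of the partial sums are bounded uniformly in K, so their quadratic Taylor
    remainder passes to the limit; the three approximation errors add up to at most 6 e K'. *)
Let is_derive_G j (x : R) : is_derive x 1 (G j) (G j.+1 x).
Proof.
have [M hM] : exists M, forall K y, (j.+2 <= N + K)%N -> `|S j.+2 K y| <= M.
  have [B B0 hB] : exists2 B, 0 <= B & forall y, `|S j.+2 j.+2 y| <= B.
    have tS : test_function (S j.+2 j.+2).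
      apply: (@test_sum R _ _ _ (fun (i : 'I_j.+2) => (th i)^[j.+2])) => i.
      by apply: test_derive1n; apply: (@supp_in_test _ (-1) 1).
    have [B B0 hB] := test_bounded 0 tS.
    by exists B => // y; exact: (hB 0%N).
  exists (B + 2 * e j.+2 + 2 * e 0%N) => K y jK.
  have : `|G j.+2 y - S j.+2 j.+2 y| <= 2 * e j.+2 by apply: G_dist; rewrite leq_addl.
  have := G_dist y jK; have := hB y; rewrite !ler_norml.
  have : e K <= e 0%N.
    elim: K {jK} => [//|K IH]; have := e_half K; have := e_gt0 K; lra.
  lra.
apply: (@is_derive_quadratic _ _ _ _ M 1) => // h h1.
apply/ler_addgt0Pr => d d0; have [K hK] := e_small (divr_gt0 d0 (ltr0n _ 6)).
have {}hK := hK _ (leq_addl j.+2 K); set K' := (j.+2 + K)%N in hK.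
have jK' : (j.+2 <= N + K')%N by rewrite /K'; lia.
have g1 := G_dist (x + h) (ltnW (ltnW jK')); have g2 := G_dist x (ltnW (ltnW jK')).
have g3 := G_dist x (ltnW jK').
have := @taylor2 R (S j K') (S j.+1 K') (S j.+2 K') x (x + h) M.
rewrite [x + h - x]addrC addKr => /(_ _ _ _)ht.
have {}ht : `|S j K' (x + h) - S j K' x - h * S j.+1 K' x| <= M * h ^+ 2.
  apply: ht => z _; [exact: is_derive_S|exact: is_derive_S|exact: hM].
have g3' : `|h * (G j.+1 x - S j.+1 K' x)| <= 2 * e K'.
  rewrite normrM -[leRHS]mul1r; apply: ler_pM => //; exact: ltW.
have -> : G j (x + h) - G j x - h * G j.+1 x =
   (G j (x + h) - S j K' (x + h)) - (G j x - S j K' x) - h * (G j.+1 x - S j.+1 K' x)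
   + (S j K' (x + h) - S j K' x - h * S j.+1 K' x) by ring.
move: g1 g2 g3' ht; rewrite !ler_norml; lra.
Qed.

(** Since the bound on [th k] covers derivatives up to order N + k, derivatives of any fixed order
    converge once finitely many terms are set aside. The sum is the function on which the gliding
    hump argument fails to be bounded. *)
Lemma test_series : exists2 F : R -> R, smooth F /\ supp_in (-1) 1 F &
  forall K j x, (j <= N + K)%N -> `|F^[j] x - \sum_(k < K) (th k)^[j] x| <= 2 * e K.
Proof.
exists (G 0%N); last first.
  by move=> K j x jK; rewrite (derive1n_family is_derive_G); exact: G_dist.
split; first exact: smooth_family is_derive_G.
move=> x hx; apply/eqP; rewrite -normr_le0; apply/ler_addgt0Pr => d d0.
have [K hK] := e_small (divr_gt0 d0 (ltr0n _ 2)).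
have := G_dist x (leq0n (N + K)); rewrite /S big1 ?subr0; last by move=> i _; rewrite derive1n0 th_supp.
move=> /le_trans; apply; have := hK K (leqnn _); rewrite add0r; lra.
Qed.

End TestSeries.

(** * Distributions without point masses *)

Section BanachSteinhaus.
Context {R : realType}.
Implicit Types (T : (R -> R) -> R) (al r : R) (f g psi theta : R -> R).

Definition rescale f al r : R -> R := fun y => f ((y - al) * r^-1).

(* [T] is of smaller order than a point mass at [al]. *)
Definition no_mass T al : Prop := forall theta, test_function theta ->
  forall e, 0 < e -> exists2 d, 0 < d &
    forall r, 0 < `|r| < d -> `|T (rescale theta al r)| <= e.

Lemma smooth_rescale f al r : smooth f -> smooth (rescale f al r).
Proof. exact: smooth_affine. Qed.

Lemma test_rescale f al r : r != 0 -> test_function f -> test_function (rescale f al r).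
Proof. by move=> r0; apply: test_affine; rewrite invr_eq0. Qed.

Lemma supp_in_rescale f al r : r != 0 -> supp_in (-1) 1 f ->
  supp_in (al - `|r|) (al + `|r|) (rescale f al r).
Proof.
move=> r0 h x hx; apply: h; apply: contra hx => hx.
by rewrite -ler_distl -[leRHS]mul1r -ler_pdivrMr ?normr_gt0// -normfV -normrM ler_norml.
Qed.

(** The crude bound, with the loss r^-N that absence of a point mass will remove. *)
Lemma dist_rescale_bound T al : distribution T -> exists (C : R) (N : nat), 0 <= C /\
  forall r f M, 0 < `|r| <= 1 -> smooth f -> supp_in (-1) 1 f ->
    (forall k x, (k <= N)%N -> `|f^[k] x| <= M) ->
    `|T (rescale f al r)| <= C * (`|r|^-1 ^+ N * M).
Proof.
move=> hT; have [C [N [C0 h]]] := dist_bound (al - 1) (al + 1) hT.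
exists C, N; split=> // r f M /andP[r0 r1] sf hf hM.
apply: h; first exact: smooth_rescale.
  have rn0 : r != 0 by rewrite -normr_gt0.
  by apply: (supp_in_le _ _ (@supp_in_rescale f al r rn0 hf)); lra.
move=> k x kN; rewrite /rescale derive1n_affine// normrM; apply: ler_pM => //; last exact: hM.
by rewrite normrX normfV ler_weXn2l// invf_ge1.
Qed.

Lemma no_mass_bounded T al f : distribution T -> no_mass T al -> smooth f ->
  supp_in (-1) 1 f -> exists B, forall r, 0 < `|r| <= 1 -> `|T (rescale f al r)| <= B.
Proof.
move=> hT hal sf hf; have tf := supp_in_test sf hf.
have [d d0 hd] := hal f tf 1 ltr01.
have [C [N [C0 h]]] := dist_rescale_bound al hT.
have [M M0 hM] := test_bounded N tf.
exists (1 + C * (d^-1 ^+ N * M)) => r /andP[r0 r1].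
have dv0 : 0 <= d^-1 by rewrite invr_ge0 ltW.
have [rd|dr] := ltP `|r| d.
  by rewrite ler_wpDr ?hd ?r0// !mulr_ge0// exprn_ge0.
rewrite ler_wpDl//; apply: le_trans (h r f M _ sf hf _) _; first by rewrite r0.
  by move=> k x kN; exact: hM.
have v0 : 0 <= `|r|^-1 by rewrite invr_ge0.
have rv : `|r|^-1 <= d^-1 by rewrite lef_pV2 ?posrE.
by rewrite ler_wpM2l// ler_wpM2r// lerXn2r ?nnegrE.
Qed.

(** The state s = ((F, e), k) holds the sum F of the earlier humps, the size e allowed for the next
    one and its index k. The next hump f at scale r must exceed by k all that F can contribute at
    any scale. *)
Let hump_spec T al N (s : (R -> R) * R * nat) (rf : R * (R -> R)) : Prop :=
  0 < s.1.2 -> smooth s.1.1 -> supp_in (-1) 1 s.1.1 ->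
  [/\ 0 < `|rf.1| <= 1, smooth rf.2, supp_in (-1) 1 rf.2,
      forall j x, (j <= N + s.2)%N -> `|(rf.2)^[j] x| <= s.1.2 &
      exists B, (forall r', 0 < `|r'| <= 1 -> `|T (rescale s.1.1 al r')| <= B) /\
        B + s.2%:R < `|T (rescale rf.2 al rf.1)|].

Let hump_exists T al N : distribution T -> no_mass T al ->
  (forall (e B : R) (k : nat), 0 < e -> 0 <= B -> exists (r : R) (f : R -> R),
    [/\ 0 < `|r| <= 1, smooth f, supp_in (-1) 1 f,
      forall j x, (j <= k)%N -> `|f^[j] x| <= e & B < `|T (rescale f al r)| ]) ->
  forall s, exists rf, hump_spec T al N s rf.
Proof.
move=> hT hal big [[F e] k].
have [[[e0 sF] hF]|h] := pselect ((0 < e /\ smooth F) /\ supp_in (-1) 1 F); last first.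
  (* An arbitrary value for inadmissible states, so that [choice] applies to all of them. *)
  by exists (0, fun=> 0) => e0 sF hF; exfalso; apply: h.
have [B hB] := no_mass_bounded hT hal sF hF.
have B0 : 0 <= B.
  by apply: le_trans (hB 1 _); rewrite // normr1 ltr01 lexx.
have [r [f [hr sf hf hj hb]]] := big e (B + k%:R) (N + k)%N e0 (addr_ge0 B0 (ler0n _ _)).
by exists (r, f) => _ _ _; split=> //; exists B; split.
Qed.

(** By homogeneity: if no f with k derivatives bounded by e made T exceed B, then B / e and k would
    be a uniform bound and order. *)
Let big_hump T al : distribution T -> no_mass T al ->
  ~ (exists (C : R) (N : nat), 0 <= C /\
  forall r f M, 0 < `|r| <= 1 -> smooth f -> supp_in (-1) 1 f ->
    (forall k x, (k <= N)%N -> `|f^[k] x| <= M) -> `|T (rescale f al r)| <= C * M) ->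
  forall (e B : R) (k : nat), 0 < e -> 0 <= B -> exists (r : R) (f : R -> R),
    [/\ 0 < `|r| <= 1, smooth f, supp_in (-1) 1 f,
      forall j x, (j <= k)%N -> `|f^[j] x| <= e & B < `|T (rescale f al r)| ].
Proof.
move=> hT hal noC e B k e0 B0; apply: contrapT => no; apply: noC.
exists (B / e), k; split; first by rewrite divr_ge0// ltW.
move=> r f M hr sf hf hM; rewrite leNgt; apply/negP => hB; apply: no.
have rn0 : r != 0 by rewrite -normr_gt0; case/andP: hr.
have M0 : 0 <= M by apply: le_trans (hM 0%N 0 _).
have {M0} M0 : 0 < M.
  rewrite lt_def M0 andbT; apply/eqP => Me; move: hB; rewrite Me mulr0.
  rewrite (_ : rescale f al r = fun=> 0) ?dist0 ?normr0 ?ltxx//.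
  apply/funext => y; apply/eqP; rewrite -normr_le0.
  by have := hM 0%N ((y - al) * r^-1); rewrite Me; apply.
exists r, (fun y => (e / M) * f y); split; first exact: hr.
- exact: smooth_scale.
- exact: supp_in_mull.
- move=> j x jk; have eM0 : 0 <= e / M by rewrite divr_ge0// ltW.
  rewrite derive1n_scale// normrM (ger0_norm eM0).
  by rewrite -[leRHS](divfK (lt0r_neq0 M0)) ler_wpM2l// hM.
- rewrite (_ : rescale _ al r = fun y => (e / M) * rescale f al r y)//.
  have tf : test_function (rescale f al r).
    by apply: test_rescale => //; exact: supp_in_test hf.
  have eM0 : 0 < e / M by rewrite divr_gt0.
  rewrite dist_scale// normrM (gtr0_norm eM0) -ltr_pdivrMl//.
  by move: hB; rewrite invf_div mulrC mulrA [_ / e]mulrAC.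
Qed.

(* Uniform boundedness by a gliding hump: were the conclusion false, a
   lacunary series of test functions would violate [no_mass]. *)
Lemma banach_steinhaus T al : distribution T -> no_mass T al ->
  exists (C : R) (N : nat), 0 <= C /\
  forall r f M, 0 < `|r| <= 1 -> smooth f -> supp_in (-1) 1 f ->
    (forall k x, (k <= N)%N -> `|f^[k] x| <= M) -> `|T (rescale f al r)| <= C * M.
Proof.
move=> hT hal; apply: contrapT => /(big_hump hT hal) big.
have [C0 [N [C00 crude]]] := dist_rescale_bound al hT.
have /choice[ch hch] := hump_exists N hT hal big.
(* The size drops at least by half for convergence, and below |r_k|^N so that all humps after the
   k-th, tested at scale r_k with the crude bound, contribute at most 2 C0. *)
pose st := fix st (k : nat) : (R -> R) * R := if k is k'.+1 then
  let s := st k' in let rf := ch (s, k') in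
  ((fun y => s.1 y + rf.2 y), Num.min (s.2 / 2) (`|rf.1| ^+ N)) else (fun=> 0, 1).
pose rr k := (ch (st k, k)).1.
pose th k := (ch (st k, k)).2.
pose e k := (st k).2.
have stS1 k : (st k.+1).1 = (fun y => (st k).1 y + th k y) by [].
have eS k : e k.+1 = Num.min (e k / 2) (`|rr k| ^+ N) by [].
have inv k : [/\ 0 < e k, smooth (st k).1 & supp_in (-1) 1 (st k).1].
  elim: k => [|k [e0 sF hF]]; first by split => //=; exact: smooth_cst.
  have [/andP[r0 _] sf hf _ _] := hch (st k, k) e0 sF hF.
  split; first by rewrite eS lt_min divr_gt0//= exprn_gt0.
    by rewrite stS1; exact: smooth_add.
  by move=> x hx; rewrite stS1 hF// /th hf// addr0.
have spec k : hump_spec T al N (st k, k) (rr k, th k).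
  by have := hch (st k, k); rewrite /rr /th; case: (ch _).
have spec' k : [/\ 0 < `|rr k| <= 1, smooth (th k), supp_in (-1) 1 (th k),
      forall j x, (j <= N + k)%N -> `|(th k)^[j] x| <= e k &
      exists B, (forall r', 0 < `|r'| <= 1 -> `|T (rescale (st k).1 al r')| <= B) /\
        B + k%:R < `|T (rescale (th k) al (rr k))|].
  by have [e0 sF hF] := inv k; exact: spec k e0 sF hF.
have {spec hch} stE k : (st k).1 = (fun y => \sum_(i < k) th i y).
  elim: k => [|k IH]; first by apply/funext => y; rewrite big_ord0.
  by rewrite stS1 IH; apply/funext => y; rewrite big_ord_recr.
clearbody rr th e; clearbody st.
have [F [sF hF] Fd] : exists2 F : R -> R, smooth F /\ supp_in (-1) 1 F &
    forall K j x, (j <= N + K)%N -> `|F^[j] x - \sum_(k < K) (th k)^[j] x| <= 2 * e K.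
  apply: (@test_series R N th e).
  - by move=> k; case: (spec' k).
  - by move=> k; case: (spec' k).
  - by move=> k; case: (inv k).
  - by move=> k; rewrite eS ge_min lexx.
  - by move=> k j x; case: (spec' k) => _ _ _ + _; apply.
have [B hB] := no_mass_bounded hT hal sF hF.
(* At scale r_k the k-th hump beats the earlier ones by k and the later ones amount to at most 2 C0,
   so k > B + 2 C0 contradicts the bound B for the full sum. *)
pose k := (Num.truncn (B + 2 * C0)).+1.
have kB : B + 2 * C0 < k%:R by exact: truncnS_gt.
have [/[dup] hr /andP[r0 r1] sth hth _ [Bk [hBk hk]]] := spec' k.
have [_ sS hS] := inv k; have [_ sS1 hS1] := inv k.+1.
have rn0 : rr k != 0 by rewrite -normr_gt0.
pose rest y := F y - (st k.+1).1 y.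
have srest : smooth rest by exact: smooth_sub.
have hrest : supp_in (-1) 1 rest by move=> x hx; rewrite /rest hF// hS1// subr0.
have restd j x : (j <= N)%N -> `|rest^[j] x| <= 2 * `|rr k| ^+ N.
  move=> jN; rewrite /rest derive1n_sub// stE derive1n_sum; last by move=> i; case: (spec' i).
  apply: le_trans (Fd k.+1 j x _) _; first by rewrite (leq_trans jN)// leq_addr.
  by rewrite ler_wpM2l// eS ge_min lexx orbT.
have hTr : `|T (rescale rest al (rr k))| <= 2 * C0.
  apply: le_trans (crude _ _ _ hr srest hrest restd) _.
  have -> : C0 * (`|rr k|^-1 ^+ N * (2 * `|rr k| ^+ N)) = 2 * C0 * (`|rr k|^-1 * `|rr k|) ^+ N.
    by rewrite exprMn; ring.
  by rewrite mulVf ?gt_eqF// expr1n mulr1.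
have tt f : smooth f -> supp_in (-1) 1 f -> test_function (rescale f al (rr k)).
  by move=> sf hf; apply: test_rescale => //; exact: supp_in_test hf.
have E : T (rescale F al (rr k)) = T (rescale (st k).1 al (rr k)) +
    T (rescale (th k) al (rr k)) + T (rescale rest al (rr k)).
  rewrite -dist_add; [|done|exact: tt|exact: tt].
  rewrite -dist_add; [|done|by apply: test_add; exact: tt|exact: tt].
  by congr T; apply/funext => y; rewrite /rescale /rest stS1; ring.
have := hB (rr k) hr; rewrite E => hE.
have := hBk (rr k) hr; move: hk hTr hE kB.
set a := T (rescale (st k).1 _ _); set b := T (rescale (th k) _ _).
set c := T (rescale rest _ _) => h1 h2 h3 h4 h5.
have : `|b| <= `|a + b + c| + `|a| + `|c|.
  have {1}-> : b = (a + b + c) - a - c by ring.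
  by apply: le_trans (ler_normB _ _) _; rewrite lerD2r ler_normB.
lra.
Qed.

End BanachSteinhaus.

(** * Uniform bounds for profiles with tails *)

Section Tails.
Context {R : realType}.
Implicit Types (T : (R -> R) -> R) (al r s : R) (f g psi K : R -> R).

Lemma step_bounded m : exists2 B, 0 <= B & forall x : R, `|step^[m] x| <= B.
Proof.
case: m => [|m].
  by exists 1 => // x; rewrite derive1n0 ger0_norm ?step_ge0 ?step_le1.
have t1 : test_function ((@step R)^[1]).
  apply: (@supp_in_test _ 0 1); first exact/smooth_derive1/smooth_step.
  move=> x; rewrite negb_and -!ltNge => /orP[x0|x1].
    apply: derive1n_near0; have : \forall y \near x, y < 0 by exact: lt_nbhsl.
    by apply: filterS => y y0; rewrite step_eq0// ltW.
  rewrite (@derive1n_near_eq _ _ (fun=> 1)) ?derive1n1 ?derive1_cst//.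
  - exact: smooth_step.
  - exact: smooth_cst.
  have : \forall y \near x, 1 < y by exact: lt_nbhsr.
  by apply: filterS => y y0; rewrite step_eq1// ltW.
have [B B0 hB] := test_bounded m t1; exists B => // x.
by rewrite -addn1 derive1nD; exact: hB.
Qed.

Definition cutoff : R -> R := bump (- 2^-1) 2^-1 2^-1.

Lemma smooth_cutoff : smooth cutoff. Proof. exact: smooth_bump. Qed.

Lemma supp_in_cutoff : supp_in (-1) 1 cutoff.
Proof.
have := @supp_in_bump R (- 2^-1) 2^-1 2^-1; rewrite invr_gt0 => /(_ (ltr0n _ 2)).
by apply: supp_in_le; lra.
Qed.

Lemma cutoff_eq1 (x : R) : `|x| <= 2^-1 -> cutoff x = 1.
Proof. by rewrite ler_norml => hx; apply: bump_eq1 => //; rewrite invr_gt0. Qed.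

Lemma test_cutoff : test_function cutoff.
Proof. exact: supp_in_test smooth_cutoff supp_in_cutoff. Qed.

Section Dyadic.
Variables (T : (R -> R) -> R) (al C : R) (N : nat).
Hypothesis C0 : 0 <= C.
Hypothesis hT : distribution T.
Hypothesis bs : forall r f M, 0 < `|r| <= 1 -> smooth f -> supp_in (-1) 1 f ->
    (forall k x, (k <= N)%N -> `|f^[k] x| <= M) -> `|T (rescale f al r)| <= C * M.
Variables (B : R).
Hypothesis B0 : 0 <= B.
Hypothesis hB : forall k x, (k <= N)%N -> `|cutoff^[k] x| <= B.
Variables (K : R -> R) (M : R).
Hypothesis sK : smooth K.
Hypothesis hK : forall m x, (m <= N)%N -> `|K^[m] x| * (1 + `|x|) ^+ N.+1 <= M.

Let M0 : 0 <= M.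
Proof. by apply: le_trans (hK 0 (leq0n _)); rewrite mulr_ge0// exprn_ge0// addr_ge0. Qed.

(** The factor 2^N comes from the Leibniz rule, 1 + 2^N from a difference of two cutoffs, 4^(N+1)
    from the radius 1/4 within which they agree. *)
Let C2 := C * (2 ^+ N * (B * (1 + 2 ^+ N) * 4 ^+ N.+1)).

Let C20 : 0 <= C2.
Proof. by rewrite !(mulr_ge0, addr_ge0, exprn_ge0). Qed.

Let cutK r s y := rescale cutoff al r y * rescale K al s y.

Let test_cutK r s : r != 0 -> test_function (cutK r s).
Proof.
move=> r0; apply: test_mulr; last exact: smooth_rescale sK.
exact: test_rescale r0 test_cutoff.
Qed.

(** Truncated at a scale comparable with s, the kernel is one profile of bounded size, to which the
    uniform bound applies directly. *)
Let base r s : s != 0 -> `|s| <= r -> r <= 2 * `|s| -> r <= 1 ->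
  `|T (cutK r s)| <= C2 * M.
Proof.
move=> s0 sr rs r1; have s0' : 0 < `|s| by rewrite normr_gt0.
have r0 : 0 < r by exact: lt_le_trans sr.
have -> : cutK r s = rescale (fun z => cutoff z * K ((z - 0) * (r * s^-1))) al r.
  apply/funext => y; rewrite /cutK /rescale; congr (_ * K _).
  by rewrite subr0 mulrA divfK ?gt_eqF.
have sK' : smooth (fun z => K ((z - 0) * (r * s^-1))) by exact: smooth_affine.
rewrite /C2 -!mulrA; apply: bs.
- by rewrite gtr0_norm// r0.
- by apply: smooth_mul; [exact: smooth_cutoff|exact: sK'].
- by apply: supp_in_mulr; exact: supp_in_cutoff.
move=> k x kN.
apply: le_trans (@derive1n_mul_bound _ k _ _ x B (2 ^+ N * M) smooth_cutoff sK' _ _) _.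
- by move=> i ik; apply: hB; exact: leq_trans kN.
- move=> i ik; have iN := leq_trans ik kN.
  rewrite derive1n_affine// normrM; apply: ler_pM => //.
    rewrite normrX normrM normfV gtr0_norm//.
    apply: (@le_trans _ _ (2 ^+ i)); last by rewrite ler_weXn2l// ler1n.
    have q2 : r * `|s|^-1 <= 2 by rewrite ler_pdivrMr.
    have q0 : 0 <= r * `|s|^-1 by rewrite divr_ge0// ltW.
    by rewrite lerXn2r ?nnegrE.
  apply: le_trans (hK ((x - 0) * (r / s)) iN); rewrite ler_peMr// exprn_ege1// lerDl//.
have E2 : (2 : R) ^+ k <= 2 ^+ N by rewrite ler_weXn2l// ler1n.
have F2 : (0 : R) <= 2 ^+ N by rewrite exprn_ge0.
have F4 : (1 : R) <= 4 ^+ N.+1 by rewrite exprn_ege1// ler1n.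
apply: ler_pM => //.
  by rewrite !mulr_ge0.
rewrite ler_wpM2l// mulrA ler_wpM2r//.
apply: le_trans (ler_wpM2l _ F4); last by rewrite addr_ge0.
by rewrite mulr1 lerDr.
Qed.

(** The two truncations differ only at distance at least r' / 4. With q = r' / |s|, the N
    derivatives cost q^N while decay of order N + 1 gains q^-(N+1); the surplus |s| / r' is summable
    over doublings of r. *)
Let piece r r' s : s != 0 -> `|s| <= r -> r <= r' -> r' <= 2 * r -> r' <= 1 ->
  `|T (fun y => cutK r' s y - cutK r s y)| <= C2 * M * (`|s| / r).
Proof.
move=> s0 sr rr' r'r r'1; have s0' : 0 < `|s| by rewrite normr_gt0.
have r0 : 0 < r by exact: lt_le_trans sr.
have r'0 : 0 < r' by exact: lt_le_trans rr'.
pose w z := cutoff z - cutoff ((z - 0) * (r' * r^-1)).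
pose K' z := K ((z - 0) * (r' * s^-1)).
have -> : (fun y => cutK r' s y - cutK r s y) = rescale (fun z => w z * K' z) al r'.
  apply/funext => y; rewrite /cutK /rescale /w /K' !subr0 -!mulrBl mulrA divfK ?gt_eqF//.
  by rewrite mulrA divfK ?gt_eqF.
have sc : smooth (fun z => cutoff ((z - 0) * (r' * r^-1))).
  by apply: smooth_affine; exact: smooth_cutoff.
have sw : smooth w by apply: smooth_sub; [exact: smooth_cutoff|exact: sc].
have sK' : smooth K' by exact: smooth_affine.
have rr2 : 0 <= r' * r^-1 <= 2 by rewrite divr_ge0 ?(ltW r'0) ?(ltW r0)//= ler_pdivrMr.
rewrite /C2 -!mulrA; apply: bs.
- by rewrite gtr0_norm// r'0.
- exact: smooth_mul.
- apply: supp_in_mulr => z hz; rewrite /w !supp_in_cutoff ?subr0//.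
  apply: contra hz => /andP[h1 h2].
  have q1 : 1 <= r' * r^-1 by rewrite ler_pdivlMr// mul1r.
  have : `|z * (r' * r^-1)| <= 1 by rewrite ler_norml h1.
  rewrite normrM (ger0_norm (x := _ / _)); last by lra.
  move=> h; rewrite -ler_norml; apply: le_trans h; rewrite ler_peMr//.
move=> k z kN.
have rv0 : 0 <= r^-1 by rewrite invr_ge0 ltW.
have sr0 : 0 <= `|s| / r by rewrite mulr_ge0.
have RHS0 : 0 <= 2 ^+ N * (B * ((1 + 2 ^+ N) * (4 ^+ N.+1 * (M * (`|s| / r))))).
  by rewrite !(mulr_ge0, addr_ge0, exprn_ge0).
have [hz|hz] := ltP `|z| 4^-1.
  rewrite (@derive1n_near0 _ _ z k) ?normr0//.
  have : \forall y \near z, `|y| < 4^-1.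
    have e0 : 0 < 4^-1 - `|z| by rewrite subr_gt0.
    apply: filterS (nbhsx_ballx z _ e0) => y; rewrite /ball/= => hy.
    by rewrite -[y](subKr z) (le_lt_trans (ler_normB _ _))//; lra.
  apply: filterS => y hy; rewrite /w !cutoff_eq1 ?subrr ?mul0r//; last by lra.
  rewrite subr0 normrM (ger0_norm (x := _ / _)); last by lra.
  have := normr_ge0 y; move: hy rr2; nra.
apply: le_trans (@derive1n_mul_bound _ k _ _ z (B * (1 + 2 ^+ N))
   (4 ^+ N.+1 * (M * (`|s| / r))) sw sK' _ _) _; last first.
- rewrite -!mulrA ler_wpM2r//.
    by rewrite !(mulr_ge0, addr_ge0, exprn_ge0).
  by rewrite ler_weXn2l// ler1n.
- move=> i ik; have iN := leq_trans ik kN.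
  rewrite /K' derive1n_affine// normrM normrX normrM normfV (gtr0_norm r'0) subr0.
  have q1 : 1 <= r' / `|s| by rewrite ler_pdivlMr// mul1r (le_trans sr).
  set q := r' / `|s| in q1 *.
  have q0 : 0 < q by lra.
  have hK1 := hK (z * (r' / s)) iN.
  have hq : `|z * (r' / s)| = `|z| * q by rewrite !normrM normfV (gtr0_norm r'0).
  have h4 : q / 4 <= 1 + `|z * (r' / s)|.
    by rewrite hq mulrC ler_wpDl// ler_pM2r.
  have hK2 : `|K^[i] (z * (r' / s))| * (q / 4) ^+ N.+1 <= M.
    apply: le_trans hK1; rewrite ler_wpM2l// lerXn2r ?nnegrE ?addr_ge0//.
    by rewrite divr_ge0// ltW.
  apply: (@le_trans _ _ (q ^+ N * `|K^[i] (z * (r' / s))|)).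
    by rewrite ler_wpM2r// ler_weXn2l.
  have -> : q ^+ N * `|K^[i] (z * (r' / s))| =
      4 ^+ N.+1 * (`|K^[i] (z * (r' / s))| * (q / 4) ^+ N.+1 * q^-1).
    rewrite (expr_div_n q 4) (exprS q).
    have : (4 : R) ^+ N.+1 != 0 by rewrite expf_neq0.
    move: (4 ^+ N.+1) (q ^+ N) `|_| => u v t u0; field.
    by rewrite u0 gt_eqF.
  rewrite ler_wpM2l ?exprn_ge0//; apply: ler_pM => //.
  + by rewrite mulr_ge0// exprn_ge0// ltW// divr_gt0.
  + by rewrite invr_ge0 ltW.
  + by rewrite /q invf_div ler_wpM2l// lef_pV2.
- move=> i ik; have iN := leq_trans ik kN.
  rewrite /w (derive1n_sub i smooth_cutoff sc).
  apply: le_trans (ler_normB _ _) _; rewrite mulrDr mulr1; apply: lerD; first exact: hB.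
  rewrite derive1n_affine; last exact: smooth_cutoff.
  rewrite normrM mulrC; apply: ler_pM => //; first exact: hB.
  rewrite normrX ger0_norm; last by lra.
  apply: (@le_trans _ _ (2 ^+ i)); last by rewrite ler_weXn2l// ler1n.
  by rewrite lerXn2r ?nnegrE; lra.
Qed.

Lemma bs_tail : forall r s, s != 0 -> `|s| <= r -> r <= 1 ->
  `|T (fun y => rescale cutoff al r y * rescale K al s y)| <= 3 * C2 * M.
Proof.
(* The term 2 |s| / r is subtracted to close the induction: passing to r / 2 doubles it, and the
   dyadic piece gives back exactly 2 |s| / r. *)
suff H n : forall r s, s != 0 -> `|s| <= r -> r <= 2 ^+ n * `|s| -> r <= 1 ->
    `|T (cutK r s)| <= C2 * M * (3 - 2 * (`|s| / r)).
  move=> r s s0 sr r1; have s0' : 0 < `|s| by rewrite normr_gt0.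
  have r0 : 0 < r by exact: lt_le_trans sr.
  have [n hn] : exists n : nat, r <= 2 ^+ n * `|s|.
    exists (Num.truncn (r / `|s|)).+1; rewrite -ler_pdivrMr//.
    apply: le_trans (ltW (truncnS_gt _)) _.
    by rewrite -natrX ler_nat ltnW// ltn_expl.
  apply: le_trans (H n r s s0 sr hn r1) _.
  rewrite [leRHS](_ : _ = C2 * M * 3); last by ring.
  by rewrite ler_wpM2l ?mulr_ge0// gerBl mulr_ge0// divr_ge0// ltW.
elim: n => [|n IH] r s s0 sr rs r1; have s0' : 0 < `|s| by rewrite normr_gt0.
all: have r0 : 0 < r by exact: lt_le_trans sr.
all: have q0 : 0 <= `|s| / r <= 1 by rewrite divr_ge0 ?(ltW r0)//= ler_pdivrMr// mul1r.
all: have CM : 0 <= C2 * M by rewrite mulr_ge0.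
  apply: le_trans (base s0 sr _ r1) _; first by move: rs; rewrite expr0; lra.
  by rewrite ler_peMr//; lra.
have [r2|r2] := leP r (2 * `|s|).
  by apply: le_trans (base s0 sr _ r1) _ => //; rewrite ler_peMr//; lra.
pose h := r / 2; have h0 : 0 < h by rewrite divr_gt0.
have h1 : `|T (cutK h s)| <= C2 * M * (3 - 2 * (`|s| / h)).
  by apply: IH => //; rewrite /h ?exprS in rs *; lra.
have h2 : `|T (fun y => cutK r s y - cutK h s y)| <= C2 * M * (`|s| / h).
  by apply: piece => //; rewrite /h; lra.
have rn0 : r != 0 by rewrite gt_eqF.
have hn0 : h != 0 by rewrite gt_eqF.
move: h2; rewrite (dist_sub hT (@test_cutK r s rn0) (@test_cutK h s hn0)) => h2.
have e1 : `|s| / h = 2 * (`|s| / r) by rewrite /h; field.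
rewrite e1 in h1 h2; set q := `|s| / r in q0 h1 h2 *.
have : `|T (cutK r s)| <= `|T (cutK r s) - T (cutK h s)| + `|T (cutK h s)|.
  by rewrite -{1}[T (cutK r s)](subrK (T (cutK h s))) ler_normD.
have : C2 * M * (3 - 2 * (2 * q)) + C2 * M * (2 * q) = C2 * M * (3 - 2 * q) by ring.
lra.
Qed.

End Dyadic.

(** Extends the uniform bound to profiles without compact support, as required for a Gaussian cut
    off on one side only. *)
Lemma no_mass_tail T al : distribution T -> no_mass T al -> exists (C : R) (N : nat),
  0 <= C /\ forall K M r s, smooth K ->
   (forall m x, (m <= N)%N -> `|K^[m] x| * (1 + `|x|) ^+ N.+1 <= M) ->
   s != 0 -> `|s| <= r -> r <= 1 ->
   `|T (fun y => rescale cutoff al r y * rescale K al s y)| <= C * M.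
Proof.
move=> hT hal; have [C [N [C0 bs]]] := banach_steinhaus hT hal.
have [B B0 hB] := test_bounded N test_cutoff.
eexists; exists N; split; last first.
  move=> K M r s sK hK s0 sr r1.
  exact: (@bs_tail T al C N C0 hT bs B B0 (fun k x => hB k x) K M sK hK r s).
by rewrite !(mulr_ge0, addr_ge0, exprn_ge0).
Qed.

End Tails.

(** * The heat kernel seen from beyond a corner *)

Section Corner.
Context {R : realType}.
Implicit Types (T : (R -> R) -> R) (al r s x y : R) (f g psi K : R -> R).

Lemma smooth_hker_near f m x t : smooth f -> smooth (fun y => f y * hker m x t y).
Proof. by move=> sf; apply: smooth_mul; [exact: sf|exact: smooth_hker]. Qed.

Lemma hker_far_le (N : nat) (r e : R) : 0 < r -> 0 < e -> exists2 t0, 0 < t0 &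
  forall m x t y, (m <= N)%N -> 0 < t < t0 -> r <= `|y - x| -> `|hker m x t y| <= e.
Proof.
move=> r0 e0; elim: N => [|N [t1 t10 h1]].
  have [t0 t00 h] := hker_far 0 r0 e0; exists t0 => // m x t y.
  by rewrite leqn0 => /eqP ->; exact: h.
have [t2 t20 h2] := hker_far N.+1 r0 e0.
exists (Num.min t1 t2) => [|m x t y]; first by rewrite lt_min t10.
rewrite leq_eqVlt ltnS => /orP[/eqP ->|mN] /andP[t0]; rewrite lt_min => /andP[ht1 ht2].
  by apply: h2; rewrite t0.
by apply: h1 => //; rewrite t0.
Qed.

(** The weight [rho] keeps the distance r from every point of P, where the kernel and its
    derivatives up to the order of T are uniformly small. *)
Lemma dist_hker_far T rho (P : R -> Prop) (r e : R) : distribution T ->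
  test_function rho -> 0 < r -> 0 < e ->
  (forall x y, P x -> `|y - x| < r -> rho y = 0) ->
  exists2 t0, 0 < t0 & forall x t, P x -> 0 < t < t0 ->
    `|T (fun y => rho y * hker 0 x t y)| <= e.
Proof.
move=> hT trho r0 e0 hrho; have srho := test_smooth trho.
have [A A0 hA] := test_supp_in trho.
have [C [N [C0 hC]]] := dist_bound (- A) A hT.
have [B B0 hB] := test_bounded N trho.
pose D := C * (2 ^+ N * B) + 1.
have D0 : 0 < D by rewrite ltr_wpDl// !mulr_ge0// exprn_ge0.
have [t0 t00 ht0] := hker_far_le N r0 (divr_gt0 e0 D0).
exists t0 => // x t Px ht.
apply: (@le_trans _ _ (C * (2 ^+ N * (B * (e / D))))).
  apply: hC; [exact: smooth_hker_near srho|exact: supp_in_mulr hA|].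
  move=> k y kN; have eD0 : 0 <= e / D by rewrite divr_ge0// ltW.
  have [hy|hy] := leP r `|y - x|.
    apply: le_trans (@derive1n_mul_bound _ k _ _ y B (e / D) srho (@smooth_hker _ _ _ _) _ _) _.
    - by move=> i ik; apply: hB; exact: leq_trans kN.
    - by move=> i ik; rewrite derive1n_hker; apply: ht0 => //; exact: leq_trans kN.
    by rewrite (ler_wpM2r (mulr_ge0 B0 eD0))// ler_weXn2l// ler1n.
  have e1 : 0 < r - `|y - x| by rewrite subr_gt0.
  have near0 : \forall z \near y, rho z * hker 0 x t z = 0.
    apply: filterS (nbhsx_ballx y _ e1) => z; rewrite /ball/= => hz.
    rewrite (hrho x)// ?mul0r//.
    have -> : z - x = (y - x) - (y - z) by ring.
    by apply: le_lt_trans (ler_normB _ _) _; lra.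
  by rewrite (derive1n_near0 k near0) normr0; apply: mulr_ge0; [exact: exprn_ge0|exact: mulr_ge0].
have -> : C * (2 ^+ N * (B * (e / D))) = (C * (2 ^+ N * B)) / D * e by ring.
by rewrite ler_piMl ?(ltW e0)// ler_pdivrMr// mul1r /D lerDl.
Qed.

(* [dir * (y - al)] is the signed distance to the corner [al] of the gap. *)
Definition posd_dir T al (dir L : R) : Prop := forall psi p q, smooth psi ->
  (forall y, 0 <= psi y) -> 0 < p -> q < L ->
  (forall y, ~~ (p <= dir * (y - al) <= q) -> psi y = 0) -> 0 <= T psi.

(** Here [xi] is the distance from the corner in units of s. The cutoff keeps v <= 2, so a Gaussian
    centred at a large [xi] is seen only in its tail; part of the exponent pays for the polynomial
    weight, and exp(-xi^2/4) is left. *)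
Lemma corner_kernel (N : nat) : exists2 D : R, 0 <= D & forall (xi : R) m u, 0 <= xi ->
  (m <= N)%N ->
  `|(fun v => step (2 - v) * gk (v - xi))^[m] u| * (1 + `|u|) ^+ N.+1 <=
  D * expR (- (xi ^+ 2 / 4)).
Proof.
have [B B0 hB] : exists2 B, 0 <= B & forall m (x : R), (m <= N)%N -> `|step^[m] x| <= B.
  elim: N => [|N [B B0 hB]].
    have [B B0 hB] := @step_bounded R 0; exists B => // m x.
    by rewrite leqn0 => /eqP ->; exact: hB.
  have [B' B'0 hB'] := @step_bounded R N.+1; exists (B + B') => [|m x].
    by rewrite addr_ge0.
  rewrite leq_eqVlt ltnS => /orP[/eqP ->|mN]; first by rewrite ler_wpDl.
  by rewrite ler_wpDr// hB.
have q4 : 0 < (4^-1 : R) by rewrite invr_gt0.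
have [G G0 hG] : exists2 G, 0 <= G & forall m (w : R), (m <= N)%N ->
    `|gk^[m] w| <= G * expR (- (1 - 4^-1) * w ^+ 2).
  elim: N {B B0 hB} => [|N [B B0 hB]].
    have [B B0 hB] := @gk_derive_expR R 0 _ q4; exists B => // m x.
    by rewrite leqn0 => /eqP ->; exact: hB.
  have [B' B'0 hB'] := @gk_derive_expR R N.+1 _ q4; exists (B + B') => [|m x].
    by rewrite addr_ge0.
  rewrite leq_eqVlt ltnS => /orP[/eqP ->|mN]; rewrite mulrDl.
    by apply: le_trans (hB' x) _; rewrite lerDr mulr_ge0 ?expR_ge0.
  by apply: le_trans (hB m x mN) _; rewrite lerDl mulr_ge0 ?expR_ge0.
have q8 : 0 < (3 / 8 : R) by rewrite divr_gt0.
have [P P0 hP] := expr_expR_bounded N.+1 q8.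
exists (2 ^+ N * (B * G) * (expR 7 * P)) => [|xi m u xi0 mN].
  by rewrite !mulr_ge0 ?exprn_ge0 ?expR_ge0.
have RHS0 : 0 <= 2 ^+ N * (B * G) * (expR 7 * P) * expR (- (xi ^+ 2 / 4)).
  by rewrite !mulr_ge0 ?exprn_ge0 ?expR_ge0.
have s1 : smooth (fun v : R => step (2 - v)).
  have := @smooth_affine R step 2 (-1) (@smooth_step R).
  by congr smooth; apply/funext => v; rewrite mulrN1 opprB.
have e1 : (fun v : R => step (2 - v)) = (fun v => step ((v - 2) * -1)).
  by apply/funext => v; rewrite mulrN1 opprB.
have e2 : (fun v : R => gk (v - xi)) = (fun v => gk ((v - xi) * 1)).
  by apply/funext => v; rewrite mulr1.
have s2 : smooth (fun v : R => gk (v - xi)).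
  by rewrite e2; apply: smooth_affine; exact: smooth_gk.
have [u2|u2] := leP u 2; last first.
  rewrite derive1n_near0 ?normr0 ?mul0r//.
  have : \forall y \near u, 2 < y by exact: lt_nbhsr.
  by apply: filterS => v v2; rewrite step_eq0 ?mul0r//; lra.
apply: (@le_trans _ _ (2 ^+ N * (B * (G * expR (- (1 - 4^-1) * (u - xi) ^+ 2))) *
    (1 + `|u|) ^+ N.+1)).
  rewrite ler_wpM2r ?exprn_ge0 ?addr_ge0//.
  apply: le_trans (@derive1n_mul_bound _ m _ _ u B (G * expR (- (1 - 4^-1) * (u - xi) ^+ 2))
    s1 s2 _ _) _.
  - move=> i im; rewrite e1 derive1n_affine; last exact: smooth_step.
    rewrite normrM normrX normrN1 expr1n mul1r; apply: hB; exact: leq_trans mN.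
  - move=> i im; rewrite e2 derive1n_affine; last exact: smooth_gk.
    by rewrite expr1n mul1r mulr1; apply: hG; exact: leq_trans mN.
  have h0 : 0 <= B * (G * expR (- (1 - 4^-1) * (u - xi) ^+ 2)).
    by rewrite !mulr_ge0 ?expR_ge0.
  by rewrite (ler_wpM2r h0)// ler_weXn2l// ler1n.
(* Of the exponent 3/4 (u - xi)^2, with u <= 2, the part xi^2 / 4 is kept, 3/8 (1 + |u|)^2 absorbs
   the weight, and the constant 7 covers what is lost through (u - xi)^2 >= xi^2/2 + u^2 - 8. *)
have key : expR (- (1 - 4^-1) * (u - xi) ^+ 2) <=
    expR (- (xi ^+ 2 / 4)) * (expR 7 * expR (- (3 / 8 * (1 + `|u|) ^+ 2))).
  rewrite -!expRD ler_expR.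
  have -> : (1 + `|u|) ^+ 2 = 1 + 2 * `|u| + u ^+ 2.
    by rewrite sqrrD expr1n mul1r mulr2n -[u ^+ 2]real_normK ?num_real//; ring.
  have hu : `|u| <= (1 + u ^+ 2) / 2.
    rewrite -[u ^+ 2]real_normK ?num_real//.
    have := sqr_ge0 (`|u| - 1); rewrite sqrrB expr1n mulr1; lra.
  have hx : xi ^+ 2 / 2 + u ^+ 2 - 8 <= (u - xi) ^+ 2.
    have [u0|u0] := leP u 0.
      have -> : (u - xi) ^+ 2 = xi ^+ 2 + u ^+ 2 + 2 * (xi * - u) by ring.
      have : 0 <= xi * - u by rewrite mulr_ge0// oppr_ge0.
      have := sqr_ge0 xi; lra.
    have -> : (u - xi) ^+ 2 = (xi - 2 * u) ^+ 2 / 2 + xi ^+ 2 / 2 - u ^+ 2 by field.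
    have := sqr_ge0 (xi - 2 * u).
    have : u ^+ 2 <= 4.
      have : u * u <= 2 * 2 by apply: ler_pM => //; exact: ltW.
      by rewrite expr2; lra.
    lra.
  have := sqr_ge0 xi; lra.
have := ler_wpM2l G0 key; set E := expR _; set F := expR _; set F7 := expR 7.
set H := expR _ => hk.
have Hp : (1 + `|u|) ^+ N.+1 * H <= P.
  by have := hP (1 + `|u|); rewrite ger0_norm ?addr_ge0.
have W0 : 0 <= (1 + `|u|) ^+ N.+1 by rewrite exprn_ge0// addr_ge0.
have F20 : 0 <= (2 : R) ^+ N by rewrite exprn_ge0.
apply: (@le_trans _ _ (2 ^+ N * (B * (G * (F * (F7 * H)))) * (1 + `|u|) ^+ N.+1)).
  by rewrite ler_wpM2r// ler_wpM2l// ler_wpM2l.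
have -> : 2 ^+ N * (B * (G * (F * (F7 * H)))) * (1 + `|u|) ^+ N.+1 =
  (2 ^+ N * (B * G) * F7 * F) * ((1 + `|u|) ^+ N.+1 * H) by ring.
have -> : 2 ^+ N * (B * G) * (F7 * P) * F = (2 ^+ N * (B * G) * F7 * F) * P by ring.
by rewrite ler_wpM2l// !mulr_ge0// expR_ge0.
Qed.

End Corner.

(** * Heat means near the corner of a gap *)

Section CornerEstimate.
Context {R : realType}.
Implicit Types (T : (R -> R) -> R) (al r s x y : R) (f g psi K : R -> R).

Lemma smooth_step_affine (u v : R) : smooth (fun y => step (u - v * y)).
Proof.
have h : smooth (fun y : R => u - v * y).
  by apply: smooth_sub; [exact: smooth_cst|apply: smooth_scale; exact: smooth_id].
have -> : (fun y => step (u - v * y)) = (fun y => step ((y - 0) * - v - - u)).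
  by apply/funext => y; congr step; ring.
have := @smooth_affine R (fun z => step (z - - u)) 0 (- v); apply.
have := @smooth_affine R step (- u) 1 (@smooth_step R).
by congr smooth; apply/funext => y; rewrite mulr1.
Qed.

Lemma hker0_ge0 x t y : 0 < t -> 0 <= hker 0 x t y.
Proof. by move=> t0; rewrite /hker mulr_ge0 ?gk_ge0// exprn_ge0// invr_ge0 ltW. Qed.

(** The kernel is cut into four pieces. The one near the corner and at most 2s inside the gap is a
    rescaled profile, bounded by [no_mass_tail]. The one at depth between s and 3L/4 is nonnegative,
    and T is positive there. The other two keep a fixed distance from the evaluation point and are
    small with s. *)
Lemma corner_estimate T chi al dir L r0 : distribution T -> no_mass T al ->
  test_function chi -> (forall y, 0 <= chi y) -> 0 < L -> dir = 1 \/ dir = -1 ->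
  posd_dir T al dir L -> 0 < r0 -> (forall y, `|y - al| <= r0 -> chi y = 1) ->
  exists2 C, 0 <= C & forall e, 0 < e -> exists2 s0, 0 < s0 & forall s r,
    0 < s < s0 -> 0 <= r <= L / 2 ->
    - (C / s * expR (- ((r / s) ^+ 2 / 4))) - e <= hconv T chi 0 (al + dir * r) s.
Proof.
move=> hT hal tchi chi0 L0 hdir hpos r00 chi1.
have [C1 [N [C10 tail]]] := no_mass_tail hT hal.
have [D D0 hD] := @corner_kernel R N.
exists (C1 * D) => [|e e0]; first by rewrite mulr_ge0.
have dir1 : dir * dir = 1 by case: hdir => ->; rewrite ?mulrNN mulr1.
have ndir : `|dir| = 1 by case: hdir => ->; rewrite ?normrN normr1.
have dn0 : dir != 0 by rewrite -normr_gt0 ndir.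
pose R0 := Num.min r0 1.
have R00 : 0 < R0 by rewrite lt_min r00 ltr01.
have R01 : R0 <= 1 by rewrite ge_min lexx orbT.
have R0r : R0 <= r0 by rewrite ge_min lexx.
pose dl y := dir * (y - al).
pose lam s y := step (2 - dir / s * (y - al)).
pose om := rescale cutoff al R0.
(* [ka] is 1 up to depth 5L/8 and 0 beyond 3L/4, while evaluation points have depth at most L/2;
   this leaves the distance L/8 used for [rho4]. *)
pose ka y := step ((3 / 4 * L - dl y) * (8 / L)).
have slam s : smooth (lam s).
  have := @smooth_step_affine (2 + dir / s * al) (dir / s).
  by congr smooth; apply/funext => y; congr step; ring.
have ska : smooth ka.
  have := @smooth_step_affine ((3 / 4 * L + dir * al) * (8 / L)) (dir * (8 / L)).
  by congr smooth; apply/funext => y; congr step; rewrite /dl; ring.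
have som : smooth om by apply: smooth_rescale; exact: smooth_cutoff.
have schi := test_smooth tchi.
have one_sub f : smooth f -> smooth (fun y => 1 - f y).
  by move=> sf; apply: smooth_sub; [exact: smooth_cst|exact: sf].
pose s1 := R0 / 4; have s10 : 0 < s1 by rewrite divr_gt0.
pose rho2 y := ((1 - om y) * lam s1 y) * chi y.
pose rho4 y := (1 - ka y) * chi y.
have trho2 : test_function rho2.
  by apply: test_mull tchi; apply: smooth_mul; [exact: one_sub som|exact: slam].
have trho4 : test_function rho4 by apply: test_mull tchi; exact: one_sub ska.
have lam1 s y : 0 < s -> dl y <= s -> lam s y = 1.
  move=> s0 hy; rewrite /lam step_eq1// -mulrA [_ * (y - al)]mulrC mulrA -/(dl y).
  have : dl y / s <= 1 by rewrite ler_pdivrMr// mul1r.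
  lra.
have lam0 s y : 0 < s -> 2 * s <= dl y -> lam s y = 0.
  move=> s0 hy; rewrite /lam step_eq0// -mulrA [_ * (y - al)]mulrC mulrA -/(dl y).
  have : 2 <= dl y / s by rewrite ler_pdivlMr.
  lra.
have om1 y : `|y - al| <= R0 / 2 -> om y = 1.
  move=> hy; rewrite /om /rescale cutoff_eq1// normrM normfV (gtr0_norm R00).
  by rewrite ler_pdivrMr// mulrC.
have om0 y : R0 < `|y - al| -> om y = 0.
  move=> hy; rewrite /om /rescale supp_in_cutoff// -ler_norml -ltNge.
  by rewrite normrM normfV (gtr0_norm R00) ltr_pdivlMr// mul1r.
have dlE y : `|dl y| = `|y - al| by rewrite normrM ndir mul1r.
pose P x := exists2 r, 0 <= r <= L / 2 & x = al + dir * r.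
have dxE x r y : x = al + dir * r -> `|y - x| = `|dl y - r|.
  move=> ->; have -> : y - (al + dir * r) = dir * (dl y - r).
    by rewrite /dl mulrBr mulrA dir1; ring.
  by rewrite normrM ndir mul1r.
have far2 x y : P x -> `|y - x| < R0 / 2 -> rho2 y = 0.
  move=> [r /andP[r0' _] /dxE ->] hr; rewrite /rho2.
  have [h|h] := leP `|y - al| (R0 / 2); first by rewrite om1// subrr !mul0r.
  rewrite lam0 ?mulr0 ?mul0r//; move: h hr; rewrite -dlE /s1.
  by case: (ger0P (dl y)); rewrite ltr_norml; lra.
have far4 x y : P x -> `|y - x| < L / 8 -> rho4 y = 0.
  move=> [r /andP[_ rL] /dxE ->] hr; rewrite /rho4 /ka step_eq1 ?subrr ?mul0r//.
  by rewrite mulrA ler_pdivlMr//; move: hr; rewrite ltr_norml; lra.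
have e2 : 0 < e / 2 by rewrite divr_gt0.
have [t2 t20 ht2] := dist_hker_far hT trho2 (divr_gt0 R00 (ltr0n _ 2)) e2 far2.
have [t4 t40 ht4] := dist_hker_far hT trho4 (divr_gt0 L0 (ltr0n _ 8)) e2 far4.
exists (Num.min (Num.min t2 t4) (Num.min s1 (L / 4))).
  by rewrite !lt_min t20 t40 s10 divr_gt0.
move=> s r /andP[s0]; rewrite !lt_min => /andP[/andP[st2 st4] /andP[ss1 sL]] hr.
set x := al + dir * r; have Px : P x by exists r.
pose H y := hker 0 x s y; have sH : smooth H by exact: smooth_hker.
pose F1 y := om y * (lam s y * H y).
pose F3 y := (1 - lam s y) * ka y * (chi y * H y).
have tF1 : test_function F1.
  apply: test_mulr; last by apply: smooth_mul; [exact: slam|exact: sH].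
  by apply: test_rescale; [rewrite gt_eqF|exact: test_cutoff].
have tF3 : test_function F3.
  apply: test_mull; last by apply: test_mulr; [exact: tchi|exact: sH].
  by apply: smooth_mul; [apply: one_sub; exact: slam|exact: ska].
have tF2 : test_function (fun y => rho2 y * H y) by exact: test_mulr trho2 sH.
have tF4 : test_function (fun y => rho4 y * H y) by exact: test_mulr trho4 sH.
have decomp : (fun y => chi y * H y) =
    (fun y => (F1 y + rho2 y * H y) + (F3 y + rho4 y * H y)).
  apply/funext => y.
  (* [rho2] must not depend on s. Away from the corner [lam s1] and [lam s] agree, both being 0 on
     the gap side and 1 on the other. *)
  have a1 : (1 - om y) * lam s1 y = (1 - om y) * lam s y.
    have [h|h] := leP `|y - al| (R0 / 2); first by rewrite om1// subrr !mul0r.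
    congr (_ * _); move: h; rewrite -dlE; case: (ger0P (dl y)) => hd h.
      by rewrite !lam0 //; rewrite /s1 in ss1 *; lra.
    by rewrite !lam1//; lra.
  have a2 : (1 - ka y) = (1 - lam s y) * (1 - ka y).
    have [h|h] := leP (dl y) (5 / 8 * L).
      by rewrite /ka step_eq1 ?subrr ?mulr0// mulrA ler_pdivlMr//; lra.
    by rewrite lam0 ?subr0 ?mul1r//; lra.
  have a3 : om y * chi y = om y.
    have [h|h] := leP `|y - al| R0; last by rewrite om0// mul0r.
    by rewrite chi1 ?mulr1// (le_trans h).
  by rewrite /F1 /F3 /rho2 /rho4 a1 a2 -{1}a3; ring.
have T1 : `|T F1| <= C1 * D / s * expR (- ((r / s) ^+ 2 / 4)).
  pose K v := step (2 - v) * gk (v - r / s).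
  have -> : F1 = fun y => s^-1 * (rescale cutoff al R0 y * rescale K al (dir * s) y).
    apply/funext => y; rewrite /F1 /H /hker /rescale /K expr1 -/om derive1n0.
    have -> : (dir * s)^-1 = dir / s.
      by rewrite invfM; congr (_ / _); apply: (mulfI dn0); rewrite dir1 mulfV.
    have -> : gk ((y - al) * (dir / s) - r / s) = gk ((y - x) / s).
      have e3 : (y - al) * (dir / s) - r / s = dir * ((y - x) / s).
        by rewrite /x; transitivity (dir * (y - al) / s - dir * dir * r / s);
          [rewrite dir1; ring|ring].
      by rewrite e3; case: hdir => ->; rewrite ?mulN1r ?gkN ?mul1r.
    by rewrite /om /rescale /lam [dir / s * _]mulrC; ring.
  have sK : smooth K.
    apply: smooth_mul.
      have := @smooth_step_affine 2 1; congr smooth.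
      by apply/funext => v; rewrite mul1r.
    have := @smooth_affine R gk (r / s) 1 (@smooth_gk R).
    by congr smooth; apply/funext => v; rewrite mulr1.
  have ts : test_function (fun y => rescale cutoff al R0 y * rescale K al (dir * s) y).
    apply: test_mulr; first by apply: test_rescale; [rewrite gt_eqF|exact: test_cutoff].
    exact: smooth_rescale sK.
  rewrite (dist_scale _ hT ts) normrM normfV (gtr0_norm s0) mulrC.
  have -> : C1 * D / s * expR (- ((r / s) ^+ 2 / 4)) =
    C1 * (D * expR (- ((r / s) ^+ 2 / 4))) / s by ring.
  have hKd : forall m u, (m <= N)%N ->
      `|K^[m] u| * (1 + `|u|) ^+ N.+1 <= D * expR (- ((r / s) ^+ 2 / 4)).
    by move=> m u mN; apply: hD mN; case/andP: hr => hr0 _; rewrite divr_ge0// ltW.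
  have ds0 : dir * s != 0 by rewrite mulf_neq0// gt_eqF.
  have dsR : `|dir * s| <= R0.
    by rewrite normrM ndir mul1r gtr0_norm//; move: ss1; rewrite /s1; lra.
  have sv0 : 0 <= s^-1 by rewrite invr_ge0 ltW.
  exact: ler_wpM2r sv0 _ _ (tail K _ R0 (dir * s) sK hKd ds0 dsR R01).
have F30 y : 0 <= F3 y.
  apply: mulr_ge0; first by apply: mulr_ge0; rewrite ?step_ge0 ?subr_ge0 ?step_le1.
  by apply: mulr_ge0; [exact: chi0|exact: hker0_ge0].
have T3 : 0 <= T F3.
  apply: (hpos F3 s (3 / 4 * L) (test_smooth tF3) F30 s0); first by lra.
  move=> y; rewrite negb_and -!ltNge => /orP[h|h]; rewrite /F3.
    by rewrite (lam1 _ _ s0 (ltW h)) subrr !mul0r.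
  rewrite [ka y]step_eq0 ?mulr0 ?mul0r//.
  have L8 : 0 < 8 / L by rewrite divr_gt0.
  by rewrite (pmulr_lle0 _ L8) subr_le0 ltW.
have T2 : `|T (fun y => rho2 y * H y)| <= e / 2 by apply: ht2 => //; rewrite s0.
have T4 : `|T (fun y => rho4 y * H y)| <= e / 2 by apply: ht4 => //; rewrite s0.
rewrite /hconv -/H decomp (dist_add hT (test_add tF1 tF2) (test_add tF3 tF4)).
rewrite (dist_add hT tF1 tF2) (dist_add hT tF3 tF4).
move: T1 T2 T4; rewrite !ler_norml; lra.
Qed.

(** Remove from [psi] a left and a right part, on which T is nonnegative. Near e, at scale r, there
    remain a multiple of a fixed profile, negligible as T has no mass at e, and the profile of psi -
    psi(e), whose derivatives are O(r), so that [banach_steinhaus] bounds its pairing by O(r). *)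
Lemma isolated_point T e d : distribution T -> no_mass T e -> posd T (e - d) e ->
  posd T e (e + d) -> posd T (e - d) (e + d).
Proof.
move=> hT he posl posr psi p q spsi psi0 dp qd hpsi.
have tpsi := supp_in_test spsi hpsi.
have [C [N [C0 bs]]] := banach_steinhaus hT he.
have [M M0 hM] := test_bounded (N + 2) tpsi.
(* [lf] is 1 for z <= -1 and 0 for z >= -1/2, and [rt] is its mirror image. *)
pose lf (z : R) := step (-1 - 2 * z); pose rt (z : R) := step (-1 - (-2) * z).
pose th z := 1 - lf z - rt z.
have slf : smooth lf by exact: smooth_step_affine.
have srt : smooth rt by exact: smooth_step_affine.
have sth : smooth th.
  apply: smooth_sub; last exact: srt.
  by apply: smooth_sub; [exact: smooth_cst|exact: slf].
have hth : supp_in (-1) 1 th.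
  move=> z; rewrite negb_and -!ltNge => /orP[h|h]; rewrite /th /lf /rt.
    by rewrite step_eq1 ?[step (-1 - -2 * z)]step_eq0; lra.
  by rewrite step_eq0 ?[step (-1 - -2 * z)]step_eq1; lra.
have tth := supp_in_test sth hth.
have [B B0 hB] := test_bounded N tth.
pose D := C * (2 ^+ N * ((2 * M) * B)).
have D0 : 0 <= D by rewrite /D !mulr_ge0// exprn_ge0.
rewrite -oppr_le0; apply/ler_addgt0Pr => eps eps0; rewrite add0r.
have e1 : 0 < eps / 2 / (psi e + 1).
  by rewrite !divr_gt0//; have := psi0 e; lra.
have [d1 d10 hd1] := he th tth _ e1.
pose r := Num.min (Num.min (d1 / 2) 1) (eps / 2 / (D + 1)).
have D1 : 0 < D + 1 by lra.
have P1 : 0 < psi e + 1 by have := psi0 e; lra.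
have r0 : 0 < r by rewrite !lt_min ltr01 !divr_gt0.
have r1 : r <= 1 by rewrite !ge_min lexx orbT.
have rd1 : r < d1.
  by apply: (@le_lt_trans _ _ (d1 / 2)); [rewrite !ge_min lexx|lra].
have rD : r * D <= eps / 2.
  apply: (@le_trans _ _ (r * (D + 1))); first by rewrite ler_wpM2l ?(ltW r0)// lerDl.
  by rewrite -ler_pdivlMr// !ge_min lexx orbT.
have rn0 : r != 0 by rewrite gt_eqF.
have nr : 0 < `|r| <= 1 by rewrite gtr0_norm// r0.
pose Fl y := psi y * rescale lf e r y.
pose Fr y := psi y * rescale rt e r y.
pose g z := (psi ((z - - (e / r)) * r) - psi e) * th z.
have tFl : test_function Fl by apply: test_mulr tpsi _; exact: smooth_rescale slf.
have tFr : test_function Fr by apply: test_mulr tpsi _; exact: smooth_rescale srt.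
have spr : smooth (fun z => psi ((z - - (e / r)) * r)) by exact: smooth_affine spsi.
have sg0 : smooth (fun z => psi ((z - - (e / r)) * r) - psi e).
  by apply: smooth_sub; [exact: spr|exact: smooth_cst].
have sg : smooth g by apply: smooth_mul; [exact: sg0|exact: sth].
have hg : supp_in (-1) 1 g by apply: supp_in_mull; exact: hth.
have tg := supp_in_test sg hg.
have decomp : psi = fun y => (Fl y + Fr y) + (psi e * rescale th e r y + rescale g e r y).
  apply/funext => y; rewrite /Fl /Fr /rescale /g.
  have -> : ((y - e) / r - - (e / r)) * r = y by field.
  by rewrite /th; ring.
have Tl : 0 <= T Fl.
  have Fl0 y : 0 <= Fl y by rewrite mulr_ge0 ?step_ge0.
  apply: (posl Fl p (e - r / 2) (test_smooth tFl) Fl0 dp).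
  - by rewrite ltrBlDr ltrDl divr_gt0.
  - move=> y; rewrite negb_and -!ltNge => /orP[h|h]; rewrite /Fl.
      by rewrite hpsi ?mul0r// negb_and -ltNge h.
    rewrite /rescale /lf step_eq0 ?mulr0//.
    have : - 2^-1 <= (y - e) / r by rewrite ler_pdivlMr//; lra.
    lra.
have Tr : 0 <= T Fr.
  have Fr0 y : 0 <= Fr y by rewrite mulr_ge0 ?step_ge0.
  have er : e < e + r / 2 by rewrite ltrDl divr_gt0.
  apply: (posr Fr (e + r / 2) q (test_smooth tFr) Fr0 er qd).
  - move=> y; rewrite negb_and -!ltNge => /orP[h|h]; rewrite /Fr; last first.
      by rewrite hpsi ?mul0r// negb_and -!ltNge h orbT.
    rewrite /rescale /rt step_eq0 ?mulr0//.
    have : (y - e) / r <= 2^-1 by rewrite ler_pdivrMr//; lra.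
    lra.
have Tg : `|T (rescale g e r)| <= eps / 2.
  apply: le_trans rD.
  have -> : r * D = C * (2 ^+ N * ((2 * M) * B) * r) by rewrite /D; ring.
  apply: (bs _ _ _ nr sg hg) => k z kN.
  have K0 : 0 <= 2 ^+ N * ((2 * M) * B) * r by rewrite !mulr_ge0 ?exprn_ge0// ltW.
  have [hz|hz] := boolP (-1 <= z <= 1); last by rewrite (supp_in_derive1n k hg hz) normr0.
  apply: le_trans (@derive1n_mul_bound _ k _ _ z (2 * M * r) B sg0 sth _ _) _; last first.
  - have -> : 2 ^+ N * (2 * M * B) * r = 2 ^+ N * (2 * M * r * B) by ring.
    have h0 : 0 <= 2 * M * r * B by rewrite !mulr_ge0// ltW.
    by rewrite (ler_wpM2r h0)// ler_weXn2l// ler1n.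
  - by move=> i ik; apply: hB; exact: leq_trans kN.
  - move=> i ik; have iN := leq_trans ik kN.
    have hM1 : M * r <= 2 * M * r by rewrite -mulrA ler_peMl ?mulr_ge0 ?ler1n// ltW.
    case: i ik iN => [|i] ik iN.
      have := @taylor2 R psi psi^[1] psi^[2] e ((z - - (e / r)) * r) M.
      have Ez : (z - - (e / r)) * r = z * r + e by field.
      rewrite Ez addrK => ht; have {}ht : `|psi (z * r + e) - psi e - z * r * psi^[1] e| <= M * (z * r) ^+ 2.
        apply: ht => [w _|w _|w _]; [exact: smooth_is_derive 0 w spsi|exact: smooth_is_derive 1%N w spsi|].
        by apply: hM; rewrite addn2.
      have hzr : `|z * r| <= r by rewrite normrM (gtr0_norm r0) ler_piMl ?(ltW r0)// ler_norml.
      rewrite derive1n0 Ez.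
      have -> : psi (z * r + e) - psi e = (psi (z * r + e) - psi e - z * r * psi^[1] e) +
        z * r * psi^[1] e by ring.
      apply: le_trans (ler_normD _ _) _.
      have h1 : `|z * r * psi^[1] e| <= r * M.
        by rewrite normrM; apply: ler_pM => //; apply: hM; rewrite addn2.
      have h2 : M * (z * r) ^+ 2 <= M * r.
        rewrite ler_wpM2l// -real_normK ?num_real// expr2 -[leRHS]mulr1.
        by apply: ler_pM => //; exact: le_trans r1.
      by lra.
    rewrite (derive1n_sub _ spr (@smooth_cst R (psi e))).
    rewrite (derive1n_affine _ _ _ spsi).
    have -> : (fun _ : R => psi e)^[i.+1] z = 0.
      have h : (fun _ : R => psi e)^[1] = fun=> 0 by apply/funext => w; rewrite derive1n1 derive1_cst.
      rewrite derive1nSr h; apply: derive1n_near0; exact: filterE.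
    rewrite subr0; apply: le_trans hM1; rewrite normrM mulrC; apply: ler_pM => //.
      by apply: hM; rewrite (leq_trans iN)// leq_addr.
    rewrite normrX (gtr0_norm r0) exprS ler_piMr ?(ltW r0)// exprn_ile1//; exact: ltW.
have Tth : `|psi e * T (rescale th e r)| <= eps / 2.
  rewrite normrM (ger0_norm (psi0 e)).
  have h : `|T (rescale th e r)| <= eps / 2 / (psi e + 1).
    by apply: hd1; rewrite gtr0_norm// r0.
  apply: (@le_trans _ _ ((psi e + 1) * (eps / 2 / (psi e + 1)))).
    by apply: ler_pM => //; rewrite lerDl.
  by rewrite mulrC divfK// gt_eqF.
have tr f : test_function f -> test_function (rescale f e r) by exact: test_rescale.
have tt1 := tr _ tth; have tt2 := tr _ tg.
have tt3 : test_function (fun y => psi e * rescale th e r y) by exact: test_scale tt1.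
rewrite {1}decomp (dist_add hT (test_add tFl tFr) (test_add tt3 tt2)).
rewrite (dist_add hT tFl tFr) (dist_add hT tt3 tt2) (dist_scale _ hT tt1).
move: Tg Tth; rewrite !ler_norml; lra.
Qed.

End CornerEstimate.

(** * The maximum principle *)

Section MaximumPrinciple.
Context {R : realType}.
Implicit Types (u v : R -> R -> R) (x t s : R).

(* With time variable t, the heat kernel t^-1 gk (x / t) solves u_t = (t/2) u_xx. *)
Definition heat_sol s u : Prop := exists (ux uxx : R -> R -> R) (L : R), 
  [/\ forall x t, s <= t -> is_derive x 1 (u ^~ t) (ux x t),
      forall x t, s <= t -> is_derive x 1 (ux ^~ t) (uxx x t),
      forall x t, s <= t -> is_derive t 1 (u x) (t / 2 * uxx x t) &
      forall x t, s <= t -> `|ux x t| <= L].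

Lemma heat_sol_add s u v : heat_sol s u -> heat_sol s v ->
  heat_sol s (fun x t => u x t + v x t).
Proof.
move=> [ux [uxx [L [h1 h2 h3 h4]]]] [vx [vxx [M [k1 k2 k3 k4]]]].
exists (fun x t => ux x t + vx x t), (fun x t => uxx x t + vxx x t), (L + M).
split=> x t st.
- exact: is_derive_add (h1 x t st) (k1 x t st).
- exact: is_derive_add (h2 x t st) (k2 x t st).
- by rewrite mulrDr; exact: is_derive_add (h3 x t st) (k3 x t st).
- by apply: le_trans (ler_normD _ _) _; apply: lerD; [exact: h4|exact: k4].
Qed.

Lemma heat_sol_scale s c u : heat_sol s u -> heat_sol s (fun x t => c * u x t).
Proof.
move=> [ux [uxx [L [h1 h2 h3 h4]]]].
exists (fun x t => c * ux x t), (fun x t => c * uxx x t), (`|c| * L).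
split=> x t st.
- exact: is_derive_scale (h1 x t st).
- exact: is_derive_scale (h2 x t st).
- by rewrite mulrCA; exact: is_derive_scale (h3 x t st).
- by rewrite normrM ler_wpM2l//; exact: h4.
Qed.

Lemma heat_sol_cst s c : heat_sol s (fun _ _ => c).
Proof.
exists (fun _ _ => 0), (fun _ _ => 0), 0; split=> x t _ //.
- exact: is_derive_cst.
- exact: is_derive_cst.
- by rewrite mulr0; exact: is_derive_cst.
- by rewrite normr0.
Qed.

Lemma is_derive_gt0 (f : R -> R) x d : is_derive x 1 f d -> 0 < d ->
  exists2 e, 0 < e & forall h, 0 < h < e -> f (x - h) < f x < f (x + h).
Proof.
move=> [dfx dE] d0.
have lim : h^-1 *: (f (h *: 1 + x) - f x) @[h --> 0^'] --> d.
  by rewrite -dE; exact: dfx.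
have : \forall h \near 0^', 0 < h^-1 *: (f (h *: 1 + x) - f x).
  exact: (cvgr_gt d lim).
move=> /nbhs_ballP[e /= e0 he].
exists e => // h /andP[h0 he'].
have := he h; have := he (- h).
rewrite /ball/= !sub0r !normrN gtr0_norm// => /(_ he') h1 /(_ he') h2.
apply/andP; split.
  have := h1; rewrite oppr_eq0 gt_eqF// => /(_ isT).
  rewrite /GRing.scale/= mulr1 invrN mulNr oppr_gt0 pmulr_rlt0 ?invr_gt0//.
  by rewrite subr_lt0 addrC.
have := h2; rewrite gt_eqF// => /(_ isT).
by rewrite /GRing.scale/= mulr1 pmulr_rgt0 ?invr_gt0// subr_gt0 addrC.
Qed.

Lemma second_derivative_test (f f1 : R -> R) (a b x d : R) : a < x < b ->
  (forall y : R, is_derive y 1 f (f1 y)) -> is_derive x 1 f1 d ->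
  (forall y, a <= y <= b -> f x <= f y) -> 0 <= d.
Proof.
move=> /andP[ax xb] hf hf1 hmin; rewrite leNgt; apply/negP => d0.
have f1x : f1 x = 0.
  apply/eqP; rewrite eq_le; apply/andP; split; rewrite leNgt; apply/negP => h.
    have [e e0 he] := is_derive_gt0 (hf x) h.
    pose k := Num.min (e / 2) (x - a).
    have k0 : 0 < k < e.
      by rewrite lt_min divr_gt0//= subr_gt0 ax/= gt_min; apply/orP; left; lra.
    have /andP[+ _] := he k k0; apply/negP; rewrite -leNgt; apply: hmin.
    have : k <= x - a by rewrite ge_min lexx orbT.
    by case/andP: k0 => k0 _; lra.
  have hN : 0 < - f1 x by rewrite oppr_gt0.
  have hfN : is_derive x 1 (fun y => -1 * f y) (- f1 x).
    by apply: (is_derive_eq1 (is_derive_scale (-1) (hf x))); rewrite mulN1r.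
  have [e e0 he] := is_derive_gt0 hfN hN.
  pose k := Num.min (e / 2) (b - x).
  have k0 : 0 < k < e.
    by rewrite lt_min divr_gt0//= subr_gt0 xb/= gt_min; apply/orP; left; lra.
  have /andP[_] := he k k0; rewrite !mulN1r ltrN2; apply/negP; rewrite -leNgt; apply: hmin.
  have : k <= b - x by rewrite ge_min lexx orbT.
  by case/andP: k0 => k0 _; lra.
have hN : 0 < - d by rewrite oppr_gt0.
have hfN : is_derive x 1 (fun y => -1 * f1 y) (- d).
  by apply: (is_derive_eq1 (is_derive_scale (-1) hf1)); rewrite mulN1r.
have [e e0 he] := is_derive_gt0 hfN hN.
pose k := Num.min (e / 2) (b - x).
have k0 : 0 < k < e.
  by rewrite lt_min divr_gt0//= subr_gt0 xb/= gt_min; apply/orP; left; lra.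
have kb : k <= b - x by rewrite ge_min lexx orbT.
case/andP: (k0) => k0' ke.
have xk : x < x + k by rewrite ltrDl.
have [|c] := @MVT R f f1 x (x + k) xk (fun y _ => hf y).
  by apply: derivable_within_continuous => y _; have [] := hf y.
rewrite in_itv/= => /andP[xc cx] E.
have : f1 c < 0.
  have hc : 0 < c - x < e by rewrite subr_gt0 xc/=; lra.
  have /andP[_] := he (c - x) hc; rewrite !mulN1r f1x oppr0.
  by rewrite [x + _]addrC subrK oppr_gt0.
have := hmin (x + k); have : x + k - x = k by ring.
move=> Ek; rewrite Ek in E; move=> /(_ _)hm c0.
have : f1 c * k < 0 by rewrite pmulr_llt0.
have : f x <= f (x + k) by apply: hm; lra.
lra.
Qed.

(** Continuity in t at one point combines with a Lipschitz bound in x uniform in t, which is why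
    [heat_sol] records a bound on [ux]. *)
Lemma heat_sol_continuous s u x t : heat_sol s u -> s < t ->
  {for (x, t), continuous (fun p : R * R => u p.1 p.2)}.
Proof.
move=> [ux [uxx [L [h1 _ h3 h4]]]] st.
have L0 : 0 <= L by apply: le_trans (h4 x t (ltW st)).
have L1 : 0 < L + 1 by lra.
have Lip y t' : s <= t' -> `|u y t' - u x t'| <= L * `|y - x|.
  move=> st'.
  have mvt p q : p <= q -> `|u q t' - u p t'| <= L * (q - p).
    move=> pq; have [|c _ ->] := @MVT_segment R (u ^~ t') (ux ^~ t') p q pq (fun z _ => h1 z t' st').
      by apply: derivable_within_continuous => z _; have [] := h1 z t' st'.
    by rewrite normrM [`|q - p|]ger0_norm ?subr_ge0// ler_wpM2r ?subr_ge0//; exact: h4.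
  have [xy|yx] := leP x y; first by rewrite [`|y - x|]ger0_norm ?subr_ge0//; exact: mvt.
  by rewrite distrC (distrC y) [`|x - y|]gtr0_norm ?subr_gt0//; apply: mvt; exact: ltW.
have ct := is_derive_continuous (h3 x t (ltW st)).
apply/cvgrPdist_le => /= e e0.
have e2 : 0 < e / 2 by rewrite divr_gt0.
have : \forall t' \near t, `|u x t - u x t'| <= e / 2.
  by have /cvgrPdist_le/(_ _ e2) := ct.
move=> nt.
have nt2 : \forall t' \near t, s < t' by exact: lt_nbhsr.
have d0 : 0 < e / 2 / (L + 1) by rewrite divr_gt0.
exists (ball x (e / 2 / (L + 1)), [set t' | `|u x t - u x t'| <= e / 2 /\ s < t']) => /=.
  split; first exact: nbhsx_ballx.
  exact: filterI.
move=> [y t'] /= [+ [ht' st']]; rewrite /ball/= => hy.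
have -> : u x t - u y t' = (u x t - u x t') - (u y t' - u x t') by ring.
apply: le_trans (ler_normB _ _) _.
have : `|u y t' - u x t'| <= e / 2.
  apply: le_trans (Lip y t' (ltW st')) _.
  apply: (@le_trans _ _ ((L + 1) * `|y - x|)); first by rewrite ler_wpM2r// lerDl.
  by rewrite mulrC -ler_pdivlMr// distrC ltW.
lra.
Qed.

(** The weak minimum principle. At a negative interior minimum of u + del (t - s) the second
    x-derivative is nonnegative, so the t-derivative is positive and a slightly earlier value is
    smaller. The minimum may lie on the final time line, as only earlier times are compared. *)
Lemma heat_min s0 s t1 (a b : R) u : heat_sol s0 u -> s0 < s -> 0 < s -> a <= b ->
  (forall x, a <= x <= b -> 0 <= u x s) ->
  (forall t, s <= t <= t1 -> 0 <= u a t) -> (forall t, s <= t <= t1 -> 0 <= u b t) ->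
  forall x t, a <= x <= b -> s <= t <= t1 -> 0 <= u x t.
Proof.
move=> hu s0s s_gt0 ab us ua ub x1 t2 hx1 ht2; rewrite leNgt; apply/negP => neg.
case/andP: (ht2) => st2 t2t1.
pose D := t1 - s + 1; have D0 : 0 < D by rewrite /D; lra.
(* Small enough for the perturbed function to stay negative at (x1, t2). *)
pose del := - u x1 t2 / (2 * D).
have del0 : 0 < del by rewrite divr_gt0 ?oppr_gt0 ?mulr_gt0.
pose v x t := u x t + del * (t - s).
have vneg : v x1 t2 < 0.
  have : del * (t2 - s) <= del * D by rewrite ler_wpM2l ?(ltW del0)// /D; lra.
  have : del * D = - u x1 t2 / 2 by rewrite /del; field; rewrite gt_eqF.
  by rewrite /v; lra.
pose K : set (R * R) := `[a, b] `*` `[s, t1].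
have cK : compact K by apply: compact_setX; exact: segment_compact.
have K0 : K (x1, t2) by split; rewrite /= in_itv.
have cv : {within K, continuous (fun p : R * R => v p.1 p.2)}.
  apply: continuous_in_subspaceT => -[x t]; rewrite inE => -[/= _].
  rewrite in_itv/= => /andP[st _].
  have cu := @heat_sol_continuous s0 u x t hu (lt_le_trans s0s st).
  apply: (@continuousD _ _ _ (fun p : R * R => u p.1 p.2) (fun p : R * R => del * (p.2 - s)) (x, t)).
    exact: cu.
  apply: (@continuousM _ _ (fun=> del) (fun p : R * R => p.2 - s) (x, t)).
    exact: cst_continuous.
  apply: (@continuousB _ _ _ (fun p : R * R => p.2) (fun=> s) (x, t)).
    exact: cvg_snd.
  exact: cst_continuous.
have [|[x t]] := compact_EVT_min _ cK cv; first by exists (x1, t2).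
rewrite inE => -[/=]; rewrite !in_itv/= => /[dup] hx /andP[ax xb] /[dup] ht /andP[st tt1] hmin.
have hmin' y t' : a <= y <= b -> s <= t' <= t1 -> v x t <= v y t'.
  by move=> hy ht'; apply: (hmin (y, t')); rewrite inE; split; rewrite /= in_itv.
have vxt : v x t < 0 by apply: le_lt_trans vneg; exact: hmin'.
have dpos t' : s <= t' -> 0 <= del * (t' - s) by move=> h; apply: mulr_ge0; [exact: ltW|rewrite subr_ge0].
have ts : s < t.
  rewrite lt_neqAle st andbT; apply/eqP => E; move: vxt; rewrite -E /v subrr mulr0 addr0.
  by rewrite ltNge us.
have xa : a < x.
  rewrite lt_neqAle ax andbT; apply/eqP => E; move: vxt; rewrite -E /v.
  by have := ua t ht; have := dpos t st; lra.
have xb' : x < b.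
  rewrite lt_neqAle xb andbT; apply/eqP => E; move: vxt; rewrite E /v.
  by have := ub t ht; have := dpos t st; lra.
have [ux [uxx [L [h1 h2 h3 h4]]]] := hu.
have s0t : s0 <= t by lra.
have uxx0 : 0 <= uxx x t.
  apply: (@second_derivative_test (u ^~ t) (ux ^~ t) a b x) => //.
  - by rewrite xa.
  - by move=> y; exact: h1.
  - exact: h2.
  - by move=> y hy; have := hmin' y t hy ht; rewrite /v lerD2r.
have hv : is_derive t 1 (v x) (t / 2 * uxx x t + del * 1).
  apply: is_derive_add; first exact: h3.
  apply: is_derive_scale.
  have := is_derive_affine1 s 1 t; congr is_derive.
  by apply/funext => z; rewrite mulr1.
have hpos : 0 < t / 2 * uxx x t + del * 1.
  by rewrite mulr1 ltr_wpDl// mulr_ge0// divr_ge0//; lra.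
have [e e0 he] := is_derive_gt0 hv hpos.
pose k := Num.min (e / 2) (t - s).
have k0 : 0 < k < e.
  by rewrite lt_min divr_gt0//= subr_gt0 ts/= gt_min; apply/orP; left; lra.
have ks : k <= t - s by rewrite ge_min lexx orbT.
have /andP[+ _] := he k k0; apply/negP; rewrite -leNgt; apply: hmin' => //.
by case/andP: k0 => k0 _; lra.
Qed.

Lemma hconv_bounded T chi m s : distribution T -> test_function chi -> 0 < s ->
  exists B, forall x t, s <= t -> `|hconv T chi m x t| <= B.
Proof.
move=> hT tchi s0; have [A A0 hA] := test_supp_in tchi.
have AA : - A <= A by lra.
have [C [N [C0 hC]]] := dist_chi_bound AA hT (test_smooth tchi) hA.
have [M hM] : exists M, forall j x t y, (j <= N)%N -> s <= t -> `|hker (m + j) x t y| <= M.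
  elim: N {C C0 hC} => [|N [M hM]].
    have [B B0 hB] := hker_bounded (m + 0) s0; exists B => j x t y.
    by rewrite leqn0 => /eqP -> st; exact: hB.
  have [B B0 hB] := hker_bounded (m + N.+1) s0; exists (Num.max M B) => j x t y.
  rewrite leq_eqVlt ltnS le_max => /orP[/eqP ->|jN] st; first by rewrite hB ?orbT.
  by rewrite hM.
exists (C * M) => x t st; apply: hC; first exact: smooth_hker.
by move=> j y jN _; rewrite derive1n_hker; exact: hM.
Qed.

Lemma heat_sol_hconv T chi s : distribution T -> test_function chi -> 0 < s ->
  heat_sol s (hconv T chi 0).
Proof.
move=> hT tchi s0; have [B hB] := hconv_bounded 1 hT tchi s0.
exists (fun x t => - hconv T chi 1 x t), (hconv T chi 2), B.
split=> x t st; have t0 : 0 < t by exact: lt_le_trans st.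
- exact: is_derive_hconv_x.
- apply: (@is_derive_ext _ (fun x => -1 * hconv T chi 1 x t)); first by move=> z; rewrite mulN1r.
  by apply: (is_derive_eq1 (is_derive_scale (-1) (is_derive_hconv_x _ _ hT tchi t0)));
    rewrite mulN1r opprK.
- exact: is_derive_hconv_t.
- by rewrite normrN; exact: hB.
Qed.

(* A shifted x-derivative of the heat kernel, started at an earlier time: it
   dominates the negative part allowed by [corner_estimate] at time [s]. *)
Definition barrier (dir al s x t : R) : R :=
  dir * hker 1 x (Num.sqrt (t ^+ 2 + 7 * s ^+ 2)) (al - dir * s).

(** The squares of the scales add under the heat flow, so this clock runs 7 s^2 ahead. At t = s it
    shows sqrt(8) s, the width matching the layer exp(-(r/s)^2/4). *)
Let delayed s t := Num.sqrt (t ^+ 2 + 7 * s ^+ 2).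

Let delayed_ge s t : 0 <= t -> t <= delayed s t.
Proof.
move=> t0; rewrite -{1}(ger0_norm t0) -sqrtr_sqr.
by apply: ler_wsqrtr; rewrite lerDl mulr_ge0 ?sqr_ge0.
Qed.

Lemma heat_sol_barrier dir al s s0 : 0 < s0 -> heat_sol s0 (barrier dir al s).
Proof.
move=> s00; have [B B0 hB] := hker_bounded 2 s00.
pose y := al - dir * s.
exists (fun x t => - dir * hker 2 x (delayed s t) y),
  (fun x t => dir * hker 3 x (delayed s t) y), (`|dir| * B).
split=> x t st; have t0 : 0 < t by exact: lt_le_trans st.
all: have dt : t <= delayed s t by apply: delayed_ge; exact: ltW.
all: have d0 : 0 < delayed s t by exact: lt_le_trans dt.
- apply: (is_derive_eq1 (is_derive_scale dir (is_derive_hker_x 1 x (delayed s t) y))).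
  by ring.
- apply: (is_derive_eq1 (is_derive_scale (- dir) (is_derive_hker_x 2 x (delayed s t) y))).
  by ring.
- have q0 : 0 < t ^+ 2 + 7 * s ^+ 2.
    have h1 := exprn_gt0 2 t0; have h2 := sqr_ge0 s; lra.
  have hq : is_derive t 1 (fun t => t ^+ 2 + 7 * s ^+ 2) (2 * t).
    apply: (@is_derive_ext _ (fun t => t * t + 7 * s ^+ 2)); first by move=> z; rewrite expr2.
    apply: (is_derive_eq1 (is_derive_add (is_derive_mul (is_derive_id t 1) (is_derive_id t 1))
      (is_derive_cst (7 * s ^+ 2) t 1))).
    by ring.
  have hd : is_derive t 1 (delayed s) (t / delayed s t).
    have h0 := @is_derive_chain R (@Num.sqrt R) (fun t => t ^+ 2 + 7 * s ^+ 2) t _ _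
      (is_derive1_sqrt q0) hq.
    apply: (is_derive_eq1 h0).
    rewrite -/(delayed s t); field; by rewrite gt_eqF.
  apply: (is_derive_eq1 (is_derive_scale dir
    (is_derive_chain (is_derive_hker_t 1 x y d0) hd))).
  by field; rewrite gt_eqF.
- rewrite normrM normrN ler_wpM2l//; apply: hB; exact: le_trans dt.
Qed.

Lemma barrierE dir al s r t : dir * dir = 1 -> 
  barrier dir al s (al + dir * r) t =
  2 * (r + s) * (delayed s t)^-1 ^+ 3 * gk ((r + s) / delayed s t).
Proof.
move=> d1; rewrite /barrier /hker -/(delayed s t) (is_derive_derive1 (is_derive_gk _)).
set v := (delayed s t)^-1.
have -> : (al - dir * s - (al + dir * r)) * v = dir * - ((r + s) * v) by ring.
have -> : gk (dir * - ((r + s) * v)) = gk ((r + s) * v).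
  have : dir = 1 \/ dir = -1.
    have /eqP : (dir - 1) * (dir + 1) = 0 by transitivity (dir * dir - 1); [ring|rewrite d1 subrr].
    by rewrite mulf_eq0 => /orP[|]; rewrite ?subr_eq0 ?addr_eq0 => /eqP ->; [left|right].
  by case=> ->; rewrite ?mulN1r ?opprK// mul1r gkN.
transitivity (dir * dir * (2 * (r + s) * v ^+ 3 * gk ((r + s) * v))); first by ring.
by rewrite d1 mul1r.
Qed.

Lemma barrier_ge0 dir al s r t : dir * dir = 1 -> 0 <= r -> 0 <= s -> 
  0 <= barrier dir al s (al + dir * r) t.
Proof.
move=> d1 r0 s0; rewrite barrierE//.
apply: mulr_ge0; last exact: gk_ge0.
apply: mulr_ge0; first by rewrite mulr_ge0// addr_ge0.
by apply: exprn_ge0; rewrite invr_ge0 sqrtr_ge0.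
Qed.

(** With w = r / s, (w + 1)^2 <= 2 w^2 + 2 yields exp(-w^2/4) <= exp(1/4) exp(-(w+1)^2/8), whence
    the 8 and the factor exp(1/4). The shift of the source by s makes the linear factor r + s at
    least s, so the barrier does not degenerate at the corner. *)
Lemma barrier_start dir al s r C : dir * dir = 1 -> 0 <= r -> 0 < s -> 0 <= C ->
  C / s * expR (- ((r / s) ^+ 2 / 4)) <=
  C * (Num.sqrt 8 ^+ 3 * Num.sqrt pi * expR 4^-1 / 2) * s * barrier dir al s (al + dir * r) s.
Proof.
move=> d1 r0 s0 C0; rewrite barrierE//.
pose q : R := Num.sqrt 8; have q0 : 0 < q by rewrite sqrtr_gt0.
have qq : q ^+ 2 = 8 by rewrite sqr_sqrtr.
have -> : delayed s s = q * s.
  rewrite /delayed (_ : s ^+ 2 + 7 * s ^+ 2 = 8 * s ^+ 2); last by ring.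
  by rewrite sqrtrM// sqrtr_sqr gtr0_norm.
rewrite -/q /gk /gauss_fun; have p0 : 0 < Num.sqrt pi :> R by rewrite sqrtr_gt0 pi_gt0.
set P := Num.sqrt pi in p0 *.
have -> : C * (q ^+ 3 * P * expR 4^-1 / 2) * s * (2 * (r + s) * (q * s)^-1 ^+ 3 *
    (P^-1 * expR (- ((r + s) / (q * s)) ^+ 2))) =
  C / s * ((r / s + 1) * (expR 4^-1 * expR (- ((r + s) / (q * s)) ^+ 2))).
  move: (expR 4^-1) => E1; move: (expR _) => E2; rewrite exprVn; field.
  by rewrite !gt_eqF.
rewrite ler_wpM2l ?divr_ge0 ?(ltW s0)// -expRD.
set w := r / s; have w0 : 0 <= w by rewrite divr_ge0// ltW.
have -> : (r + s) / (q * s) = (w + 1) / q.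
  by rewrite /w; field; rewrite !gt_eqF.
rewrite (expr_div_n (w + 1) q) qq.
apply: (@le_trans _ _ (1 * expR (4^-1 - (w + 1) ^+ 2 / 8))); last first.
  by rewrite ler_wpM2r ?expR_ge0//; lra.
rewrite mul1r ler_expR.
have -> : (w + 1) ^+ 2 = 2 * w ^+ 2 + 2 - (w - 1) ^+ 2 by ring.
have := sqr_ge0 (w - 1); lra.
Qed.

(** On [al, be] x [s, t] the barriers of both corners and e / 2 are added to the means. The sum is
    nonnegative at time s by [corner_estimate], each half of the gap using its own corner, and on
    the sides by hypothesis. At the fixed time t the barriers carry a factor s. *)
Lemma gap T chi al be t0 r0 : distribution T -> test_function chi ->
  (forall y, 0 <= chi y) -> 0 < r0 -> (forall y, al - r0 <= y <= be + r0 -> chi y = 1) ->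
  al < be -> no_mass T al -> no_mass T be -> posd T al be ->
  (forall t, 0 < t < t0 -> 0 <= hconv T chi 0 al t) ->
  (forall t, 0 < t < t0 -> 0 <= hconv T chi 0 be t) ->
  forall x t, al <= x <= be -> 0 < t < t0 -> 0 <= hconv T chi 0 x t.
Proof.
move=> hT tchi chi0 r00 chi1 ab ha hb hpos hal hbe x t hx /andP[t_gt0 tt0].
pose L := be - al; have L0 : 0 < L by rewrite subr_gt0.
have d11 : (1 : R) * 1 = 1 by rewrite mulr1.
have dNN : (-1 : R) * -1 = 1 by rewrite mulrNN mulr1.
have posa : posd_dir T al 1 L.
  move=> psi p q spsi psi0 p0 qL hpsi; apply: (hpos psi (al + p) (al + q) spsi psi0).
  - by rewrite ltrDl.
  - by move: qL; rewrite /L; lra.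
  - by move=> y hy; apply: hpsi; apply: contra hy; rewrite mul1r; lra.
have posb : posd_dir T be (-1) L.
  move=> psi p q spsi psi0 p0 qL hpsi; apply: (hpos psi (be - q) (be - p) spsi psi0).
  - by move: qL; rewrite /L; lra.
  - by rewrite ltrBlDr ltrDl.
  - by move=> y hy; apply: hpsi; apply: contra hy; rewrite mulN1r; lra.
have chia y : `|y - al| <= r0 -> chi y = 1.
  by rewrite ler_norml => hy; apply: chi1; lra.
have chib y : `|y - be| <= r0 -> chi y = 1.
  by rewrite ler_norml => hy; apply: chi1; lra.
have [Ca Ca0 esta] := corner_estimate hT ha tchi chi0 L0 (or_introl erefl) posa r00 chia.
have [Cb Cb0 estb] := corner_estimate hT hb tchi chi0 L0 (or_intror erefl) posb r00 chib.
pose Q : R := Num.sqrt 8 ^+ 3 * Num.sqrt pi * expR 4^-1 / 2.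
have Q0 : 0 <= Q by rewrite !mulr_ge0 ?expR_ge0 ?sqrtr_ge0 ?exprn_ge0 ?invr_ge0 ?sqrtr_ge0.
have [G G0 hG] := @gk_bounded R 0.
pose Z := (Ca + Cb) * Q * (2 * (L + 1) * t^-1 ^+ 3 * G).
have Z0 : 0 <= Z.
  have tv : 0 <= t^-1 by rewrite invr_ge0 ltW.
  have CC : 0 <= Ca + Cb by rewrite addr_ge0.
  have L1 : 0 <= 2 * (L + 1) by lra.
  have tv3 : 0 <= t^-1 ^+ 3 by exact: exprn_ge0.
  exact: mulr_ge0 (mulr_ge0 CC Q0) (mulr_ge0 (mulr_ge0 L1 tv3) G0).
rewrite -oppr_le0; apply/ler_addgt0Pr => e e0; rewrite add0r lerNl.
have e2 : 0 < e / 2 by rewrite divr_gt0.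
have [sa sa0 {}esta] := esta _ e2; have [sb sb0 {}estb] := estb _ e2.
(* [Z] bounds the sum of the two barriers at time t after the factor s is taken out; s Z <= e / 2
   leaves a total error e. *)
pose s := Num.min (Num.min (sa / 2) (sb / 2)) (Num.min (Num.min (t / 2) 1) (e / 2 / (Z + 1))).
have Z1 : 0 < Z + 1 by lra.
have s_gt0 : 0 < s by rewrite !lt_min ltr01 !divr_gt0.
have s_sa : s < sa by apply: (@le_lt_trans _ _ (sa / 2)); [rewrite !ge_min lexx|lra].
have s_sb : s < sb by apply: (@le_lt_trans _ _ (sb / 2)); [rewrite !ge_min lexx orbT|lra].
have s_t : s < t by apply: (@le_lt_trans _ _ (t / 2)); [rewrite !ge_min lexx !orbT|lra].
have s_1 : s <= 1 by rewrite !ge_min lexx !orbT.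
have s_Z : s * Z <= e / 2.
  apply: (@le_trans _ _ (s * (Z + 1))); first by rewrite ler_wpM2l ?(ltW s_gt0)// lerDl.
  by rewrite -ler_pdivlMr// !ge_min lexx !orbT.
pose u x t := hconv T chi 0 x t + (Ca * Q * s * barrier 1 al s x t +
  (Cb * Q * s * barrier (-1) be s x t + e / 2)).
have s2 : 0 < s / 2 by rewrite divr_gt0.
have hu : heat_sol (s / 2) u.
  apply: heat_sol_add; first exact: heat_sol_hconv.
  apply: heat_sol_add; first by apply: heat_sol_scale; exact: heat_sol_barrier.
  apply: heat_sol_add; first by apply: heat_sol_scale; exact: heat_sol_barrier.
  exact: heat_sol_cst.
have xa y : y = al + 1 * (y - al) by ring.
have xb y : y = be + -1 * (be - y) by ring.
have CaQ : 0 <= Ca * Q * s by rewrite !mulr_ge0// ltW.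
have CbQ : 0 <= Cb * Q * s by rewrite !mulr_ge0// ltW.
have Ba y t' : al <= y <= be -> 0 <= Ca * Q * s * barrier 1 al s y t'.
  move=> /andP[y1 _]; rewrite mulr_ge0// [in barrier _ _ _ y](xa y) barrier_ge0 ?subr_ge0//.
  exact: ltW.
have Bb y t' : al <= y <= be -> 0 <= Cb * Q * s * barrier (-1) be s y t'.
  move=> /andP[_ y1]; rewrite mulr_ge0// [in barrier _ _ _ y](xb y) barrier_ge0 ?subr_ge0//.
  exact: ltW.
have main : 0 <= u x t.
  apply: (@heat_min (s / 2) s t al be u hu _ s_gt0 (ltW ab)) => //.
  - lra.
  - move=> y hy; rewrite /u; have b1 := Ba y s hy; have b2 := Bb y s hy.
    case/andP: hy => y1 y2.
    have [hm|hm] := leP (y - al) (L / 2).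
      have hr : 0 <= y - al <= L / 2 by rewrite subr_ge0 y1.
      have := esta s (y - al); rewrite s_gt0 s_sa -(xa y) => /(_ isT hr).
      case/andP: hr => hr _.
      have := barrier_start al d11 hr s_gt0 Ca0; rewrite -/Q -(xa y); move: b2.
      by move: (hconv _ _ _ _ _) (barrier 1 _ _ _ _) (barrier (-1) _ _ _ _) => z1 z2 z3; clear; lra.
    have hr : 0 <= be - y <= L / 2 by move: hm; rewrite subr_ge0 y2 /L; clear; lra.
    have := estb s (be - y); rewrite s_gt0 s_sb -(xb y) => /(_ isT hr).
    case/andP: hr => hr _.
    have := barrier_start be dNN hr s_gt0 Cb0; rewrite -/Q -(xb y); move: b1.
    by move: (hconv _ _ _ _ _) (barrier 1 _ _ _ _) (barrier (-1) _ _ _ _) => z1 z2 z3; clear; lra.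
  - move=> t' /andP[t'1 t'2]; have hh : al <= al <= be by rewrite lexx ltW.
    rewrite /u; have b1 := Ba al t' hh; have b2 := Bb al t' hh.
    have h : 0 <= hconv T chi 0 al t'.
      by apply: hal; rewrite (lt_le_trans s_gt0 t'1) (le_lt_trans t'2 tt0).
    by move: b1 b2 h e2; move: (hconv _ _ _ _ _) (barrier 1 _ _ _ _) (barrier (-1) _ _ _ _) => z1 z2 z3; clear; lra.
  - move=> t' /andP[t'1 t'2]; have hh : al <= be <= be by rewrite lexx ltW.
    rewrite /u; have b1 := Ba be t' hh; have b2 := Bb be t' hh.
    have h : 0 <= hconv T chi 0 be t'.
      by apply: hbe; rewrite (lt_le_trans s_gt0 t'1) (le_lt_trans t'2 tt0).
    by move: b1 b2 h e2; move: (hconv _ _ _ _ _) (barrier 1 _ _ _ _) (barrier (-1) _ _ _ _) => z1 z2 z3; clear; lra.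
  - lra.
have bd dir ga r C : dir * dir = 1 -> 0 <= r <= L -> 0 <= C ->
    C * Q * s * barrier dir ga s (ga + dir * r) t <=
    s * (C * Q * (2 * (L + 1) * t^-1 ^+ 3 * G)).
  move=> d1 /andP[r_ge0 rL] C0; rewrite barrierE//.
  have dt : t <= delayed s t by apply: delayed_ge; exact: ltW.
  have d0 : 0 < delayed s t by exact: lt_le_trans dt.
  rewrite [leRHS](_ : _ = C * Q * s * (2 * (L + 1) * t^-1 ^+ 3 * G)); last by ring.
  apply: ler_wpM2l; first by rewrite !mulr_ge0// ltW.
  have dv : 0 <= (delayed s t)^-1 by rewrite invr_ge0 ltW.
  have tv : 0 <= t^-1 by rewrite invr_ge0 ltW.
  apply: ler_pM; rewrite ?gk_ge0//.
  - by rewrite !mulr_ge0 ?addr_ge0 ?exprn_ge0// ltW.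
  - apply: ler_pM; rewrite ?exprn_ge0 ?mulr_ge0 ?addr_ge0 ?(ltW s_gt0)//.
      by rewrite ler_wpM2l// lerD.
    by rewrite lerXn2r ?nnegrE// lef_pV2 ?posrE.
  - by have := hG ((r + s) / delayed s t); rewrite derive1n0 ger0_norm ?gk_ge0.
have hxa : 0 <= x - al <= L by case/andP: hx => x1 x2; rewrite subr_ge0 x1 /L; clear -x2; lra.
have hxb : 0 <= be - x <= L by case/andP: hx => x1 x2; rewrite subr_ge0 x2 /L; clear -x1; lra.
have := bd 1 al _ Ca d11 hxa Ca0; rewrite -(xa x).
have := bd (-1) be _ Cb dNN hxb Cb0; rewrite -(xb x).
move: main s_Z; rewrite /u /Z.
rewrite [s * ((Ca + Cb) * _ * _)](_ : _ = s * (Ca * Q * (2 * (L + 1) * t^-1 ^+ 3 * G)) +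
  s * (Cb * Q * (2 * (L + 1) * t^-1 ^+ 3 * G))); last by ring.
by move: (hconv _ _ _ _ _) (barrier 1 _ _ _ _) (barrier (-1) _ _ _ _) => z1 z2 z3; clear; lra.
Qed.

End MaximumPrinciple.

(** * Integrals over intervals *)

Section IntervalIntegral.
Context {R : realType}.
Implicit Types (f g F : R -> R) (A B x y : R).

Definition itg f A B : R := \int[@lebesgue_measure R]_(x in `[A, B]) f x.

Lemma itg_integrable f A B : continuous f ->
  (@lebesgue_measure R).-integrable `[A, B] (EFin \o f).
Proof.
move=> cf; apply: continuous_compact_integrable; first exact: segment_compact.
exact: continuous_subspaceT.
Qed.

Lemma itgD f g A B : continuous f -> continuous g ->
  itg (fun x => f x + g x) A B = itg f A B + itg g A B.
Proof. by move=> cf cg; apply: RintegralD => //; exact: itg_integrable. Qed.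

Lemma itgB f g A B : continuous f -> continuous g ->
  itg (fun x => f x - g x) A B = itg f A B - itg g A B.
Proof. by move=> cf cg; apply: RintegralB => //; exact: itg_integrable. Qed.

Lemma itgZ (c : R) f A B : continuous f -> itg (fun x => c * f x) A B = c * itg f A B.
Proof. by move=> cf; apply: RintegralZl => //; exact: itg_integrable. Qed.

Lemma itg_cst (c : R) A B : A <= B -> itg (fun=> c) A B = c * (B - A).
Proof.
move=> AB; rewrite /itg.
rewrite Rintegral_cst; last exact: measurable_itv.
rewrite /= lebesgue_measure_itv/=.
rewrite lte_fin; move: AB; rewrite le_eqVlt => /orP[/eqP ->|AB].
  by rewrite ltxx /= subrr.
by rewrite AB.
Qed.

Lemma itg_le f g A B : continuous f -> continuous g ->
  (forall x, A <= x <= B -> f x <= g x) -> itg f A B <= itg g A B.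
Proof.
move=> cf cg h; apply: le_Rintegral; [exact: measurable_itv|exact: itg_integrable|exact: itg_integrable|].
by move=> x /=; rewrite in_itv; exact: h.
Qed.

Lemma itg_ge0 f A B : (forall x, A <= x <= B -> 0 <= f x) -> 0 <= itg f A B.
Proof. by move=> h; apply: Rintegral_ge0 => x /=; rewrite in_itv; exact: h. Qed.

Lemma continuous_norm f : continuous f -> continuous (fun x => `|f x|).
Proof. by move=> cf x; apply: continuous_comp; [exact: cf|exact: norm_continuous]. Qed.

Lemma itg_norm f A B : continuous f -> `|itg f A B| <= itg (fun x => `|f x|) A B.
Proof. by move=> cf; apply: le_normr_Rintegral => //; exact: itg_integrable. Qed.

Lemma itg_norm_le f g A B : continuous f -> continuous g ->
  (forall x, A <= x <= B -> `|f x| <= g x) -> `|itg f A B| <= itg g A B.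
Proof.
move=> cf cg h; apply: le_trans (itg_norm _ _ cf) _.
by apply: itg_le => //; exact: continuous_norm.
Qed.

Lemma itg_bound f A B M : A <= B -> continuous f ->
  (forall x, A <= x <= B -> `|f x| <= M) -> `|itg f A B| <= M * (B - A).
Proof.
move=> AB cf h; rewrite -itg_cst//; apply: itg_norm_le => //.
by move=> x; exact: cst_continuous.
Qed.

Lemma itg_FTC f F A B : A <= B -> continuous f ->
  (forall x, A <= x <= B -> is_derive x 1 F (f x)) -> itg f A B = F B - F A.
Proof.
rewrite le_eqVlt => /orP[/eqP <-|AB] cf hF.
  by rewrite subrr /itg set_itv1 Rintegral_set1.
have cF x : A <= x <= B -> {for x, continuous F}.
  by move=> /hF h; exact: is_derive_continuous h.
rewrite /itg /Rintegral (@continuous_FTC2 R f F A B AB)//.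
- exact: continuous_subspaceT.
- split.
  + by move=> x; rewrite in_itv/= => /andP[/ltW h1 /ltW h2]; have [|] := hF x; rewrite ?h1.
  + by apply: cvg_at_right_filter; apply: cF; rewrite lexx ltW.
  + by apply: cvg_at_left_filter; apply: cF; rewrite lexx ltW.
- move=> x; rewrite in_itv/= => /andP[/ltW h1 /ltW h2].
  by rewrite -derive1n1; apply: is_derive_derive1; apply: hF; rewrite h1.
Qed.

(** The primitive is known only to the right of A; hence base points one unit to the left of the
    interval at hand. *)
Lemma primitive_exists f A : continuous f ->
  exists F, forall x, A < x -> is_derive x 1 F (f x).
Proof.
move=> cf; exists (fun x => itg f A x) => x Ax.
have x1 : x < x + 1 by rewrite ltrDl.
have [d e] := continuous_FTC1_closed x1 (itg_integrable A (x + 1) cf) Ax (cf x).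
by rewrite -e -derive1n1; exact: derivable_is_derive.
Qed.

Lemma itg_chasles f A B C : A <= B -> B <= C -> continuous f ->
  itg f A C = itg f A B + itg f B C.
Proof.
move=> AB BC cf; have [F hF] := primitive_exists (A - 1) cf.
have h x : A <= x -> is_derive x 1 F (f x) by move=> Ax; apply: hF; lra.
have H P Q : A <= P -> P <= Q -> itg f P Q = F Q - F P.
  by move=> AP PQ; apply: (itg_FTC PQ cf) => x /andP[Px _]; apply: h; exact: le_trans Px.
rewrite (H A C) ?(le_trans AB BC)// (H A B)// (H B C)//.
by ring.
Qed.

Lemma itg_eq f g A B : (forall x, A <= x <= B -> f x = g x) -> itg f A B = itg g A B.
Proof. by move=> h; apply: eq_Rintegral => x; rewrite inE /= in_itv; exact: h. Qed.

Lemma itg_subset f A B A' B' : continuous f -> (forall x, 0 <= f x) ->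
  A' <= A -> A <= B -> B <= B' -> itg f A B <= itg f A' B'.
Proof.
move=> cf f0 h1 h2 h3; rewrite (itg_chasles h1 (le_trans h2 h3) cf) (itg_chasles h2 h3 cf).
have : 0 <= itg f A' A by apply: itg_ge0.
have : 0 <= itg f B B' by apply: itg_ge0.
lra.
Qed.

Lemma continuous_affine (f : R -> R) al r : continuous f ->
  continuous (fun y => f ((y - al) * r)).
Proof.
move=> cf x; apply: (@continuous_comp _ _ _ (fun y => (y - al) * r)); last exact: cf.
exact: is_derive_continuous (is_derive_affine1 al r x).
Qed.

Lemma itg_affine f A B x t : A <= B -> 0 < t -> continuous f ->
  itg (fun y => f ((y - x) * t^-1)) A B = t * itg f ((A - x) * t^-1) ((B - x) * t^-1).
Proof.
move=> AB t0 cf; have tv : 0 < t^-1 by rewrite invr_gt0.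
have [F hF] := primitive_exists ((A - x) * t^-1 - 1) cf.
have AB' : (A - x) * t^-1 <= (B - x) * t^-1 by rewrite ler_pM2r// lerD2r.
have -> : itg f ((A - x) * t^-1) ((B - x) * t^-1) = F ((B - x) * t^-1) - F ((A - x) * t^-1).
  by apply: (itg_FTC AB' cf) => y /andP[h _]; apply: hF; lra.
rewrite mulrBr; apply: (@itg_FTC _ (fun y => t * F ((y - x) * t^-1)) _ _ AB).
  exact: continuous_affine.
move=> y /andP[h _]; have hy : (A - x) * t^-1 - 1 < (y - x) * t^-1.
  have : (A - x) * t^-1 <= (y - x) * t^-1 by rewrite ler_pM2r// lerD2r.
  lra.
have h' := @is_derive_chain R F (fun y => (y - x) * t^-1) y _ _ (hF _ hy) (is_derive_affine1 x t^-1 y).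
apply: (is_derive_eq1 (is_derive_scale t h')).
by rewrite mulrCA mulfV ?mulr1// gt_eqF.
Qed.

Lemma itg_opp f A B : A <= B -> continuous f ->
  itg (fun y => f (- y)) A B = itg f (- B) (- A).
Proof.
move=> AB cf; have [F hF] := primitive_exists (- B - 1) cf.
have AB' : - B <= - A by rewrite lerN2.
have -> : itg f (- B) (- A) = F (- A) - F (- B).
  by apply: (itg_FTC AB' cf) => y /andP[h _]; apply: hF; lra.
have oppE y : (y - 0) * -1 = - y by rewrite subr0 mulrN1.
transitivity (-1 * F (- B) - -1 * F (- A)); last by ring.
apply: (@itg_FTC _ (fun y => -1 * F (- y)) _ _ AB).
  move=> y; have := @continuous_affine f 0 (-1) cf y.
  by rewrite (_ : (fun y => f ((y - 0) * -1)) = (fun y => f (- y)))//; apply/funext => z; rewrite oppE.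
move=> y /andP[_ h]; have hy : - B - 1 < (y - 0) * -1 by rewrite oppE; lra.
have := is_derive_scale (-1) (@is_derive_chain R F (fun y => (y - 0) * -1) y _ _
  (hF _ hy) (is_derive_affine1 0 (-1) y)).
rewrite oppE (_ : (fun y => -1 * F ((y - 0) * -1)) = (fun y => -1 * F (- y))).
  by move=> h'; apply: (is_derive_eq1 h'); ring.
by apply/funext => z; rewrite oppE.
Qed.

Lemma itg_parts f g f1 g1 A B : A <= B -> continuous f1 -> continuous g1 ->
  (forall x, is_derive x 1 f (f1 x)) -> (forall x, is_derive x 1 g (g1 x)) ->
  g A = 0 -> g B = 0 ->
  itg (fun x => f x * g1 x) A B = - itg (fun x => f1 x * g x) A B.
Proof.
move=> AB cf1 cg1 hf hg gA gB.
have cf : continuous f by move=> x; exact: is_derive_continuous (hf x).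
have cg : continuous g by move=> x; exact: is_derive_continuous (hg x).
have c1 : continuous (fun x => f1 x * g x) by move=> x; apply: cvgM; [exact: cf1|exact: cg].
have c2 : continuous (fun x => f x * g1 x) by move=> x; apply: cvgM; [exact: cf|exact: cg1].
have c3 : continuous (fun x => f1 x * g x + f x * g1 x).
  by move=> x; apply: cvgD; [exact: c1|exact: c2].
have := @itg_FTC _ (fun x => f x * g x) A B AB c3 (fun x _ => is_derive_mul (hf x) (hg x)).
by rewrite (itgD _ _ c1 c2) gA gB !mulr0 subrr => /eqP; rewrite addrC addr_eq0 => /eqP.
Qed.

Lemma itg_parts_n f psi n A B : A <= B -> smooth f -> smooth psi ->
  (forall k, psi^[k] A = 0) -> (forall k, psi^[k] B = 0) ->
  itg (fun x => f x * psi^[n] x) A B = (-1) ^+ n * itg (fun x => f^[n] x * psi x) A B.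
Proof.
move=> AB sf spsi pA pB; elim: n f sf => [|n IH] f sf; first by rewrite expr0 mul1r.
have -> : itg (fun x => f x * psi^[n.+1] x) A B = - itg (fun x => f^[1] x * psi^[n] x) A B.
  apply: (@itg_parts f (psi^[n]) (f^[1]) (psi^[n.+1]) A B AB _ _ _ _ (pA n) (pB n)).
  - exact: smooth_continuous sf.
  - exact: smooth_continuous spsi.
  - by move=> x; exact: smooth_is_derive 0 x sf.
  - by move=> x; exact: smooth_is_derive n x spsi.
by rewrite (IH _ (smooth_derive1 sf)) exprS mulN1r mulNr -derive1nSr.
Qed.

Lemma itg_setT f A B : continuous f -> supp_in A B f ->
  \int[@lebesgue_measure R]_x f x = itg f A B.
Proof.
move=> cf hf; rewrite /itg Rintegral_mkcond [RHS]Rintegral_mkcond.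
apply: eq_Rintegral => x _; rewrite !patchE in_setT; case: ifPn => //.
by rewrite notin_setE/= in_itv => /negP/hf.
Qed.

Lemma itg_mass f e : continuous f -> (forall x, 0 <= f x) ->
  (\int[@lebesgue_measure R]_x (f x)%:E = 1)%E -> 0 < e ->
  exists2 M, 0 < M & forall A B, A <= - M -> M <= B -> 1 - e <= itg f A B <= 1.
Proof.
move=> cf f0 f1 e0.
have /measurable_EFinP mf := continuous_measurable_fun cf.
have le1 A B : itg f A B <= 1.
  rewrite -lee_fin -f1 /itg /Rintegral fineK; last first.
    by apply: integrable_fin_num; [exact: measurable_itv|exact: itg_integrable].
  apply: ge0_subset_integral => //=.
  by move=> x _; rewrite lee_fin.
pose D (n : nat) : set R := `[- n%:R, n%:R].
have UD : \bigcup_n D n = setT.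
  apply/seteqP; split=> // x _; exists (Num.truncn `|x|).+1 => //=.
  by rewrite /D /= in_itv/= -ler_norml ltW// truncnS_gt.
have : (\int[@lebesgue_measure R]_(x in D n) (f x)%:E)%E @[n --> \oo] --> (1%:E : \bar R).
  rewrite -f1 -UD; apply: ge0_nondecreasing_set_cvg_integral.
  - move=> m n mn; apply/subsetPset => x; rewrite /D /= !in_itv/= => /andP[h1 h2].
    have mn' : (m%:R : R) <= n%:R by rewrite ler_nat.
    by apply/andP; split; lra.
  - by move=> n; exact: measurable_itv.
  - by move=> n; apply: measurable_funS mf.
  - by move=> n x _; rewrite lee_fin.
move=> /fine_cvgP[_] /cvgrPdist_lt /(_ e e0) [n _ hn].
exists n.+1%:R => [|A B hA hB]; first by rewrite ltr0n.
rewrite le1 andbT; have := hn n.+1 (leqnSn n).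
have -> : (fine \o (fun n => \int[@lebesgue_measure R]_(x in D n) (f x)%:E)%E) n.+1 =
  itg f (- n.+1%:R) n.+1%:R by [].
rewrite ltr_distl => /andP[_ h].
have n0 : 0 <= n.+1%:R :> R by rewrite ler0n.
have : itg f (- n.+1%:R) n.+1%:R <= itg f A B by apply: itg_subset => //; lra.
lra.
Qed.

End IntervalIntegral.

(** * From heat means back to the distribution *)

Section Transfer.
Context {R : realType}.
Implicit Types (f g F : R -> R) (A B x y : R).

Lemma lipschitz_of_derive f f1 L : 0 <= L -> continuous f1 -> (forall x, is_derive x 1 f (f1 x)) ->
  (forall x, `|f1 x| <= L) -> forall x y, `|f x - f y| <= L * `|x - y|.
Proof.
move=> L0 c1 h1 hL x y; wlog yx : x y / y <= x => [hw|].
  have [/hw//|/ltW/hw] := leP y x.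
  by rewrite distrC (distrC y).
rewrite -(itg_FTC yx c1 (fun z _ => h1 z)) (ger0_norm (x := x - y)) ?subr_ge0//.
by apply: itg_bound => // z _; exact: hL.
Qed.

(** (w^2 + 1) g = g''/4 + 3g/2 dominates |w| g, and the right-hand side has bounded integrals
    because g' is bounded and g has mass 1. *)
Lemma itg_gk_first_moment : exists2 C, 0 <= C & forall A B, A <= B ->
  itg (fun w => `|w| * gk w) A B <= C.
Proof.
have [b b0 hb] := @gk_bounded R 1; exists (2^-1 * b + 3 / 2); first by lra.
move=> A B AB; have cg k : continuous ((@gk R)^[k]) := @smooth_continuous R gk k (@smooth_gk R).
have cg0 : continuous (@gk R) := cg 0%N.
have cid : continuous (fun x : R => x) by move=> x; exact: cvg_id.
have c1 : continuous (fun w : R => `|w| * gk w).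
  by move=> x; apply: cvgM; [exact: norm_continuous|exact: cg0].
have c2 : continuous (fun w : R => 4^-1 * gk^[2] w).
  by move=> x; apply: cvgM; [exact: cst_continuous|exact: cg].
have c3 : continuous (fun w : R => 3 / 2 * gk w).
  by move=> x; apply: cvgM; [exact: cst_continuous|exact: cg0].
have le : itg (fun w => `|w| * gk w) A B <= itg (fun w => 4^-1 * gk^[2] w + 3 / 2 * gk w) A B.
  apply: itg_le => // [x|w _]; first by apply: cvgD; [exact: c2|exact: c3].
  have -> : gk^[2] w = (4 * w ^+ 2 - 2) * gk w.
    by rewrite gk_rec (is_derive_derive1 (is_derive_gk w)) /=; ring.
  have -> : 4^-1 * ((4 * w ^+ 2 - 2) * gk w) + 3 / 2 * gk w = (w ^+ 2 + 1) * gk w by field.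
  rewrite ler_pM2r ?gk_gt0//.
  have := sqr_ge0 (`|w| - 1); rewrite sqrrB real_normK ?num_real//.
  have := normr_ge0 w; lra.
apply: le_trans le _; rewrite (itgD _ _ c2 c3) (itgZ _ _ _ cg0) (itgZ _ _ _ (cg 2%N)).
rewrite (@itg_FTC R (gk^[2]) (gk^[1]) A B AB (cg 2%N)
  (fun x _ => @smooth_is_derive R gk 1%N x (@smooth_gk R))).
have [M _ hM] := @itg_mass R gk 1 cg0 (@gk_ge0 R) (let: conj (And4 _ _ h _) _ := @gk_testT1 R in h) ltr01.
have : itg gk A B <= 1.
  have := hM (Num.min A (- M)) (Num.max B M); rewrite ge_min lexx orbT le_max lexx orbT => /(_ isT isT) /andP[_].
  by apply: le_trans; apply: itg_subset => //; [exact: gk_ge0|rewrite ge_min lexx|rewrite le_max lexx].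
move: (hb A) (hb B); rewrite !ler_norml; move: (gk^[1] A) (gk^[1] B) (itg gk A B) => u v w.
lra.
Qed.

(** The heat kernel as an approximate identity. The first moment gives an error L C t, so the rate
    depends on f only through its Lipschitz constant and its bound, uniformly in y. *)
Lemma hker_approx L M e : 0 <= L -> 0 <= M -> 0 < e ->
  exists2 t1, 0 < t1 & forall f t A B y, continuous f ->
    (forall x y, `|f x - f y| <= L * `|x - y|) -> (forall x, `|f x| <= M) ->
    0 < t < t1 -> A <= y - 1 -> y + 1 <= B ->
    `|itg (fun x => hker 0 x t y * f x) A B - f y| <= e.
Proof.
move=> L0 M0 e0; have [C C0 hC] := itg_gk_first_moment.
have cg0 : continuous (@gk R) := @smooth_continuous R gk 0 (@smooth_gk R).
have e'0 : 0 < e / 2 / (M + 1) by rewrite !divr_gt0//; lra.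
have [K K0 hK] := @itg_mass R gk _ cg0 (@gk_ge0 R)
  (let: conj (And4 _ _ h _) _ := @gk_testT1 R in h) e'0.
have d0 : 0 < e / 2 / (L * C + 1) by rewrite !divr_gt0//; have := mulr_ge0 L0 C0; lra.
exists (Num.min K^-1 (e / 2 / (L * C + 1))) => [|f t A B y cf hL hM /andP[t0]].
  by rewrite lt_min invr_gt0 K0.
rewrite lt_min => /andP[tK td] Ay yB; have tv : 0 < t^-1 by rewrite invr_gt0.
have AB : A <= B by lra.
have hE x : hker 0 x t y = t^-1 * gk ((x - y) * t^-1).
  by rewrite /hker expr1 -gkN -mulNr opprB.
have ck : continuous (fun x => gk ((x - y) * t^-1)) := @continuous_affine R gk y t^-1 cg0.
have ck1 : continuous (fun x => t^-1 * gk ((x - y) * t^-1)).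
  by move=> x; apply: cvgM; [exact: cst_continuous|exact: ck].
have mass : 1 - e / 2 / (M + 1) <= itg (fun x => t^-1 * gk ((x - y) * t^-1)) A B <= 1.
  rewrite (itgZ _ _ _ ck) (itg_affine _ AB t0 cg0) mulrA mulVf ?gt_eqF// mul1r.
  have Kt : K <= t^-1 by rewrite -(invrK K) lef_pV2 ?posrE ?invr_gt0// ltW.
  apply: hK.
    apply: le_trans (_ : - t^-1 <= _); last by lra.
    by rewrite -(mulN1r t^-1) ler_pM2r//; lra.
  by apply: le_trans Kt _; rewrite -[leLHS]mul1r ler_pM2r//; lra.
rewrite (itg_eq (g := fun x => t^-1 * gk ((x - y) * t^-1) * (f x - f y) +
  f y * (t^-1 * gk ((x - y) * t^-1)))); last by move=> x _; rewrite hE; ring.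
have c1 : continuous (fun x => t^-1 * gk ((x - y) * t^-1) * (f x - f y)).
  move=> x; apply: cvgM; [exact: ck1|].
  by apply: cvgB; [exact: cf|exact: cst_continuous].
have c2 : continuous (fun x => f y * (t^-1 * gk ((x - y) * t^-1))).
  by move=> x; apply: cvgM; [exact: cst_continuous|exact: ck1].
have cF : continuous (fun w : R => `|w| * gk w).
  by move=> x; apply: cvgM; [exact: norm_continuous|exact: cg0].
have cFa := @continuous_affine R _ y t^-1 cF.
rewrite (itgD _ _ c1 c2) (itgZ _ _ _ ck1).
have h1 : `|itg (fun x => t^-1 * gk ((x - y) * t^-1) * (f x - f y)) A B| <= L * C * t.
  apply: le_trans (_ : itg (fun x => L * (`|(x - y) * t^-1| * gk ((x - y) * t^-1))) A B <= _).
    apply: itg_norm_le => // [x|x _]; first by apply: cvgM; [exact: cst_continuous|exact: cFa].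
    rewrite /= (normrM _ (f x - f y)) (normrM t^-1) (normrM (x - y)) (gtr0_norm tv) (ger0_norm (gk_ge0 _)).
    have := hL x y; have g0 := gk_ge0 ((x - y) * t^-1) => h.
    have := ler_wpM2l (mulr_ge0 (ltW tv) g0) h.
    by congr (_ <= _); ring.
  rewrite (itgZ _ _ _ cFa) (itg_affine _ AB t0 cF) -mulrA (mulrC C) ler_wpM2l//.
  rewrite ler_wpM2l ?(ltW t0)//; apply: hC.
  by rewrite ler_pM2r// lerD2r.
have LC : L * C * t <= e / 2.
  have p0 : 0 < L * C + 1 by have := mulr_ge0 L0 C0; lra.
  have : t * (L * C + 1) < e / 2 by rewrite -ltr_pdivlMr.
  rewrite mulrDr mulr1 mulrC; lra.
have h2 : `|f y * itg (fun x => t^-1 * gk ((x - y) * t^-1)) A B - f y| <= e / 2.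
  have -> z : f y * z - f y = f y * (z - 1) by ring.
  rewrite normrM; have p0 : 0 < M + 1 by lra.
  have -> : e / 2 = (M + 1) * (e / 2 / (M + 1)) by field; rewrite gt_eqF.
  apply: ler_pM => //; first by have := hM y; lra.
  by rewrite ler_norml; move: mass => /andP[m1 m2]; apply/andP; split; lra.
by rewrite -addrA; apply: le_trans (ler_normD _ _) _; lra.
Qed.

Lemma riemann_sum f L A d n : 0 <= L -> continuous f ->
  (forall x y, `|f x - f y| <= L * `|x - y|) -> 0 <= d ->
  `|\sum_(i < n) d * f (A + i%:R * d) - itg f A (A + n%:R * d)| <= L * d * (n%:R * d).
Proof.
move=> L0 cf hL d0; elim: n => [|n IH].
  by rewrite big_ord0 mul0r addr0 mulr0 /itg set_itv1 Rintegral_set1 subrr normr0.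
have nd : 0 <= n%:R * d by rewrite mulr_ge0.
have e : A + n.+1%:R * d = A + n%:R * d + d by rewrite -natr1; ring.
rewrite big_ord_recr /= (itg_chasles (B := A + n%:R * d)) ?lerDl//; last by rewrite e lerDl.
have -> : L * d * (n.+1%:R * d) = L * d * (n%:R * d) + L * d * d by rewrite -natr1; ring.
have -> : \sum_(i < n) d * f (A + i%:R * d) + d * f (A + n%:R * d) -
  (itg f A (A + n%:R * d) + itg f (A + n%:R * d) (A + n.+1%:R * d)) =
  (\sum_(i < n) d * f (A + i%:R * d) - itg f A (A + n%:R * d)) +
  (d * f (A + n%:R * d) - itg f (A + n%:R * d) (A + n.+1%:R * d)) by ring.
apply: le_trans (ler_normD _ _) _; apply: lerD => //.
have le1 : A + n%:R * d <= A + n.+1%:R * d by rewrite e lerDl.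
set P := A + n%:R * d in le1 e *.
have -> : d * f P = itg (fun=> f P) P (A + n.+1%:R * d).
  by rewrite itg_cst// e; ring.
rewrite -(itgB _ _ _ cf); last by move=> x; exact: cst_continuous.
have {3}-> : d = (A + n.+1%:R * d) - P by rewrite e; ring.
apply: itg_bound => // [x|x /andP[h1 h2]].
  by apply: cvgB; [exact: cst_continuous|exact: cf].
apply: le_trans (hL _ _) _; apply: ler_wpM2l => //.
by rewrite ler_norml; apply/andP; split; lra.
Qed.

Lemma hker_bounded_le N (t0 : R) : 0 < t0 ->
  exists2 B, 0 <= B & forall m x t y, (m <= N)%N -> t0 <= t -> `|hker m x t y| <= B.
Proof.
move=> t00; elim: N => [|N [B B0 hB]].
  have [B B0 hB] := @hker_bounded R 0 t0 t00; exists B => // m x t y.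
  by rewrite leqn0 => /eqP ->; exact: hB.
have [B' B'0 hB'] := @hker_bounded R N.+1 t0 t00; exists (B + B').
  by rewrite addr_ge0.
move=> m x t y; rewrite leq_eqVlt => /orP[/eqP -> /(hB' x _ y) h|]; first by lra.
by rewrite ltnS => mN /(hB m x _ y mN) h; lra.
Qed.

(** Differentiating the kernel in x instead of y gives (-1)^k, which cancels the sign of k
    integrations by parts. *)
Lemma itg_hker_parts psi k t y A B : A <= B -> smooth psi ->
  (forall j, psi^[j] A = 0) -> (forall j, psi^[j] B = 0) ->
  itg (fun x => hker 0 x t y * psi^[k] x) A B = itg (fun x => hker k x t y * psi x) A B.
Proof.
move=> AB spsi pA pB.
have fam m x : is_derive x 1 (fun x => (-1) ^+ m * hker m x t y) ((-1) ^+ m.+1 * hker m.+1 x t y).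
  apply: (is_derive_eq1 (is_derive_scale ((-1) ^+ m) (is_derive_hker_x m x t y))).
  by rewrite exprS; ring.
pose G m x := (-1) ^+ m * hker m x t y : R.
have G0 : G 0%N = (fun x => hker 0 x t y) by apply/funext => x; rewrite /G expr0 mul1r.
have sG : smooth (G 0%N) := @smooth_family R G fam.
have := @itg_parts_n R (G 0%N) psi k A B AB sG spsi pA pB.
rewrite (derive1n_family fam) G0 => ->.
have c : continuous (fun x => G k x * psi x).
  move=> x; apply: cvgM; first exact: is_derive_continuous (fam k x).
  exact: (@smooth_continuous R psi 0%N spsi).
rewrite -(itgZ _ _ _ c); apply: itg_eq => x _.
by rewrite /G !mulrA -exprMn mulrNN mulr1 expr1n mul1r.
Qed.

(** A Riemann sum of heat kernels centred at points X with the nonnegative weights d psi(X)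
    approximates [psi] with all derivatives up to the order of T. On the sum T is a nonnegative
    combination of the means. *)
Lemma transfer T chi p q t0 : distribution T -> test_function chi -> 0 < t0 ->
  (forall y, p <= y <= q -> chi y = 1) ->
  (forall x t, p <= x <= q -> 0 < t < t0 -> 0 <= hconv T chi 0 x t) -> posd T p q.
Proof.
move=> dT tchi t00 chi1 hpos psi p' q' spsi psi0 pp' q'q hsupp.
have tpsi : test_function psi := supp_in_test spsi hsupp.
have schi := test_smooth tchi.
have [A0 A00 hA0] := test_supp_in tchi.
have A0A0 : - A0 <= A0 by lra.
have [C [N [C0 hC]]] := dist_chi_bound A0A0 dT schi hA0.
have [M M0 hM] := test_bounded N.+1 tpsi.
apply/ler_addgt0Pr => e e0.
have e1 : 0 < e / 2 / (C + 1) by rewrite !divr_gt0//; lra.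
set e' := e / 2 / (C + 1) in e1.
have [t1 t10 ht1] := hker_approx M0 M0 e1.
pose t := Num.min t0 t1 / 2.
have m0 : 0 < Num.min t0 t1 by rewrite lt_min t00.
have t_gt0 : 0 < t by rewrite divr_gt0.
have tm : t < Num.min t0 t1 by rewrite /t; lra.
have [tt0 tt1] : t < t0 /\ t < t1 by move: tm; rewrite lt_min => /andP[].
have [Bk Bk0 hBk] := hker_bounded_le N.+1 t_gt0.
pose P := Num.min p' (- A0) - 1; pose Q := Num.max q' A0 + 1.
have [hP1 hP2] : P <= p' - 1 /\ P <= - A0 - 1.
  by rewrite /P !lerD2r !ge_min !lexx orbT.
have [hQ1 hQ2] : q' + 1 <= Q /\ A0 + 1 <= Q.
  by rewrite /Q !lerD2r !le_max !lexx orbT.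
have PQ : P < Q by lra.
have pP j : psi^[j] P = 0.
  by apply: (supp_in_derive1n j hsupp); apply/negP => /andP[h _]; lra.
have pQ j : psi^[j] Q = 0.
  by apply: (supp_in_derive1n j hsupp); apply/negP => /andP[_ h]; lra.
have ht_ : 0 < t < t1 by rewrite t_gt0.
pose L2 := 2 * Bk * M.
have L20 : 0 <= L2 by rewrite /L2 mulr_ge0// mulr_ge0.
(* The Riemann sum error L2 (Q - P)^2 / n is then at most e'. *)
pose n := (Num.truncn (L2 * (Q - P) ^+ 2 / e')).+1.
have n0 : (0 : R) < n%:R by rewrite ltr0n.
pose d := (Q - P) / n%:R.
have d0 : 0 <= d by rewrite divr_ge0 ?ltW// subr_gt0.
have nd : n%:R * d = Q - P by rewrite /d mulrCA mulfV ?mulr1// gt_eqF.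
have hd : L2 * d * (n%:R * d) <= e'.
  rewrite nd /d; have : L2 * (Q - P) ^+ 2 / e' < n%:R by exact: truncnS_gt.
  rewrite ltr_pdivrMr// => /ltW h.
  have -> z : L2 * ((Q - P) / z) * (Q - P) = L2 * (Q - P) ^+ 2 / z by ring.
  by rewrite ler_pdivrMr// (mulrC e').
pose X (i : 'I_n) := P + (i : nat)%:R * d.
pose S y := \sum_(i < n) d * (psi (X i) * hker 0 (X i) t y).
have sS i : smooth (fun y => d * (psi (X i) * hker 0 (X i) t y)).
  by apply: smooth_scale; apply: smooth_scale; exact: smooth_hker.
have sSS : smooth S := smooth_sum (r := index_enum _) (P := xpredT) sS.
have SE k y : S^[k] y = \sum_(i < n) d * (hker k (X i) t y * psi (X i)).
  rewrite (derive1n_sum _ _ k sS); apply: eq_bigr => i _.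
  rewrite derive1n_scale; last by apply: smooth_scale; exact: smooth_hker.
  rewrite derive1n_scale; last exact: smooth_hker.
  by rewrite derive1n_hker add0n (mulrC (psi _)).
have bound : `|T (fun y => chi y * (psi y - S y))| <= C * (e' + e').
  apply: hC => [|k y kN hy]; first exact: smooth_sub spsi sSS.
  rewrite (derive1n_sub k spsi sSS) SE.
  have ck : continuous (psi^[k]) := @smooth_continuous R psi k spsi.
  have hk : (k <= N.+1)%N := leqW kN.
  have lip : forall x x', `|psi^[k] x - psi^[k] x'| <= M * `|x - x'|.
    apply: (lipschitz_of_derive M0 (@smooth_continuous R psi k.+1 spsi)).
      by move=> x; exact: smooth_is_derive k x spsi.
    by move=> x; exact: hM.
  have := ht1 (psi^[k]) t P Q y ck lip (fun x => hM k x hk) ht_.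
  have [hy1 hy2] : P <= y - 1 /\ y + 1 <= Q by move: hy => /andP[hy1 hy2]; clear -hP2 hQ2 hy1 hy2; split; lra.
  move=> /(_ hy1 hy2); rewrite (itg_hker_parts _ _ _ (ltW PQ) spsi pP pQ) => a1.
  have der x : is_derive x 1 (fun x => hker k x t y * psi x)
      (- hker k.+1 x t y * psi x + hker k x t y * psi^[1] x).
    by apply: is_derive_mul; [exact: is_derive_hker_x|exact: (@smooth_is_derive R psi 0%N x spsi)].
  have ch j : continuous (fun x => hker j x t y).
    by move=> x; exact: is_derive_continuous (is_derive_hker_x j x t y).
  have c1 : continuous (fun x => - hker k.+1 x t y * psi x + hker k x t y * psi^[1] x).
    move=> x; apply: cvgD; apply: cvgM; [apply: cvgN; exact: ch| |exact: ch|].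
      exact: (@smooth_continuous R psi 0%N spsi).
    exact: (@smooth_continuous R psi 1%N spsi).
  have lip2 : forall x x', `|hker k x t y * psi x - hker k x' t y * psi x'| <= L2 * `|x - x'|.
    apply: (lipschitz_of_derive L20 c1 der) => x.
    apply: le_trans (ler_normD _ _) _; rewrite (normrM _ (psi x)) (normrM _ (psi^[1] x)) normrN.
    have -> : L2 = Bk * M + Bk * M by rewrite /L2; ring.
    apply: lerD; apply: (ler_pM (normr_ge0 _) (normr_ge0 _)).
    - exact: (hBk k.+1 x t y kN (lexx t)).
    - exact: (hM 0%N x (leq0n _)).
    - exact: (hBk k x t y hk (lexx t)).
    - exact: (hM 1%N x (ltn0Sn N)).
  have cc : continuous (fun x => hker k x t y * psi x).
    by move=> x; exact: is_derive_continuous (der x).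
  have := @riemann_sum _ L2 P d n L20 cc lip2 d0.
  rewrite nd [P + _]addrC subrK -nd => a2.
  rewrite -[X in `|X|](_ : (psi^[k] y - itg (fun x => hker k x t y * psi x) P Q) +
     (itg (fun x => hker k x t y * psi x) P Q - \sum_(i < n) d * (hker k (X i) t y * psi (X i))) = _);
     last by ring.
  apply: le_trans (ler_normD _ _) _; apply: lerD; rewrite distrC//.
  exact: le_trans a2 hd.
have tS : test_function (fun y => chi y * S y) := test_mulr tchi sSS.
have TS : 0 <= T (fun y => chi y * S y).
  have -> : (fun y => chi y * S y) = (fun y => \sum_(i < n) (d * psi (X i)) * (chi y * hker 0 (X i) t y)).
    by apply/funext => y; rewrite /S mulr_sumr; apply: eq_bigr => i _; ring.
  have th i : test_function (fun y => chi y * hker 0 (X i) t y).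
    by apply: test_mulr tchi _; exact: smooth_hker.
  rewrite (dist_sum _ dT) => [|i]; last exact: test_scale (th i).
  apply: sumr_ge0 => i _; rewrite (dist_scale _ dT (th i)).
  have [h|h] := boolP (p' <= X i <= q'); last by rewrite (hsupp _ h) mulr0 mul0r.
  apply: mulr_ge0; first exact: mulr_ge0.
  by apply: hpos; [move: h => /andP[]; lra|rewrite t_gt0].
have TE : T psi = T (fun y => chi y * (psi y - S y)) + T (fun y => chi y * S y).
  rewrite -(dist_add dT _ tS); last exact: test_mulr tchi (smooth_sub spsi sSS).
  congr T; apply/funext => y; rewrite -mulrDr subrK.
  have [h|h] := boolP (p' <= y <= q'); last by rewrite (hsupp _ h) mulr0.
  by rewrite chi1 ?mul1r//; move: h => /andP[h1 h2]; clear -h1 h2 pp' q'q; lra.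
have Ce : C * (e' + e') <= e.
  rewrite /e'; clear -C0 e0; have -> : e / 2 / (C + 1) + e / 2 / (C + 1) = e / (C + 1).
    by field; lra.
  by rewrite mulrCA ler_piMr ?ltW// ltr_pdivrMr ?mul1r; lra.
move: bound; rewrite ler_norml TE => /andP[h _]; clear -h TS Ce; lra.
Qed.

End Transfer.

(** * Positivity from heat means *)

Section Positivity.
Context {R : realType}.
Implicit Types (T : (R -> R) -> R) (chi : R -> R) (p q x y : R).

(** The form of Baire's theorem used below: the property P n is imposed at stage n, and strict
    inclusions keep the limit point inside ]p0, q0[ and in every interval. *)
Lemma nested_intervals (G : R -> R -> Prop) (P : nat -> R -> R -> Prop) p0 q0 :
  p0 < q0 -> G p0 q0 ->
  (forall n p q, p < q -> G p q ->
     exists p' q', [/\ p < p', p' < q', q' < q, G p' q' & P n p' q']) ->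
  exists2 z, p0 < z < q0 & forall n, exists p q, p <= z <= q /\ P n p q.
Proof.
move=> pq0 G0 hstep.
(* The state carries the stage number, since dependent choice provides no index. *)
pose X := {u : nat * (R * R) | u.2.1 < u.2.2 /\ G u.2.1 u.2.2}.
pose rel (u v : X) := [/\ (sval v).1 = (sval u).1.+1, (sval u).2.1 < (sval v).2.1,
  (sval v).2.2 < (sval u).2.2 & P (sval u).1 (sval v).2.1 (sval v).2.2].
have hrel u : {v | rel u v}.
  apply: cid; case: u => [[n [p q]] [/= pq Gpq]].
  have [p' [q' [h1 h2 h3 h4 h5]]] := hstep n p q pq Gpq.
  by exists (exist _ (n.+1, (p', q')) (conj h2 h4)).
have [F [F0 hF]] := dependent_choice hrel (exist _ (0%N, (p0, q0)) (conj pq0 G0)).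
pose a n := (sval (F n)).2.1; pose b n := (sval (F n)).2.2.
have ab n : a n < b n by rewrite /a /b; case: (F n) => ? [].
have Fn n : (sval (F n)).1 = n.
  by elim: n => [|n IH]; [rewrite F0|have [-> _ _ _] := hF n; rewrite IH].
have aS n : a n < a n.+1 by have [] := hF n.
have bS n : b n.+1 < b n by have [] := hF n.
have am n k : a n <= a (n + k)%N.
  by elim: k => [|k IH]; rewrite ?addn0// addnS (le_trans IH)// ltW.
have bm n k : b (n + k)%N <= b n.
  by elim: k => [|k IH]; rewrite ?addn0// addnS (le_trans _ IH)// ltW.
have amb n m : a n <= b m.
  apply: le_trans (am n m) _; rewrite addnC; apply: le_trans (bm m n).
  exact: ltW.
have ub : has_ubound (range a) by exists (b 0%N) => _ [n _ <-].
pose z := sup (range a).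
have az n : a n <= z by apply: ub_le_sup => //; exists n.
have zb n : z <= b n by apply: ge_sup => [|_ [m _ <-]//]; exists (a 0%N), 0%N.
have a0 : a 0%N = p0 by rewrite /a F0.
have b0 : b 0%N = q0 by rewrite /b F0.
exists z => [|n].
  by rewrite -a0 -b0 (lt_le_trans (aS 0%N))// (le_lt_trans (zb 1%N)).
exists (a n.+1), (b n.+1); rewrite az zb; split=> //.
by have [_ _ _] := hF n; rewrite Fn.
Qed.

Lemma posd_sub T c d c' d' : c <= c' -> d' <= d -> posd T c d -> posd T c' d'.
Proof.
move=> cc dd h psi p q spsi psi0 cp qd; apply: h => //.
  exact: le_lt_trans cc cp.
exact: lt_le_trans qd dd.
Qed.

(** The set S of points near which T is not positive. *)
Let bad T c d x := c < x < d /\ ~ exists2 e, 0 < e & posd T (x - e) (x + e).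

Let posd_good T c d p q : distribution T -> c <= p -> q <= d ->
  (forall x, p < x < q -> ~ bad T c d x) -> posd T p q.
Proof.
move=> dT cp qd h; apply: posd_local => // x /andP[px xq].
apply: contrapT => hx; apply: (h x); first by rewrite px.
by split=> //; rewrite (le_lt_trans cp)//= (lt_le_trans xq).
Qed.

Let bad_open T c d x e y : 0 < e -> posd T (x - e) (x + e) -> `|y - x| < e -> ~ bad T c d y.
Proof.
move=> e0 h yx [_]; apply; exists (e - `|y - x|); first by rewrite subr_gt0.
by apply: posd_sub h; have := ler_norm (y - x); have := ler_norm (x - y); rewrite (distrC x); lra.
Qed.

(** If x were the only bad point nearby, T would be positive on both sides of x, hence across it by
    [isolated_point]. *)
Let bad_perfect T c d x p q : distribution T -> (forall al, c < al < d -> no_mass T al) ->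
  bad T c d x -> p < x < q -> exists y, [/\ p < y < q, y <> x & bad T c d y].
Proof.
move=> dT nm [/andP[cx xd] bx] /andP[px xq]; apply: contrapT => hn; apply: bx.
pose e := Num.min (Num.min (x - p) (q - x)) (Num.min (x - c) (d - x)).
have e0 : 0 < e by rewrite !lt_min !subr_gt0 px xq cx xd.
have [h1 h2 h3 h4] : [/\ e <= x - p, e <= q - x, e <= x - c & e <= d - x].
  by rewrite /e !ge_min !lexx ?orbT.
exists e => //; apply: isolated_point => //.
- by apply: nm; rewrite cx.
- apply: (@posd_good T c d) => // [||y /andP[y1 y2] hy]; [lra|lra|].
  by apply: hn; exists y; split=> //; [apply/andP; split; lra|move=> yx; rewrite yx ltxx in y2].
- apply: (@posd_good T c d) => // [||y /andP[y1 y2] hy]; [lra|lra|].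
  by apply: hn; exists y; split=> //; [apply/andP; split; lra|move=> yx; rewrite yx ltxx in y1].
Qed.

Lemma continuous_lt0 (f : R -> R) x : {for x, continuous f} -> f x < 0 ->
  exists2 e, 0 < e & forall y, `|y - x| <= e -> f y < 0.
Proof.
move=> cf fx; have fx' : 0 < - f x by rewrite oppr_gt0.
move/cvgrPdist_lt : cf => /(_ _ fx') /nbhs_ballP[e /= e0 he]; exists (e / 2); first by rewrite divr_gt0.
move=> y hy; have : `|f x - f y| < - f x.
  by apply: he; rewrite /ball/= distrC; apply: le_lt_trans hy _; lra.
by rewrite ltr_norml => /andP[h _]; lra.
Qed.

(* The Baire category argument: a portion of the bad set on which the Gaussian
   means are nonnegative up to a uniform scale. *)
Let portion T chi c d (E : set R) : distribution T -> test_function chi -> countable E ->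
  (forall al, c < al < d -> no_mass T al) ->
  (forall x, c < x < d -> ~ E x -> exists2 t0, 0 < t0 &
     forall t, 0 < t < t0 -> 0 <= hconv T chi 0 x t) ->
  (exists x, bad T c d x) ->
  exists p q t0, [/\ c <= p, q <= d, 0 < t0, exists2 x, p < x < q & bad T c d x &
    forall x t, bad T c d x -> p < x < q -> 0 < t < t0 -> 0 <= hconv T chi 0 x t].
Proof.
move=> dT tchi /countable_injP[f finj] nm hE [x0 bx0].
apply: contrapT => hn.
(* If no portion works, every interval meeting the bad set contains a bad point with a negative mean
   at a time below 1/(n+1), and by continuity an interval of such points. [P n] records this and
   also avoids the n-th point of E, so the limit point lies outside E and has negative means at
   arbitrarily small times. *)
pose G p q := [/\ c <= p, q <= d & exists2 x, p < x < q & bad T c d x].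
pose P (n : nat) p q := (forall z, p <= z <= q -> E z -> f z <> n) /\
  exists2 t, 0 < t < n.+1%:R^-1 & forall z, p <= z <= q -> hconv T chi 0 z t < 0.
have cd : c < d by case: bx0 => /andP[h1 h2] _; exact: lt_trans h1 h2.
have G0 : G c d by split=> //; exists x0 => //; case: bx0.
have hstep n p q : p < q -> G p q ->
    exists p' q', [/\ p < p', p' < q', q' < q, G p' q' & P n p' q'].
  move=> pq [cp qd [x xpq bx]].
  have [y [u [ypq by_ u0 hu]]] : exists y u, [/\ p < y < q, bad T c d y, 0 < u &
      forall z, `|z - y| < u -> E z -> f z <> n].
    have [[w [Ew fw]]|hw] := pselect (exists w, E w /\ f w = n); last first.
      by exists x, 1; split=> // z _ Ez fz; apply: hw; exists z.
    have [y [ypq yw by_]] : exists y, [/\ p < y < q, y <> w & bad T c d y].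
      have [xw|xw] := pselect (x = w); last by exists x.
      by have [y [h1 h2 h3]] := bad_perfect dT nm bx xpq; exists y; rewrite -xw.
    exists y, `|w - y|; split=> //; first by rewrite normr_gt0 subr_eq0; apply/eqP => h; apply: yw.
    move=> z hz Ez fz; have zw : z = w by apply: finj; rewrite ?inE// fz.
    by move: hz; rewrite zw ltxx.
  move: (ypq) => /andP[py yq].
  pose e := Num.min u (Num.min (y - p) (q - y)).
  have e0 : 0 < e by rewrite !lt_min !subr_gt0 py yq u0.
  have [e1 e2 e3] : [/\ e <= u, e <= y - p & e <= q - y] by rewrite /e !ge_min !lexx ?orbT.
  have [x' [t [bx' hx' ht hneg]]] : exists x' t, [/\ bad T c d x', y - e < x' < y + e,
      0 < t < n.+1%:R^-1 & hconv T chi 0 x' t < 0].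
    apply: contrapT => hc; apply: hn; exists (y - e), (y + e), n.+1%:R^-1.
    split; [lra|lra|by rewrite invr_gt0 ltr0n| |].
      by exists y => //; apply/andP; split; lra.
    move=> x' t bx' hx' ht; rewrite leNgt; apply/negP => hneg.
    by apply: hc; exists x', t.
  have cx' : {for x', continuous (fun z => hconv T chi 0 z t)}.
    by apply: is_derive_continuous (is_derive_hconv_x 0 x' dT tchi _); case/andP: ht.
  have [v v0 hv] := continuous_lt0 cx' hneg.
  move: (hx') => /andP[x1 x2].
  pose g := Num.min v (Num.min (x' - (y - e)) (y + e - x')).
  have g0 : 0 < g by rewrite !lt_min !subr_gt0 x1 x2 v0.
  have [g1 g2 g3] : [/\ g <= v, g <= x' - (y - e) & g <= y + e - x'].
    by rewrite /g !ge_min !lexx ?orbT.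
  have [i1 i2 i3] : [/\ p < x' - g / 2, x' - g / 2 < x' + g / 2 & x' + g / 2 < q].
    by clear -g0 g2 g3 e2 e3; split; lra.
  exists (x' - g / 2), (x' + g / 2); split=> //.
    split; [exact: le_trans cp (ltW i1)|exact: le_trans (ltW i3) qd|].
    by exists x' => //; clear -g0; apply/andP; split; lra.
  split=> [z /andP[z1 z2]|].
    by apply: hu; clear -z1 z2 g0 g2 g3 e1; rewrite ltr_norml; apply/andP; split; lra.
  exists t => // z /andP[z1 z2]; apply: hv; clear -z1 z2 g0 g1.
  by rewrite ler_norml; apply/andP; split; lra.
have [z zcd hz] := nested_intervals cd G0 hstep.
have nEz : ~ E z.
  by move=> Ez; have [p [q [hpq [h _]]]] := hz (f z); exact: (h z hpq Ez).
have [t0 t00 ht0] := hE z zcd nEz.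
have [p [q [hpq [_ [t /andP[t1 t2] h]]]]] := hz (Num.truncn t0^-1).
have : 0 <= hconv T chi 0 z t.
  apply: ht0; rewrite t1; apply: lt_trans t2 _.
  by rewrite invf_plt ?posrE ?ltr0n//; exact: truncnS_gt.
by rewrite leNgt h.
Qed.

(** On a portion where the means at bad points are nonnegative, T is positive between any two bad
    points, so a bad point between two others would be good. Perfectness provides three bad
    points. *)
Lemma positivity T chi c d (E : set R) r0 : distribution T -> test_function chi ->
  (forall y, 0 <= chi y) -> 0 < r0 -> (forall y, c - r0 <= y <= d + r0 -> chi y = 1) ->
  countable E -> (forall al, c < al < d -> no_mass T al) ->
  (forall x, c < x < d -> ~ E x -> exists2 t0, 0 < t0 &
     forall t, 0 < t < t0 -> 0 <= hconv T chi 0 x t) ->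
  posd T c d.
Proof.
move=> dT tchi chi0 r00 chi1 cE nm hE.
apply: (@posd_good T c d) => // x _ bx.
have [p [q [t0 [cp qd t00 [x1 x1pq bx1] hpos]]]] :=
  portion dT tchi cE nm hE (ex_intro _ x bx).
have key u v : bad T c d u -> bad T c d v -> p < u -> u < v -> v < q -> posd T u v.
  move=> bu bv pu uv vq.
  apply: (transfer dT tchi t00) => [y /andP[h1 h2]|y t /andP[uy yv] ht].
    by apply: chi1; apply/andP; split; lra.
  have [by_|nby] := pselect (bad T c d y).
    by apply: hpos => //; apply/andP; split; lra.
  (* [sup A] and [inf B] are the ends of the gap around y. The bad set is relatively closed, so both
     ends are bad and y lies strictly between them. *)
  pose A := [set s | bad T c d s /\ u <= s <= y]; pose B := [set s | bad T c d s /\ y <= s <= v].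
  have Au : A u by split=> //; rewrite lexx.
  have Bv : B v by split=> //; rewrite lexx andbT.
  have hA : has_sup A by split; [exists u|exists y => s [_ /andP[]]].
  have hB : has_inf B by split; [exists v|exists y => s [_ /andP[]]].
  have ual : u <= sup A by apply: ub_le_sup => //; case: hA.
  have aly : sup A <= y by apply: ge_sup; [exists u|move=> s [_ /andP[]]].
  have bev : inf B <= v by apply: ge_inf => //; case: hB.
  have ybe : y <= inf B by apply: lb_le_inf; [exists v|move=> s [_ /andP[]]].
  have bal : bad T c d (sup A).
    split; first by apply/andP; split; lra.
    move=> [e e0 he]; have [s [bs hs] ss] := sup_adherent e0 hA.
    have sA : s <= sup A by apply: ub_le_sup => //; case: hA.
    apply: (bad_open e0 he _ bs); rewrite ltr_norml; apply/andP; split; lra.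
  have bbe : bad T c d (inf B).
    split; first by apply/andP; split; lra.
    move=> [e e0 he]; have [s [bs hs] ss] := inf_adherent e0 hB.
    have sB : inf B <= s by apply: ge_inf => //; case: hB.
    apply: (bad_open e0 he _ bs); rewrite ltr_norml; apply/andP; split; lra.
  have aly' : sup A < y.
    by rewrite lt_neqAle aly andbT; apply/eqP => h; apply: nby; rewrite -h.
  have ybe' : y < inf B.
    by rewrite lt_neqAle ybe andbT; apply/eqP => h; apply: nby; rewrite h.
  have albe : sup A < inf B by lra.
  have pos : posd T (sup A) (inf B).
    apply: (@posd_good T c d) => // [||s /andP[s1 s2] bs]; [lra|lra|].
    have [sy|ys] := leP s y.
      have : s <= sup A by apply: ub_le_sup; [case: hA|split=> //; apply/andP; split; lra].
      by move=> h; lra.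
    have : inf B <= s by apply: ge_inf; [case: hB|split=> //; apply/andP; split; lra].
    by move=> h; lra.
  have chi' w : sup A - r0 <= w <= inf B + r0 -> chi w = 1.
    by move=> /andP[w1 w2]; apply: chi1; apply/andP; split; lra.
  apply: (gap dT tchi chi0 r00 chi' albe _ _ pos _ _ _ ht).
  - by apply: nm; case: bal.
  - by apply: nm; case: bbe.
  - by move=> s hs; apply: hpos => //; apply/andP; split; lra.
  - by move=> s hs; apply: hpos => //; apply/andP; split; lra.
  - by rewrite aly ybe.
have key' u v w : bad T c d u -> bad T c d v -> bad T c d w -> p < u -> u < v -> v < w ->
    w < q -> False.
  move=> bu bv bw pu uv vw wq.
  have := key u w bu bw pu (lt_trans uv vw) wq => h.
  case: bv => _; apply; exists (Num.min (v - u) (w - v)); first by rewrite lt_min !subr_gt0 uv.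
  apply: posd_sub h.
    have : Num.min (v - u) (w - v) <= v - u by rewrite ge_min lexx.
    by lra.
  have : Num.min (v - u) (w - v) <= w - v by rewrite ge_min lexx orbT.
  by lra.
have [x2 [x2pq x21 bx2]] := bad_perfect dT nm bx1 x1pq.
have three u v : bad T c d u -> bad T c d v -> p < u -> u < v -> v < q -> False.
  move=> bu bv pu uv vq.
  have [|w [/andP[uw wq] wv bw]] := bad_perfect (p := u) (q := q) dT nm bv; first by rewrite uv.
  have [h|h|h] := ltgtP w v; last exact: wv.
    exact: (key' u w v).
  exact: (key' u v w).
move: x1pq x2pq => /andP[h1 h2] /andP[h3 h4].
have [h|h|h] := ltgtP x1 x2; last by apply: x21.
  exact: (three x1 x2).
exact: (three x2 x1).
Qed.

End Positivity.

(** * Monotonicity *)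

Section SumDistribution.
Context {R : realType}.
Implicit Types (T S : (R -> R) -> R) (phi psi : R -> R).

Lemma distribution_add T S : distribution T -> distribution S ->
  distribution (fun phi => T phi + S phi).
Proof.
move=> [lT bT] [lS bS]; split=> [c phi psi tphi tpsi|K cK].
  by rewrite lT// lS//; ring.
have [C [N h]] := bT K cK; have [C' [N' h']] := bS K cK.
exists (C + C'), (maxn N N') => phi M tphi supp hM; rewrite mulrDl.
apply: le_trans (ler_normD _ _) _; apply: lerD.
  by apply: h => // k x kN; apply: hM; rewrite leq_max kN.
by apply: h' => // k x kN; apply: hM; rewrite leq_max kN orbT.
Qed.

Lemma distribution_scale T (c : R) : distribution T -> distribution (fun phi => c * T phi).
Proof.
move=> [lT bT]; split=> [d phi psi tphi tpsi|K cK]; first by rewrite lT//; ring.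
have [C [N h]] := bT K cK; exists (`|c| * C), N => phi M tphi supp hM.
by rewrite normrM -mulrA ler_wpM2l//; exact: h.
Qed.

Lemma Rintegral_subset (A B : set (measurableTypeR R)) (f : R -> R) : measurable A -> measurable B ->
  A `<=` B -> (forall x, 0 <= f x) -> (@lebesgue_measure R).-integrable B (EFin \o f) ->
  \int[@lebesgue_measure R]_(x in A) f x <= \int[@lebesgue_measure R]_(x in B) f x.
Proof.
move=> mA mB AB f0 fi; have fiA := integrableS mB mA AB fi.
rewrite /Rintegral fine_le ?integrable_fin_num//.
apply: ge0_subset_integral => //; first by case/integrableP: fi.
by move=> x _; rewrite lee_fin.
Qed.

Lemma half_expr_small (C e : R) : 0 < e -> exists n, C * 2^-1 ^+ n <= e.
Proof.
move=> e0; have p0 : 0 < e / (`|C| + 1) by rewrite divr_gt0// ltr_wpDl.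
have [n _ hn] := near_infty_natSinv_expn_lt (PosNum p0).
exists n; have := hn n (leqnn n); rewrite /= div1r -exprVn ltr_pdivlMr ?ltr_wpDl// => h.
have h2 : 0 <= 2^-1 ^+ n :> R by rewrite exprn_ge0.
apply: le_trans (ltW h); rewrite mulrC ler_wpM2l//.
by apply: le_trans (ler_norm C) _; rewrite lerDl.
Qed.

Lemma geometric_limit (s : nat -> R) C : 0 <= C ->
  (forall n, `|s n.+1 - s n| <= C * 2^-1 ^+ n.+1) ->
  forall n, `|limn s - s n| <= C * 2^-1 ^+ n.
Proof.
move=> C0 hs.
have hsm n k : `|s (n + k)%N - s n| <= C * 2^-1 ^+ n - C * 2^-1 ^+ (n + k)%N.
  elim: k => [|k IH]; first by rewrite addn0 !subrr normr0.
  have -> : s (n + k.+1)%N - s n = (s (n + k).+1 - s (n + k)%N) + (s (n + k)%N - s n).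
    by rewrite addnS; ring.
  apply: le_trans (ler_normD _ _) _.
  have := hs (n + k)%N; rewrite addnS exprS.
  by move: (2^-1 ^+ (n + k)) (s (n + k).+1) IH => u v; lra.
have p0 n : 0 <= C * 2^-1 ^+ n by rewrite mulr_ge0// exprn_ge0.
have hle n m : `|s m - s n| <= C * 2^-1 ^+ n + C * 2^-1 ^+ m.
  have [/subnKC <-|/ltnW /subnKC <-] := leqP n m.
    by apply: le_trans (hsm _ _) _; rewrite lerD2l; have := p0 (n + (m - n))%N; lra.
  rewrite distrC; apply: le_trans (hsm _ _) _; rewrite addrC lerD2r.
  by have := p0 (m + (n - m))%N; lra.
pose A := range (fun n => s n - C * 2^-1 ^+ n).
have ub n : ubound A (s n + C * 2^-1 ^+ n).
  by move=> _ [m _ <-]; have := hle n m; rewrite ler_norml; lra.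
have hl n : `|sup A - s n| <= C * 2^-1 ^+ n.
  rewrite ler_norml; apply/andP; split.
    rewrite lerNl opprB lerBlDr -lerBlDl; apply: ub_le_sup; last by exists n.
    by exists (s n + C * 2^-1 ^+ n).
  by rewrite lerBlDl; apply: ge_sup; [exists (s 0%N - C * 2^-1 ^+ 0), 0%N|exact: ub].
suff -> : limn s = sup A by [].
apply/cvg_lim => //; apply/cvgrPdist_le => e e0.
have [n hn] := half_expr_small C e0; exists n => // m /= nm.
apply: le_trans (hl m) _; apply: le_trans hn; rewrite ler_wpM2l//.
by rewrite ler_wiXn2l ?invr_ge0 ?invf_le1// ler1n.
Qed.

End SumDistribution.

(** * A small measure with infinite density on a null set *)

Section Penalty.
Context {R : realType}.
Implicit Types (phi psi : R -> R).
Local Notation lam := (@lebesgue_measure R).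

Lemma negligible_open_cover (Z : set R) (e : R) : lam.-negligible Z -> 0 < e ->
  exists U : set R, [/\ open U, Z `<=` U & (lam U <= e%:E)%E].
Proof.
move=> [Z' [mZ' Z'0 ZZ']] e0.
have fin : (lam Z' < +oo)%E by move: Z'0 => /= ->; exact: ltry.
have [U [oU ZU hU]] := lebesgue_regularity_outer mZ' fin e0.
exists U; split=> //; first exact: subset_trans ZU.
have mU : measurable (U : set (measurableTypeR R)) by exact: open_measurable.
rewrite -(setDUK ZU); apply: le_trans (measureU2 _ _ _) _ => //; first exact: measurableD.
by move: Z'0 hU => /= ->; rewrite add0e => /ltW.
Qed.

Lemma Rintegral_bounded (a b : R) (A : set (measurableTypeR R)) phi M : measurable A -> A `<=` `[a, b] ->
  continuous phi -> (forall x, `|phi x| <= M) ->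
  `|\int[lam]_(x in A) phi x| <= M * fine (lam A).
Proof.
move=> mA Aab cphi hM.
have fi g : continuous g -> lam.-integrable A (EFin \o g).
  by move=> cg; apply: integrableS (itg_integrable a b cg); [exact: measurable_itv| |].
apply: le_trans (le_normr_Rintegral mA (fi _ cphi)) _.
rewrite -Rintegral_cst//; apply: le_Rintegral => //.
  by apply: fi; exact: continuous_norm.
by apply: fi => x; exact: cst_continuous.
Qed.

Section Construction.
Variables (a b e : R) (Z : set R) (U : nat -> set R).
Hypotheses (ab : a < b) (e0 : 0 < e).
Hypothesis U_open : forall k, open (U k).
Hypothesis U_cover : forall k, Z `<=` U k.
Hypothesis U_small : forall k, (lam (U k) <= (e * 2^-1 ^+ k.+2)%:E)%E.

(** Term 0 spreads the mass e / 2 uniformly over ]a, b[; term k + 1 is Lebesgue measure on the part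
    of the k-th cover inside ]a, b[, of mass at most e / 2^(k+2). The total is at most e. *)
Let O k : set (measurableTypeR R) := if k is k'.+1 then U k' `&` `]a, b[ else `]a, b[.
Let c k : R := if k is 0 then e / 2 / (b - a) else 1.
Let mu k phi := c k * \int[lam]_(x in O k) phi x.
Let s phi n := \sum_(k < n) mu k phi.

Definition penalty phi : R := limn (s phi).

Let O_open k : open (O k).
Proof. by case: k => [|k]; [|apply: openI => //]; exact: interval_open. Qed.

Let O_meas k : measurable (O k).
Proof. by apply: open_measurable; exact: O_open. Qed.

Let O_sub k : O k `<=` `[a, b].
Proof.
case: k => [|k]; first exact: subset_itv_oo_cc.
by apply: subset_trans (@subIsetr _ _ _) _; exact: subset_itv_oo_cc.
Qed.

Let c_ge0 k : 0 <= c k.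
Proof. by case: k => //=; rewrite divr_ge0 ?subr_ge0 ?ltW// divr_gt0. Qed.

Let O_small k : c k * fine (lam (O k)) <= e * 2^-1 ^+ k.+1.
Proof.
case: k => [|k] /=.
  rewrite lebesgue_measure_itv/= lte_fin ab /= expr1.
  by rewrite mulfVK// gt_eqF// subr_gt0.
have fin : (lam (U k `&` `]a, b[) <= (e * 2^-1 ^+ k.+2)%:E)%E.
  apply: le_trans (U_small k); apply: le_measure; rewrite ?inE.
  - exact: (O_meas k.+1).
  - exact: open_measurable.
  - exact: subIsetl.
by rewrite mul1r -lee_fin fineK// ge0_fin_numE// (le_lt_trans fin)// ltry.
Qed.

Let integ k phi : continuous phi -> lam.-integrable (O k) (EFin \o phi).
Proof.
move=> cphi; apply: integrableS (itg_integrable a b cphi) => //.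
Qed.

Let mu_le k phi M : continuous phi -> (forall x, `|phi x| <= M) ->
  `|mu k phi| <= M * e * 2^-1 ^+ k.+1.
Proof.
move=> cphi hM; rewrite /mu normrM (ger0_norm (c_ge0 k)).
have M0 : 0 <= M := le_trans (normr_ge0 _) (hM 0).
apply: le_trans (_ : c k * (M * fine (lam (O k))) <= _).
  by apply: ler_wpM2l => //; exact: Rintegral_bounded (O_meas k) (@O_sub k) cphi hM.
by rewrite mulrCA -mulrA ler_wpM2l.
Qed.

Let near_s phi M n : continuous phi -> (forall x, `|phi x| <= M) ->
  `|penalty phi - s phi n| <= M * e * 2^-1 ^+ n.
Proof.
move=> cphi hM; have M0 : 0 <= M := le_trans (normr_ge0 _) (hM 0).
apply: geometric_limit => [|k]; first by rewrite mulr_ge0// ltW.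
by rewrite /s big_ord_recr /= addrAC subrr add0r; exact: mu_le.
Qed.

Let mu_ge0 k phi : (forall x, 0 <= phi x) -> 0 <= mu k phi.
Proof. by move=> h; rewrite mulr_ge0// Rintegral_ge0. Qed.

Let penalty_ge_s phi n : test_function phi -> (forall x, 0 <= phi x) -> s phi n <= penalty phi.
Proof.
move=> tphi phi0; have [M M0 hM] := test_bounded 0 tphi.
have cphi : continuous phi := @smooth_continuous R phi 0 (test_smooth tphi).
apply/ler_addgt0Pr => d d0; have [m hm] := half_expr_small (M * e) d0.
have h : s phi n <= s phi (m + n)%N.
  elim: m {hm} => [//|m IH]; rewrite addSn; apply: le_trans IH _.
  by rewrite /s big_ord_recr /= lerDl mu_ge0.
have := near_s (m + n) cphi (fun x => hM 0%N x isT); rewrite ler_norml => /andP[h1 _].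
have : M * e * 2^-1 ^+ (m + n) <= M * e * 2^-1 ^+ m.
  by rewrite ler_wpM2l// ?mulr_ge0 ?(ltW e0)// ler_wiXn2l ?invr_ge0 ?invf_le1 ?ler1n ?leq_addr.
by move: h1; move: (2^-1 ^+ (m + n)) => u h1 h2; lra.
Qed.

Lemma penalty_le phi M : continuous phi -> (forall x, `|phi x| <= M) -> `|penalty phi| <= e * M.
Proof.
by move=> cphi hM; have := near_s 0 cphi hM; rewrite /s big_ord0 subr0 expr0 mulr1 (mulrC M).
Qed.

Lemma distribution_penalty : distribution penalty.
Proof.
split=> [d phi psi tphi tpsi|K cK]; last first.
  exists e, 0%N => phi M tphi _ hM; apply: penalty_le => [|x]; last exact: (hM 0%N).
  exact: (@smooth_continuous R phi 0 (test_smooth tphi)).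
have [M M0 hM] := test_bounded 0 tphi; have [M' M'0 hM'] := test_bounded 0 tpsi.
have cphi : continuous phi := @smooth_continuous R phi 0 (test_smooth tphi).
have cpsi : continuous psi := @smooth_continuous R psi 0 (test_smooth tpsi).
have cd : continuous (fun x => d * phi x).
  by move=> x; apply: cvgM; [exact: cst_continuous|exact: cphi].
have cs : continuous (fun x => d * phi x + psi x).
  by move=> x; apply: cvgD; [exact: cd|exact: cpsi].
have hMs x : `|d * phi x + psi x| <= `|d| * M + M'.
  apply: le_trans (ler_normD _ _) _; rewrite normrM.
  by apply: lerD; [rewrite ler_wpM2l//; exact: (hM 0%N)|exact: (hM' 0%N)].
have sE n : s (fun x => d * phi x + psi x) n = d * s phi n + s psi n.
  rewrite /s mulr_sumr -big_split /=; apply: eq_bigr => k _.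
  rewrite /mu RintegralD//; [|exact: integ|exact: integ].
  by rewrite RintegralZl//; [ring|exact: integ].
apply/eqP; rewrite -subr_eq0 -normr_le0; apply/ler_addgt0Pr => z z0; rewrite add0r.
have [n hn] := half_expr_small (2 * (`|d| * M + M') * e) z0.
have h1 := near_s n cs hMs.
have h2 := near_s n cphi (fun x => hM 0%N x isT).
have h3 := near_s n cpsi (fun x => hM' 0%N x isT).
apply: le_trans hn; rewrite sE in h1.
have -> : penalty (fun x => d * phi x + psi x) - (d * penalty phi + penalty psi) =
  (penalty (fun x => d * phi x + psi x) - (d * s phi n + s psi n)) -
  (d * (penalty phi - s phi n) + (penalty psi - s psi n)) by ring.
have h4 : `|d * (penalty phi - s phi n)| <= `|d| * (M * e * 2^-1 ^+ n).
  by rewrite normrM ler_wpM2l.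
apply: le_trans (ler_normB _ _) _.
have h5 := ler_normD (d * (penalty phi - s phi n)) (penalty psi - s psi n).
have -> : 2 * (`|d| * M + M') * e * 2^-1 ^+ n = (`|d| * M + M') * e * 2^-1 ^+ n +
  (`|d| * (M * e * 2^-1 ^+ n) + M' * e * 2^-1 ^+ n) by ring.
apply: lerD => //; apply: le_trans h5 _; exact: lerD.
Qed.

Let mu_supp k phi M p q : p <= q -> continuous phi -> supp_in p q phi ->
  (forall x, `|phi x| <= M) -> `|mu k phi| <= c k * (M * (q - p)).
Proof.
move=> pq cphi hs hM; rewrite /mu normrM (ger0_norm (c_ge0 k)) ler_wpM2l//.
apply: le_trans (le_normr_Rintegral (O_meas k) (integ k cphi)) _.
have cn := continuous_norm cphi.
apply: le_trans (_ : itg (fun x => `|phi x|) (Num.min a p) (Num.max b q) <= _).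
  apply: (@Rintegral_subset R (O k) `[Num.min a p, Num.max b q]) => //.
  - apply: subset_trans (@O_sub k) _ => x /=; rewrite !in_itv/= ge_min le_max.
    by move=> /andP[-> ->].
  - exact: itg_integrable.
have sn : supp_in p q (fun x => `|phi x|) by move=> x /hs ->; rewrite normr0.
rewrite -(itg_setT (A := Num.min a p) (B := Num.max b q))//; last first.
  by apply: supp_in_le sn; rewrite ?ge_min ?le_max lexx orbT.
rewrite (itg_setT cn sn) -itg_cst//; apply: itg_le => // x.
exact: cst_continuous.
Qed.

(** The tail of the series is small uniformly in r, and the finitely many remaining terms have
    bounded densities, so they are O(|r|). *)
Lemma no_mass_penalty al : no_mass penalty al.
Proof.
move=> th tth d d0; have [M M0 hM] := test_bounded 0 tth.
have [A A0 hA] := test_supp_in tth.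
have [n hn] : exists n, M * e * 2^-1 ^+ n <= d / 2 by apply: half_expr_small; rewrite divr_gt0.
pose B := \sum_(k < n) c k * (M * (2 * A)) + 1.
have B0 : 0 < B.
  by rewrite ltr_wpDl// sumr_ge0// => k _; rewrite !mulr_ge0 ?(ltW A0).
exists (d / 2 / B) => [|r /andP[r0 rd]]; first by rewrite !divr_gt0.
have r0' : r != 0 by rewrite -normr_gt0.
have cr : continuous (rescale th al r) :=
  @smooth_continuous R _ 0 (@smooth_rescale R th al r (test_smooth tth)).
have hr x : `|rescale th al r x| <= M by exact: (hM 0%N).
have sr : supp_in (al - A * `|r|) (al + A * `|r|) (rescale th al r).
  move=> x hx; apply: hA; apply: contra hx; rewrite -!ler_norml.
  rewrite normrM normfV ler_pdivrMr ?normr_gt0// ler_norml => /andP[h1 h2].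
  by apply/andP; split; lra.
have pq : al - A * `|r| <= al + A * `|r| by rewrite lerD2l ge0_cp// mulr_ge0// ltW.
have h1 := near_s n cr hr.
have h2 : `|s (rescale th al r) n| <= B * `|r|.
  apply: le_trans (ler_norm_sum _ _ _) _; rewrite mulrDl mulr_suml.
  apply: le_trans (_ : \sum_(k < n) c k * (M * (2 * A)) * `|r| <= _); last by rewrite lerDl mul1r.
  apply: ler_sum => k _; apply: le_trans (mu_supp k pq cr sr hr) _.
  rewrite (_ : al + A * `|r| - (al - A * `|r|) = 2 * A * `|r|); last by ring.
  by rewrite !mulrA lexx.
have h3 : B * `|r| <= d / 2 by rewrite mulrC -ler_pdivlMr// ltW.
rewrite -[penalty _](subrK (s (rescale th al r) n)).
by apply: le_trans (ler_normD _ _) _; lra.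
Qed.

(** Term 0 alone; it compensates the small negative error in the means at points outside the null
    set. *)
Lemma penalty_ge phi p q : a < p -> q < b -> test_function phi -> (forall y, 0 <= phi y) ->
  e / 2 / (b - a) * itg phi p q <= penalty phi.
Proof.
move=> ap qb tphi phi0.
have cphi : continuous phi := @smooth_continuous R phi 0 (test_smooth tphi).
apply: le_trans (penalty_ge_s 1 tphi phi0); rewrite /s big_ord1 /mu /=.
apply: ler_wpM2l; first exact: (c_ge0 0).
apply: (@Rintegral_subset R `[p, q] (O 0)) => //; last exact: (integ 0 cphi).
by move=> y /=; rewrite !in_itv/= => /andP[h1 h2]; rewrite (lt_le_trans ap)//= (le_lt_trans h2).
Qed.

(** A point of Z lies in all covers, and the first K of them contain a common interval around it,
    where the density is at least K. *)
Lemma penalty_near x (K : nat) : a < x < b -> Z x -> exists2 d, 0 < d &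
  forall phi, test_function phi -> (forall y, 0 <= phi y) ->
    K%:R * itg phi (x - d) (x + d) <= penalty phi.
Proof.
move=> xab Zx.
have Oball k : O k x -> exists2 d, 0 < d & `[x - d, x + d] `<=` O k.
  move=> Ox; have /nbhs_ballP[d /= d0 hd] := open_nbhs_nbhs (conj (@O_open k) Ox).
  exists (d / 2); first by rewrite divr_gt0.
  move=> y /=; rewrite in_itv/= => /andP[h1 h2]; apply: hd; rewrite /ball/= ltr_norml.
  by apply/andP; split; lra.
have [d d0 hd] : exists2 d, 0 < d & forall k, (k <= K)%N -> `[x - d, x + d] `<=` O k.
  elim: (K) => [|m [d d0 hd]].
    have [|d d0 hd] := Oball 0%N; first by rewrite /= in_itv.
    by exists d => // k; rewrite leqn0 => /eqP ->.
  have [|d' d'0 hd'] := Oball m.+1; first by split; [exact: U_cover|rewrite /= in_itv].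
  exists (Num.min d d') => [|k km]; first by rewrite lt_min d0.
  have [md md'] : Num.min d d' <= d /\ Num.min d d' <= d' by rewrite !ge_min !lexx orbT.
  move: km; rewrite leq_eqVlt => /orP[/eqP ->|/hd h] y /= hy.
    by apply: hd'; move: hy; rewrite /= !in_itv/= => /andP[h1 h2]; apply/andP; split; lra.
  by apply: h; move: hy; rewrite /= !in_itv/= => /andP[h1 h2]; apply/andP; split; lra.
exists d => // phi tphi phi0.
have cphi : continuous phi := @smooth_continuous R phi 0 (test_smooth tphi).
apply: le_trans (penalty_ge_s K.+1 tphi phi0); rewrite /s big_ord_recl.
rewrite -[leLHS]add0r; apply: lerD; first exact: mu_ge0.
rewrite mulr_natl -[X in _ *+ X]card_ord -sumr_const; apply: ler_sum => k _.
rewrite /mu /= mul1r; apply: (@Rintegral_subset R `[x - d, x + d] (O k.+1)) => //.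
- exact: (hd k.+1 (ltn_ord k)).
- exact: (integ k.+1 cphi).
Qed.

End Construction.
End Penalty.

(** * The monotonicity theorem *)

Section Monotonicity.
Context {R : realType}.
Implicit Types (w W T S : (R -> R) -> R) (chi : R -> R).

Lemma itg_hker_ge (d : R) : 0 < d -> exists2 t0, 0 < t0 &
  forall x t, 0 < t < t0 -> 2^-1 <= itg (hker 0 x t) (x - d) (x + d).
Proof.
move=> d0; have cg0 : continuous (@gk R) := @smooth_continuous R gk 0 (@smooth_gk R).
have h2 : 0 < 2^-1 :> R by rewrite invr_gt0.
have [K K0 hK] := @itg_mass R gk _ cg0 (@gk_ge0 R)
  (let: conj (And4 _ _ h _) _ := @gk_testT1 R in h) h2.
exists (d / K) => [|x t /andP[t0 tdK]]; first by rewrite divr_gt0.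
have tv : 0 < t^-1 by rewrite invr_gt0.
have ck : continuous (fun y => gk ((y - x) * t^-1)) := @continuous_affine R gk x t^-1 cg0.
rewrite (itg_eq (g := fun y => t^-1 * gk ((y - x) * t^-1))); last first.
  by move=> y _; rewrite /hker expr1.
have dd : x - d <= x + d by lra.
rewrite (itgZ _ _ _ ck) (itg_affine _ dd t0 cg0) mulrA mulVf ?gt_eqF// mul1r.
have -> : x - d - x = - d by ring.
have -> : x + d - x = d by ring.
have Kd : K <= d * t^-1 by rewrite ler_pdivlMr// mulrC -ler_pdivlMr// ltW.
by have := hK (- d * t^-1) (d * t^-1); rewrite mulNr lerN2 => /(_ Kd Kd); lra.
Qed.

Lemma supp_in_integral_derive theta : test_function theta ->
  \int[@lebesgue_measure R]_y (theta^[1]) y = 0.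
Proof.
move=> tth; have [A A0 hA] := test_supp_in tth.
have sth := test_smooth tth.
have c1 : continuous (theta^[1]) := @smooth_continuous R theta 1 sth.
have hA' : supp_in (- (A + 1)) (A + 1) theta by apply: supp_in_le hA; lra.
rewrite (itg_setT c1 (supp_in_derive1n 1 hA')).
have AA : - (A + 1) <= A + 1 by lra.
rewrite (itg_FTC AA c1 (fun x _ => @smooth_is_derive R theta 0 x sth)).
by rewrite /= !hA ?subrr//; apply/negP => /andP[h1 h2]; lra.
Qed.

(** Up to sign, w against a test function rescaled by r is W dilated by r against its derivative,
    which tends to gamma times the integral of a derivative, that is to 0. *)
Lemma no_mass_derivative w W al : ddistr W w -> Lojasiewicz W -> no_mass w al.
Proof.
move=> dW [distW /(_ al) [gamma pv]] theta tth e e0.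
have sth := test_smooth tth.
have := pv (theta^[1]) (test_derive1n 1 tth).
rewrite (supp_in_integral_derive tth) mulr0 => /cvgrPdist_le /(_ e e0).
rewrite near_withinE => /nbhs_ballP[d /= d0 hd].
exists d => // r /andP[r0 rd]; have rn0 : r != 0 by rewrite -normr_gt0.
have := hd r; rewrite /ball/= sub0r normrN => /(_ rd rn0); rewrite sub0r normrN.
congr (_ <= _); rewrite (dW _ (test_rescale al rn0 tth)).
rewrite /rescale -(derive1n1 (fun y => theta ((y - al) / r))) (@derive1n_affine R theta al r^-1 1 sth) expr1.
rewrite (dist_scale r^-1 distW); last first.
  by apply: test_affine; [rewrite invr_eq0|exact: test_derive1n].
by rewrite /dilate normrN !normrM !normfV normr_id.
Qed.

Lemma affine1E (f : R -> R) (u : R) : (fun y => f ((y - u) * 1)) = (fun y => f (y - u)).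
Proof. by apply/funext => y; rewrite mulr1. Qed.

Lemma supp_in_step_shift (u : R) : supp_in u (u + 1) (fun y : R => step^[1] (y - u)).
Proof.
move=> y hy; have [yu|uy] := leP y u.
  have [h|h] := eqVneq y u; first by move: hy; rewrite h lexx lerDl ler01.
  apply: derive1n_near0; have : y - u < 0 by rewrite subr_lt0 lt_neqAle h.
  by move=> /lt_nbhsl; apply: filterS => z /ltW; exact: step_eq0.
have h1 : 1 < y - u by move: hy; rewrite (ltW uy)/= -ltNge; lra.
have : \forall z \near y - u, step z = (fun=> 1) z.
  by move: (lt_nbhsr h1); apply: filterS => z /ltW; exact: step_eq1.
move/(derive1n_near_eq 1 (@smooth_step R) (@smooth_cst R 1)) => ->.
exact: is_derive_derive1 (is_derive_cst _ _ _).
Qed.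

Lemma itg_step_shift (u : R) : \int[@lebesgue_measure R]_y (step^[1] (y - u)) = 1.
Proof.
have c : continuous (fun y : R => step^[1] (y - u)).
  rewrite -affine1E.
  exact: (@continuous_affine R (step^[1]) u 1 (@smooth_continuous R step 1 (@smooth_step R))).
have hs : supp_in u (u + 1) (fun y : R => step^[1] (y - u)).
  exact: supp_in_step_shift.
rewrite (itg_setT c hs).
have uu : u <= u + 1 by rewrite lerDl.
have hd (y : R) : is_derive y 1 (fun y => step (y - u)) (step^[1] (y - u)).
  have := is_derive_affine u 1 0 y (@smooth_step R).
  rewrite expr1 mul1r mulr1; apply: is_derive_ext => z.
  by rewrite expr0 mul1r mulr1.
rewrite (itg_FTC uu c (fun y _ => hd y)).
by rewrite subrr (addrC u) addrK step_eq1// step_eq0// subr0.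
Qed.

Lemma test_step_shift (u : R) : test_function (fun y : R => step^[1] (y - u)).
Proof.
have sb : smooth (fun y : R => step (y - u)).
  by have := @smooth_affine R step u 1 (@smooth_step R); rewrite affine1E.
have E : (fun y : R => step^[1] (y - u)) = (fun y : R => step (y - u))^[1].
  have := @derive1n_affine R step u 1 1 (@smooth_step R).
  by rewrite expr1n affine1E => ->; apply/funext => y; rewrite mul1r mulr1.
rewrite E; apply: (@supp_in_test R u (u + 1)); first exact: smooth_derive1n.
rewrite -E; exact: supp_in_step_shift.
Qed.

Lemma no_mass_add T S al : distribution T -> distribution S ->
  no_mass T al -> no_mass S al -> no_mass (fun phi => T phi + S phi) al.
Proof.
move=> dT dS nT nS th tth e e0; have e20 : 0 < e / 2 by rewrite divr_gt0.
have [d d0 hd] := nT th tth _ e20; have [d' d'0 hd'] := nS th tth _ e20.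
exists (Num.min d d') => [|r /andP[r0]]; first by rewrite lt_min d0.
rewrite lt_min => /andP[r1 r2]; apply: le_trans (ler_normD _ _) _.
have := hd r; have := hd' r; rewrite r0 r1 r2 => /(_ isT) h1 /(_ isT) h2; lra.
Qed.

(* Adding a small positive penalty, with infinite density on the exceptional null set,
   makes every Gaussian mean eventually nonnegative outside the countable set. *)
Lemma monotone w W chi (a b gamma r0 : R) (E Z : set R) : a < b ->
  distribution w -> Lojasiewicz W -> ddistr W w ->
  point_value W a 0 -> point_value W b gamma ->
  test_function chi -> (forall y, 0 <= chi y) -> 0 < r0 ->
  (forall y, a - r0 <= y <= b + r0 -> chi y = 1) ->
  countable E -> (@lebesgue_measure R).-negligible Z ->
  (forall x, a < x < b -> ~ Z x -> forall e, 0 < e -> exists2 t0, 0 < t0 &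
     forall t, 0 < t < t0 -> - e <= hconv w chi 0 x t) ->
  (forall x, a < x < b -> ~ E x -> exists M t0, 0 < t0 /\
     forall t, 0 < t < t0 -> - M <= hconv w chi 0 x t) ->
  0 <= gamma.
Proof.
move=> ab dw lW dW pva pvb tchi chi0 r00 chi1 cE nZ hZ hE.
have distW : distribution W by case: lW.
apply/ler_addgt0Pr => e e0.
have Uex k : exists U : set R, [/\ open U, Z `<=` U &
    (lebesgue_measure U <= (e * 2^-1 ^+ k.+2)%:E)%E].
  by apply: negligible_open_cover => //; rewrite mulr_gt0// exprn_gt0// invr_gt0.
have [U /all_and3[Uo Uc Us]] := choice Uex.
pose nu := penalty a b e U.
have dnu : distribution nu := distribution_penalty ab e0 Uo Us.
pose T phi := w phi + nu phi.
have dT : distribution T := distribution_add dw dnu.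
have schi := test_smooth tchi.
have tk x t : test_function (fun y => chi y * hker 0 x t y).
  by apply: test_mulr tchi _; exact: smooth_hker.
have k0 x t y : 0 < t -> 0 <= chi y * hker 0 x t y.
  by move=> t0; rewrite mulr_ge0//; exact: hker0_ge0.
have chik x t p q : a <= p -> q <= b -> itg (fun y => chi y * hker 0 x t y) p q = itg (hker 0 x t) p q.
  move=> ap qb; apply: itg_eq => y /andP[h1 h2]; rewrite chi1 ?mul1r//.
  by apply/andP; split; lra.
have TE x t : hconv T chi 0 x t = hconv w chi 0 x t + nu (fun y => chi y * hker 0 x t y) by [].
have posT : posd T a b.
  apply: (positivity dT tchi chi0 r00 chi1 cE) => [al _|x /andP[ax xb] nEx].
    exact: no_mass_add dw dnu (no_mass_derivative al dW lW) (no_mass_penalty ab e0 Uo Us al).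
  have [Zx|nZx] := pselect (Z x).
    have [M [t0 [t00 hM]]] := hE x (introT andP (conj ax xb)) nEx.
    (* At least half of the kernel mass falls where the density is K, and K / 2 > M. *)
    pose K := (Num.truncn (2 * M)).+1.
    have [d d0 hd] := penalty_near ab e0 Uo Uc Us K (introT andP (conj ax xb)) Zx.
    pose d' := Num.min d (Num.min (x - a) (b - x)).
    have d'0 : 0 < d' by rewrite !lt_min d0 !subr_gt0 ax xb.
    have [d1 d2 d3] : [/\ d' <= d, d' <= x - a & d' <= b - x] by rewrite /d' !ge_min !lexx ?orbT.
    have [t1 t10 ht1] := itg_hker_ge d'0.
    exists (Num.min t0 t1) => [|t /andP[tt0]]; first by rewrite lt_min t00.
    rewrite lt_min => /andP[tt1 tt2]; rewrite TE.
    have h1 : - M <= hconv w chi 0 x t by apply: hM; rewrite tt0.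
    have h2 := hd _ (tk x t) (fun y => k0 x t y tt0).
    have h3 : 2^-1 <= itg (hker 0 x t) (x - d') (x + d') by apply: ht1; rewrite tt0.
    have h4 : itg (hker 0 x t) (x - d') (x + d') <= itg (fun y => chi y * hker 0 x t y) (x - d) (x + d).
      rewrite -(chik x t (x - d') (x + d')); [|lra|lra].
      apply: itg_subset; [|by move=> y; exact: k0|lra|lra|lra].
      exact: (@smooth_continuous R _ 0 (test_smooth (tk x t))).
    have h5 : 2 * M < K%:R by exact: truncnS_gt.
    have K0 : 0 <= K%:R :> R by [].
    have h6 : K%:R * 2^-1 <= K%:R * itg (fun y => chi y * hker 0 x t y) (x - d) (x + d).
      by rewrite ler_wpM2l//; lra.
    rewrite -/nu in h2; lra.
  pose d := Num.min (x - a) (b - x) / 2.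
  have m0 : 0 < Num.min (x - a) (b - x) by rewrite lt_min !subr_gt0 ax xb.
  have d0 : 0 < d by rewrite divr_gt0.
  have [m1 m2] : Num.min (x - a) (b - x) <= x - a /\ Num.min (x - a) (b - x) <= b - x.
    by rewrite !ge_min !lexx orbT.
  have [dxa dxb] : a < x - d /\ x + d < b by rewrite /d; split; lra.
  have [t1 t10 ht1] := itg_hker_ge d0.
  have c0 : 0 < e / 2 / (b - a) by rewrite !divr_gt0// subr_gt0.
  (* The error allowed in the means is the density of term 0 times half of the kernel mass. *)
  have c20 : 0 < e / 2 / (b - a) * 2^-1 by rewrite divr_gt0.
  have [t0 t00 ht0] := hZ x (introT andP (conj ax xb)) nZx _ c20.
  exists (Num.min t0 t1) => [|t /andP[tt0]]; first by rewrite lt_min t00.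
  rewrite lt_min => /andP[tt1 tt2]; rewrite TE.
  have h1 := ht0 t (introT andP (conj tt0 tt1)).
  have h2 := ht1 x t (introT andP (conj tt0 tt2)).
  have h3 := penalty_ge ab e0 Uo Us dxa dxb (tk x t) (fun y => k0 x t y tt0).
  rewrite (chik _ _ _ _ (ltW dxa) (ltW dxb)) -/nu in h3.
  have h4 : e / 2 / (b - a) * 2^-1 <= e / 2 / (b - a) * itg (hker 0 x t) (x - d) (x + d).
    by rewrite ler_wpM2l// ltW.
  lra.
(* Test the positive distribution against plateaus exhausting (a, b). *)
apply/ler_addgt0Pr => e' e'0; have e20 : 0 < e' / 2 by rewrite divr_gt0.
have := pva _ (test_step_shift 1); rewrite (itg_step_shift 1) mulr1 => /cvgrPdist_le /(_ _ e20).
rewrite near_withinE => /nbhs_ballP[s1 /= s10 hs1].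
have := pvb _ (test_step_shift (-2)); rewrite (itg_step_shift (-2)) mulr1 => /cvgrPdist_le /(_ _ e20).
rewrite near_withinE => /nbhs_ballP[s2 /= s20 hs2].
pose m := Num.min (Num.min s1 s2) ((b - a) / 4).
have m0 : 0 < m by rewrite !lt_min s10 s20 divr_gt0// subr_gt0.
have [m1 m2 m3] : [/\ m <= s1, m <= s2 & m <= (b - a) / 4] by rewrite /m !ge_min !lexx ?orbT.
pose s := m / 2; have s0 : 0 < s by rewrite divr_gt0.
have [s_1 s_2 s3] : [/\ s < s1, s < s2 & 4 * s < b - a] by rewrite /s; split; lra.
have sv0 : 0 < s^-1 by rewrite invr_gt0.
(* The plateau rises on [a + s, a + 2s] and falls on [b - 2s, b - s], strictly inside ]a, b[; hence
   the shifts 1 and -2 in the test functions at a and b. *)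
pose psi y := step ((y - (a + s)) * s^-1) - step ((y - (b - 2 * s)) * s^-1) : R.
have spsi1 : smooth (fun y => step ((y - (a + s)) * s^-1)) by exact/smooth_affine/smooth_step.
have spsi2 : smooth (fun y => step ((y - (b - 2 * s)) * s^-1)) by exact/smooth_affine/smooth_step.
have spsi : smooth psi := smooth_sub spsi1 spsi2.
have e0p x y : y <= x -> step ((y - x) * s^-1) = 0.
  by move=> yx; apply: step_eq0; rewrite pmulr_lle0// subr_le0.
have e1p x y : x + s <= y -> step ((y - x) * s^-1) = 1.
  by move=> yx; apply: step_eq1; rewrite ler_pdivlMr// mul1r; lra.
have supp : supp_in (a + s) (b - s) psi.
  move=> y hy; rewrite /psi; have [ya|ya] := leP y (a + s).
    by rewrite !e0p ?subrr//; lra.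
  have yb : b - s < y by move: hy; rewrite (ltW ya)/= -ltNge.
  by rewrite !e1p ?subrr//; lra.
have psi01 y : 0 <= psi y <= 1.
  have := step_ge0 ((y - (a + s)) * s^-1); have := step_le1 ((y - (a + s)) * s^-1).
  have := step_ge0 ((y - (b - 2 * s)) * s^-1); have := step_le1 ((y - (b - 2 * s)) * s^-1).
  rewrite /psi; have [yb|yb] := leP y (b - 2 * s); first by rewrite (e0p _ _ yb); lra.
  by rewrite (e1p (a + s) y); lra.
have tpsi : test_function psi := supp_in_test spsi supp.
have := posT psi (a + s) (b - s) spsi (fun y => let: conj h _ := elimT andP (psi01 y) in h).
have as0 : a < a + s by rewrite ltrDl.
have bs0 : b - s < b by rewrite gtrBl.
move=> /(_ as0 bs0 supp); rewrite /T.
have hnu : nu psi <= e.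
  have hb y : `|psi y| <= 1 by have := psi01 y; rewrite ler_norml; lra.
  have := penalty_le ab e0 Uo Us (@smooth_continuous R psi 0 spsi) hb.
  by rewrite mulr1 ler_norml => /andP[].
have -> : w psi = dilate W b s (fun y => step^[1] (y - -2)) - dilate W a s (fun y => step^[1] (y - 1)).
  rewrite (dW _ tpsi) -(derive1n1 psi) (derive1n_sub 1 spsi1 spsi2).
  have sn0 : s^-1 != 0 by rewrite gt_eqF.
  rewrite (@derive1n_affine R step (a + s) s^-1 1 (@smooth_step R)).
  rewrite (@derive1n_affine R step (b - 2 * s) s^-1 1 (@smooth_step R)) expr1.
  have -> : (fun y => s^-1 * step^[1] ((y - (a + s)) * s^-1) - s^-1 * step^[1] ((y - (b - 2 * s)) * s^-1)) =
      (fun y => s^-1 * step^[1] ((y - a) * s^-1 - 1) - s^-1 * step^[1] ((y - b) * s^-1 - -2)).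
    have E1 y : (y - (a + s)) * s^-1 = (y - a) * s^-1 - 1 by field; rewrite gt_eqF.
    have E2 y : (y - (b - 2 * s)) * s^-1 = (y - b) * s^-1 - -2 by field; rewrite gt_eqF.
    by apply/funext => y; rewrite E1 E2.
  have t1 := @test_affine R _ a s^-1 sn0 (test_step_shift 1).
  have t2 := @test_affine R _ b s^-1 sn0 (test_step_shift (-2)).
  rewrite (dist_sub distW (test_scale s^-1 t1) (test_scale s^-1 t2)).
  rewrite (dist_scale s^-1 distW t1) (dist_scale s^-1 distW t2) /dilate (gtr0_norm s0).
  exact: opprB.
have sn : s != 0 by rewrite gt_eqF.
have := hs1 s; rewrite /ball/= sub0r normrN (gtr0_norm s0) => /(_ s_1 sn).
have := hs2 s; rewrite /ball/= sub0r normrN (gtr0_norm s0) => /(_ s_2 sn).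
move: (dilate W b s _) (dilate W a s _) => u v.
by rewrite !ler_norml => /andP[h1 h2] /andP[h3 h4] h5; lra.
Qed.

End Monotonicity.

(** * Approximate Taylor polynomials *)

Section TaylorPolynomial.
Context {R : realType}.
Implicit Types (F f p phi chi : R -> R) (c : nat -> R).

(** It has n terms, of degree below n, where [peano_poly n] has n + 1. *)
Definition tpoly n c (h : R) : R := \sum_(j < n) c j * (h ^+ j / j`!%:R).

Lemma tpolyS n c h : tpoly n.+1 c h = tpoly n c h + c n * (h ^+ n / n`!%:R).
Proof. by rewrite /tpoly big_ord_recr. Qed.

Lemma tpoly0 n c : tpoly n.+1 c 0 = c 0%N.
Proof.
by elim: n => [|n IH]; rewrite tpolyS ?IH; rewrite ?/tpoly ?big_ord0 ?expr0n /= ?mul0r ?mulr0 ?addr0// fact0 divr1 mulr1 add0r.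
Qed.

Lemma tpoly_eq0 n c h : (forall j, (j < n)%N -> c j = 0) -> tpoly n c h = 0.
Proof. by move=> hc; rewrite /tpoly big1// => j _; rewrite hc// mul0r. Qed.

Lemma tpoly_sub n c d h : tpoly n (fun j => c j - d j) h = tpoly n c h - tpoly n d h.
Proof. by rewrite /tpoly -sumrB; apply: eq_bigr => j _; rewrite mulrBl. Qed.

Lemma is_derive_pow j (x : R) : is_derive x 1 (fun y => y ^+ j.+1) (j.+1%:R * x ^+ j).
Proof.
elim: j => [|j IH].
  rewrite expr0 mulr1; apply: is_derive_ext (is_derive_id x 1) => y; by rewrite expr1.
have h := is_derive_mul (is_derive_id x 1) IH.
have hE : (fun y : R => y * y ^+ j.+1) =1 (fun y => y ^+ j.+2) by move=> y; rewrite -exprS.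
apply: (is_derive_eq1 (is_derive_ext hE h)).
by rewrite /= exprS -[in RHS]natr1; ring.
Qed.

Lemma is_derive_tpoly n c (h : R) :
  is_derive h 1 (tpoly n c) (tpoly n.-1 (fun j => c j.+1) h).
Proof.
elim: n => [|n IH] /=.
  rewrite /tpoly big_ord0; apply: is_derive_ext (is_derive_cst (0 : R) h 1) => y.
  by rewrite big_ord0.
case: n IH => [|n] IH.
  rewrite /tpoly big_ord0; apply: is_derive_ext (is_derive_cst (c 0%N) h 1) => y.
  by rewrite big_ord1 expr0 fact0 divr1 mulr1.
have h1 := is_derive_add IH (is_derive_scale (c n.+1 / n.+1`!%:R) (is_derive_pow n h)).
have hE : (fun y : R => tpoly n.+1 c y + c n.+1 / n.+1`!%:R * y ^+ n.+1) =1 tpoly n.+2 c.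
  by move=> y; rewrite [RHS]tpolyS; congr (_ + _); rewrite mulrA mulrAC.
apply: (is_derive_eq1 (is_derive_ext hE h1)).
rewrite /= tpolyS; congr (_ + _); rewrite factS natrM.
have f0 : n`!%:R != 0 :> R by rewrite pnatr_eq0 -lt0n fact_gt0.
by field; rewrite f0 -[1]/(1%:R) -natrD pnatr_eq0.
Qed.

Lemma tpoly_shift_derive n c x m (y : R) :
  is_derive y 1 (fun y => tpoly (n - m) (fun j => c (j + m)%N) (y - x))
                (tpoly (n - m.+1) (fun j => c (j + m.+1)%N) (y - x)).
Proof.
have h := @is_derive_chain R _ (fun y => (y - x) * 1) y _ _
  (is_derive_tpoly (n - m) (fun j => c (j + m)%N) ((y - x) * 1)) (is_derive_affine1 x 1 y).
have hE : (fun y => tpoly (n - m) (fun j => c (j + m)%N) ((y - x) * 1)) =1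
    (fun y => tpoly (n - m) (fun j => c (j + m)%N) (y - x)) by move=> z; rewrite mulr1.
apply: (is_derive_eq1 (is_derive_ext hE h)).
rewrite !mulr1 subnS; congr (tpoly _ _ _); apply/funext => j.
by rewrite addSnnS.
Qed.

Lemma derive1n_tpoly n c x m : (fun y => tpoly n c (y - x))^[m] =
  (fun y => tpoly (n - m) (fun j => c (j + m)%N) (y - x)).
Proof.
have E : (fun y => tpoly n c (y - x)) = (fun y => tpoly (n - 0) (fun j => c (j + 0)%N) (y - x)).
  by rewrite subn0; apply/funext => y; congr (tpoly _ _ _); apply/funext => j; rewrite addn0.
by rewrite E; exact: (derive1n_family (G := fun m y => tpoly (n - m) (fun j => c (j + m)%N) (y - x))
  (tpoly_shift_derive n c x)).
Qed.

Lemma smooth_tpoly n c x : smooth (fun y => tpoly n c (y - x)).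
Proof.
have E : (fun y => tpoly n c (y - x)) = (fun y => tpoly (n - 0) (fun j => c (j + 0)%N) (y - x)).
  by rewrite subn0; apply/funext => y; congr (tpoly _ _ _); apply/funext => j; rewrite addn0.
by rewrite E; exact: (smooth_family (G := fun m y => tpoly (n - m) (fun j => c (j + m)%N) (y - x))
  (tpoly_shift_derive n c x)).
Qed.

Lemma derive1n_tpoly_top n c x : (fun y => tpoly n.+1 c (y - x))^[n] = (fun=> c n).
Proof.
rewrite derive1n_tpoly; apply/funext => y; rewrite subSnn /tpoly big_ord1.
by rewrite add0n expr0 fact0 divr1 mulr1.
Qed.

Lemma derive1n_tpoly_over n c x : (fun y => tpoly n c (y - x))^[n] = (fun=> 0).
Proof. by rewrite derive1n_tpoly; apply/funext => y; rewrite subnn /tpoly big_ord0. Qed.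

(** The derivatives of both sides in h agree by induction, and so do the values at h = 0. *)
Lemma tpoly_taylor n c (u h : R) :
  tpoly n c (u + h) = tpoly n (fun j => tpoly (n - j) (fun i => c (i + j)%N) u) h.
Proof.
elim: n c h => [|n IH] c h; first by rewrite /tpoly !big_ord0.
set d := fun j => tpoly (n.+1 - j) (fun i => c (i + j)%N) u.
have E : d 0%N = tpoly n.+1 c u.
  by rewrite /d subn0; congr (tpoly _ _ _); apply/funext => i; rewrite addn0.
suff : tpoly n.+1 c (u + h) - tpoly n.+1 d h = tpoly n.+1 c (u + 0) - tpoly n.+1 d 0.
  by rewrite tpoly0 E addr0 subrr => /eqP; rewrite subr_eq0 => /eqP.
apply: (@is_derive_0_is_cst R (fun h => tpoly n.+1 c (u + h) - tpoly n.+1 d h)) => y.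
have h1 := @is_derive_chain R _ (fun y => (y - - u) * 1) y _ _
  (is_derive_tpoly n.+1 c ((y - - u) * 1)) (is_derive_affine1 (- u) 1 y).
have h2 := is_derive_add h1 (is_derive_scale (-1) (is_derive_tpoly n.+1 d y)).
have hE : (fun y => tpoly n.+1 c ((y - - u) * 1) + -1 * tpoly n.+1 d y) =1
    (fun h => tpoly n.+1 c (u + h) - tpoly n.+1 d h).
  by move=> z; rewrite mulr1 opprK (addrC z) mulN1r.
apply: (is_derive_eq1 (is_derive_ext hE h2)).
rewrite !mulr1 opprK (addrC y) /= IH mulN1r; apply/eqP; rewrite subr_eq0; apply/eqP.
congr (tpoly _ _ _); apply/funext => j; rewrite /d subSS; congr (tpoly _ _ _).
by apply/funext => i; rewrite addnS.
Qed.

End TaylorPolynomial.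

(** * Distributional derivatives of a continuous function *)

Section NthDerivative.
Context {R : realType}.
Implicit Types (F f p phi chi : R -> R) (T U : (R -> R) -> R) (c : nat -> R).

(** A Peano expansion with a smooth function in place of the polynomial. Paired with the condition
    that p^[k] is constant, it treats interior points, end points and the extended parts of F
    alike. *)
Definition approx k F (x : R) p : Prop := forall e : R, 0 < e ->
  exists2 d, 0 < d & forall h, `|h| < d -> `|F (x + h) - p (x + h)| <= e * `|h| ^+ k.

Lemma approx_continuous k F x p : smooth p -> approx k F x p -> {for x, continuous F}.
Proof.
move=> sp hap; have Fx : F x = p x.
  apply/eqP; rewrite -subr_eq0 -normr_le0; apply/ler_addgt0Pr => e e0; rewrite add0r.
  have [d d0 /(_ 0)] := hap e e0; rewrite normr0 addr0 => /(_ d0) h.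
  apply: le_trans h _; rewrite ler_piMr// ?(ltW e0)// expr0n.
  by case: (k == 0)%N.
apply/cvgrPdist_le => e e0; have e20 : 0 < e / 2 by rewrite divr_gt0.
have /cvgrPdist_le /(_ _ e20) := @smooth_continuous R p 0 sp x.
move=> /nbhs_ballP[d1 /= d10 hd1]; have [d2 d20 hd2] := hap _ e20.
apply/nbhs_ballP; exists (Num.min 1 (Num.min d1 d2)) => [|y]; rewrite /ball/=.
  by rewrite !lt_min ltr01 d10.
rewrite !lt_min => /and3P[h1 h2 h3].
have a2 := hd1 y h2.
have := hd2 (y - x); rewrite (addrC x) subrK (distrC y x) => /(_ h3) a1.
have p1 : `|x - y| ^+ k <= 1 by rewrite exprn_ile1// ltW.
have a3 : `|F y - p y| <= e / 2.
  by apply: le_trans a1 _; rewrite ler_piMr// ltW.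
rewrite Fx (_ : p x - F y = (p x - p y) - (F y - p y)); last by ring.
by apply: le_trans (ler_normB _ _) _; lra.
Qed.

(** The k-th distributional derivative of F. *)
Definition dnth F k phi : R := (-1) ^+ k * \int[@lebesgue_measure R]_y (F y * phi^[k] y).

Lemma continuous_mul_smooth F phi k : continuous F -> smooth phi -> continuous (fun y => F y * phi^[k] y).
Proof. by move=> cF sphi y; apply: cvgM; [exact: cF|exact: (@smooth_continuous R phi k sphi)]. Qed.

Lemma dnthE F k phi (P Q : R) : continuous F -> smooth phi -> supp_in P Q phi ->
  dnth F k phi = (-1) ^+ k * itg (fun y => F y * phi^[k] y) P Q.
Proof.
move=> cF sphi hs; rewrite /dnth (itg_setT (A := P) (B := Q))//.
  exact: continuous_mul_smooth.
by apply: supp_in_mull; exact: supp_in_derive1n.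
Qed.

Lemma supp_in_derive1n_bounds P Q P' Q' phi : P' < P -> Q < Q' -> supp_in P Q phi ->
  (forall j, phi^[j] P' = 0) /\ (forall j, phi^[j] Q' = 0).
Proof.
move=> h1 h2 hs; split=> j; apply: (supp_in_derive1n j hs); apply/negP => /andP[h3 h4]; lra.
Qed.

(* Against an approximant whose k-th derivative is constant, only the remainder survives. *)
Lemma dnth_split F p C k phi (P Q : R) : P <= Q -> continuous F -> smooth p ->
  p^[k] = (fun=> C) -> smooth phi -> supp_in P Q phi ->
  (forall j, phi^[j] P = 0) -> (forall j, phi^[j] Q = 0) ->
  dnth F k phi = C * itg phi P Q + (-1) ^+ k * itg (fun y => (F y - p y) * phi^[k] y) P Q.
Proof.
move=> PQ cF sp pC sphi hs hP hQ; rewrite (dnthE k cF sphi hs).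
have cp : continuous p := @smooth_continuous R p 0 sp.
have cphi : continuous phi := @smooth_continuous R phi 0 sphi.
have c1 := continuous_mul_smooth (k := k) cp sphi.
have c2 : continuous (fun y => F y - p y).
  by move=> y; apply: cvgB; [exact: cF|exact: cp].
have c3 := continuous_mul_smooth (k := k) c2 sphi.
rewrite (itg_eq (g := fun y => p y * phi^[k] y + (F y - p y) * phi^[k] y)); last first.
  by move=> y _; ring.
rewrite (itgD _ _ c1 c3) mulrDr (itg_parts_n k PQ sp sphi hP hQ) pC (itgZ _ _ _ cphi).
by rewrite mulrA -exprMn mulrNN mulr1 expr1n mul1r.
Qed.

Lemma distribution_dnth F k : continuous F -> distribution (dnth F k).
Proof.
move=> cF; split=> [c phi psi tphi tpsi|K cK].
  have sphi := test_smooth tphi; have spsi := test_smooth tpsi.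
  have [A A0 hA] := test_supp_in tphi; have [B B0 hB] := test_supp_in tpsi.
  have hA' : supp_in (- (A + B)) (A + B) phi by apply: supp_in_le hA; lra.
  have hB' : supp_in (- (A + B)) (A + B) psi by apply: supp_in_le hB; lra.
  have scphi : smooth (fun x => c * phi x) := @smooth_scale R c phi sphi.
  have hS : supp_in (- (A + B)) (A + B) (fun x => c * phi x + psi x).
    by move=> x hx; rewrite hA'// hB'// mulr0 addr0.
  rewrite (dnthE k cF sphi hA') (dnthE k cF spsi hB').
  rewrite (dnthE k cF (smooth_add scphi spsi) hS).
  rewrite (derive1n_add k scphi spsi) (@derive1n_scale R c phi k sphi).
  have c1 := continuous_mul_smooth (k := k) cF sphi.
  have c2 := continuous_mul_smooth (k := k) cF spsi.
  have c3 : continuous (fun y => c * (F y * phi^[k] y)).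
    by move=> y; apply: cvgM; [exact: cst_continuous|exact: c1].
  rewrite (itg_eq (g := fun y => c * (F y * phi^[k] y) + F y * psi^[k] y)); last first.
    by move=> y _; ring.
  by rewrite (itgD _ _ c3 c2) (itgZ _ _ _ c1); ring.
have [M [Mr hM]] := compact_bounded cK; pose A := `|M| + 1.
have A0 : 0 < A by rewrite ltr_wpDl.
have cb : continuous (fun y => F y * bump (- A) A 1 y).
  move=> y; apply: cvgM; [exact: cF|].
  exact: (@smooth_continuous R (bump (- A) A 1) 0 (@smooth_bump R (- A) A 1)).
have lt01 : (0 : R) < 1 := ltr01.
have sb := @supp_in_mull R _ _ F _ (@supp_in_bump R (- A) A 1 lt01).
have [MF MF0 hMF] := supp_in_bounded cb sb.
exists (MF * (2 * A)), k => phi M' tphi supp hM'; have sphi := test_smooth tphi.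
have hA : supp_in (- A) A phi.
  move=> x hx; apply: fsupport_notin => /supp fx; move/negP: hx; apply.
  rewrite -ler_norml; apply: (hM A) => //.
  by rewrite (le_lt_trans (ler_norm M))// ltrDl.
rewrite (dnthE k cF sphi hA) normrM normrX normrN1 expr1n mul1r.
have -> : MF * (2 * A) * M' = MF * M' * (A - - A) by ring.
apply: itg_bound; [lra|exact: continuous_mul_smooth|move=> x hx].
rewrite normrM; apply: ler_pM => //; last exact: hM'.
by have := hMF x; rewrite bump_eq1 ?mulr1.
Qed.

Lemma ddistr_dnth F k : ddistr (dnth F k) (dnth F k.+1).
Proof.
move=> phi tphi; rewrite /dnth exprS mulN1r mulNr; congr (- (_ * _)).
apply: eq_Rintegral => y _; congr (_ * _).
by rewrite derive1nSr -derive1n1.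
Qed.

(** The remainder is at most e |h|^k on an interval of length O(|t|), and the k derivatives of the
    dilated test function cost |t|^-k; after division by |t| an error O(e) remains. *)
Lemma point_value_near F k (x C : R) p : continuous F -> smooth p -> p^[k] = (fun=> C) ->
  approx k F x p -> point_value (dnth F k) x C.
Proof.
move=> cF sp pC hap phi tphi; have sphi := test_smooth tphi.
have [A A0 hA] := test_supp_in tphi; have [M M0 hM] := test_bounded k tphi.
pose B := A + 1; have B0 : 0 < B by rewrite /B; lra.
have hB : supp_in (- B) B phi by apply: supp_in_le hA; rewrite /B; lra.
have cphi : continuous phi := @smooth_continuous R phi 0 sphi.
have cp : continuous p := @smooth_continuous R p 0 sp.
apply/cvgrPdist_le => e e0.
pose D := B ^+ k * M * (2 * B) + 1.
have D0 : 0 < D by rewrite ltr_wpDl// !mulr_ge0// ?exprn_ge0// ltW.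
have [d d0 hd] := hap _ (divr_gt0 e0 D0).
rewrite near_withinE; apply/nbhs_ballP; exists (d / (2 * B)) => /=.
  by rewrite divr_gt0// mulr_gt0.
move=> t; rewrite /ball/= sub0r normrN => td tn0.
have t0 : 0 < `|t| by rewrite normr_gt0.
have tB : `|t| * (2 * B) < d by rewrite -ltr_pdivlMr// mulr_gt0.
pose P := x - B * `|t|; pose Q := x + B * `|t|.
have Bt : 0 < B * `|t| by rewrite mulr_gt0.
have PQ : P <= Q by rewrite /P /Q; lra.
have tv0 : t^-1 != 0 by rewrite invr_eq0.
have spsi : smooth (fun y => phi ((y - x) * t^-1)) := @smooth_affine R phi x t^-1 sphi.
have scale_supp E : supp_in (- E) E phi ->
    supp_in (x - E * `|t|) (x + E * `|t|) (fun y => phi ((y - x) * t^-1)).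
  move=> hE y hy; apply: hE; apply: contra hy; rewrite -!ler_norml normrM normfV.
  by rewrite ler_pdivrMr// ler_norml => /andP[h1 h2]; apply/andP; split; lra.
have sA := scale_supp A hA; have sB := scale_supp B hB.
have [zP zQ] : (forall j, (fun y => phi ((y - x) * t^-1))^[j] P = 0) /\
    (forall j, (fun y => phi ((y - x) * t^-1))^[j] Q = 0).
  by apply: supp_in_derive1n_bounds sA; rewrite /P /Q /B mulrDl; lra.
have BB : - B <= B by lra.
have mass : itg (fun y => phi ((y - x) * t^-1)) P Q = `|t| * itg phi (- B) B.
  have Pt : P - x = - (B * `|t|) by rewrite /P; ring.
  have Qt : Q - x = B * `|t| by rewrite /Q; ring.
  (* Point values involve both signs of t; a negative one is reduced to a positive one by reflecting
     [phi]. *)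
  have [tp|tn] : 0 < t \/ 0 < - t.
    by move: tn0; rewrite neq_lt => /orP[h|h]; [right; rewrite oppr_gt0|left].
  - rewrite (itg_affine _ PQ tp cphi) Pt Qt (gtr0_norm tp) mulNr mulfK//.
  - have cphi' : continuous (fun y => phi (- y)).
      by move=> y; apply: (@continuous_comp _ _ _ (fun y => - y)); [exact: opp_continuous|exact: cphi].
    have tE : t^-1 = - (- t)^-1 by rewrite invrN opprK.
    rewrite (itg_eq (g := fun y => phi (- ((y - x) * (- t)^-1)))); last first.
      by move=> y _; rewrite tE mulrN.
    have tn' : t < 0 by rewrite -oppr_gt0.
    rewrite (itg_affine (f := fun y => phi (- y)) _ PQ tn cphi') Pt Qt (ltr0_norm tn').
    have e1 : - (B * - t) * (- t)^-1 = - B by field.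
    have e2 : B * - t * (- t)^-1 = B by field.
    by rewrite e1 e2 (itg_opp BB cphi) opprK.
rewrite /dilate (dnth_split PQ cF sp pC spsi sB zP zQ) mass (itg_setT cphi hB).
set J := itg (fun y => (F y - p y) * _) P Q.
have hJ : `|J| <= e / D * (B ^+ k * M * (2 * B)) * `|t|.
  have -> : e / D * (B ^+ k * M * (2 * B)) * `|t| = e / D * (B ^+ k * M) * (Q - P).
    by rewrite /Q /P; ring.
  apply: itg_bound => // [|y /andP[y1 y2]].
    by apply: continuous_mul_smooth => // z; apply: cvgB; [exact: cF|exact: cp].
  rewrite (@derive1n_affine R phi x t^-1 k sphi) !normrM normrX normfV.
  have yx : `|y - x| <= B * `|t| by rewrite ler_norml /P /Q in y1 y2 *; apply/andP; split; lra.
  have yd : `|y - x| < d by apply: le_lt_trans yx _; move: tB; lra.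
  have := hd (y - x) yd; rewrite (addrC x) subrK => a1.
  have a2 : `|phi^[k] ((y - x) * t^-1)| <= M by exact: hM.
  have a3 : `|y - x| ^+ k <= (B * `|t|) ^+ k.
    by apply: lerXn2r => //; rewrite nnegrE// ltW.
  have a4 : `|F y - p y| <= e / D * (B * `|t|) ^+ k.
    by apply: le_trans a1 _; rewrite ler_wpM2l// ltW// divr_gt0.
  have tk : `|t|^-1 ^+ k * (B * `|t|) ^+ k = B ^+ k.
    by rewrite exprMn mulrCA -exprMn mulVf ?expr1n ?mulr1// gt_eqF.
  rewrite mulrA; apply: le_trans (_ : e / D * (B * `|t|) ^+ k * `|t|^-1 ^+ k * M <= _).
    have a5 : 0 <= `|t|^-1 ^+ k by rewrite exprn_ge0// invr_ge0.
    exact: ler_pM (mulr_ge0 (normr_ge0 _) a5) (normr_ge0 _) (ler_wpM2r a5 a4) a2.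
  by rewrite -(mulrA (e / D)) (mulrC ((B * `|t|) ^+ k)) tk -!mulrA.
have -> : C * itg phi (- B) B - `|t|^-1 * (C * (`|t| * itg phi (- B) B) + (-1) ^+ k * J) =
    - ((-1) ^+ k * (`|t|^-1 * J)).
  by field; rewrite gt_eqF.
rewrite normrN normrM normrX normrN1 expr1n mul1r normrM normfV normr_id.
rewrite ler_pdivrMl// mulrC; apply: le_trans hJ _; rewrite ler_wpM2r//.
by rewrite mulrAC ler_pdivrMr// ler_wpM2l ?(ltW e0)// lerDl.
Qed.

Lemma point_value_unique T (x c d : R) : point_value T x c -> point_value T x d -> c = d.
Proof.
move=> hc hd; have := hc _ (test_step_shift 0); have := hd _ (test_step_shift 0).
rewrite (itg_step_shift 0) !mulr1 => h1 h2.
exact: (cvg_unique _ h2 h1).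
Qed.

Lemma point_value_sub T U (x c d : R) : point_value T x c -> point_value U x d ->
  point_value (fun phi => T phi - U phi) x (c - d).
Proof.
move=> hc hd phi tphi; rewrite mulrBl.
have h := cvgB (hc phi tphi) (hd phi tphi).
have -> : dilate (fun phi => T phi - U phi) x ^~ phi = (fun t => dilate T x t phi - dilate U x t phi).
  by apply/funext => t; rewrite /dilate mulrBr.
exact: h.
Qed.

End NthDerivative.

(** * Means of derivatives *)

Section Decay.
Context {R : realType}.
Implicit Types (F f p phi chi : R -> R).

(** The power (1 + w^2)^(al/2), comparable with |w|^al at infinity but smooth and positive
    everywhere. *)
Definition bracket_pow (al w : R) : R := expR (al / 2 * ln (1 + w ^+ 2)).

Let br_gt0 (w : R) : 0 < 1 + w ^+ 2.
Proof. by rewrite ltr_pwDl// sqr_ge0. Qed.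

Let ln_ge0' (w : R) : 0 <= ln (1 + w ^+ 2).
Proof. by apply: ln_ge0; rewrite lerDl sqr_ge0. Qed.

Lemma bracket_pow_le1 al w : al <= 0 -> bracket_pow al w <= 1.
Proof.
move=> al0; rewrite /bracket_pow -[leRHS]expR0 ler_expR; have := ln_ge0' w => h.
by rewrite mulr_le0_ge0// mulr_le0_ge0// invr_ge0.
Qed.

Lemma norm_bracket_pow al w : `|w| * bracket_pow al w <= bracket_pow (al + 1) w.
Proof.
have [->|w0] := eqVneq w 0; first by rewrite normr0 mul0r expR_ge0.
have h : `|w| <= expR (2^-1 * ln (1 + w ^+ 2)).
  have hw : 0 < `|w| by rewrite normr_gt0.
  rewrite -[leLHS]lnK ?posrE// ler_expR.
  have : ln (`|w| ^+ 2) <= ln (1 + w ^+ 2).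
    by rewrite ler_ln ?posrE ?exprn_gt0// real_normK ?num_real// lerDr.
  by rewrite lnXn// -mulr_natl; lra.
have -> : bracket_pow (al + 1) w = expR (2^-1 * ln (1 + w ^+ 2)) * bracket_pow al w.
  by rewrite /bracket_pow -expRD; congr expR; ring.
by rewrite ler_wpM2r// expR_ge0.
Qed.

Lemma is_derive_bracket_pow al (w : R) :
  is_derive w 1 (bracket_pow al) (al * w * (1 + w ^+ 2)^-1 * bracket_pow al w).
Proof.
have h1 : is_derive w 1 (fun y : R => 1 + y ^+ 2) (2 * w).
  have := is_derive_add (is_derive_cst (1 : R) w 1) (is_derive_mul (is_derive_id w 1) (is_derive_id w 1)).
  move=> h; apply: (is_derive_eq1 (is_derive_ext _ h)); last by rewrite /=; ring.
  by move=> y; rewrite expr2.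
have h2 := @is_derive_chain R (@ln R) (fun y => 1 + y ^+ 2) w _ _ (is_derive1_ln (br_gt0 w)) h1.
have h3 := is_derive_scale (al / 2) h2.
have h4 := @is_derive_chain R (@expR R) (fun y => al / 2 * ln (1 + y ^+ 2)) w _ _ (is_derive_expR _) h3.
by apply: (is_derive_eq1 h4); rewrite /bracket_pow; field; rewrite gt_eqF.
Qed.

Lemma continuous_bracket_pow al : continuous (bracket_pow al).
Proof. by move=> w; exact: is_derive_continuous (@is_derive_bracket_pow al w). Qed.

(* The primitive is read off from -(w <w>^al)', up to a multiple of atan'. *)
Lemma itg_bracket_pow al : al < -1 -> exists2 C, 0 <= C & forall A B, A <= B ->
  itg (bracket_pow al) A B <= C.
Proof.
move=> hal; pose be := - al - 1; have be0 : 0 < be by rewrite /be; lra.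
have al0 : al <= 0 by lra.
have pi0 : 0 <= pi :> R := pi_ge0 R.
exists ((2 + (1 + be) * pi) / be) => [|A B AB].
  by rewrite divr_ge0 ?(ltW be0)// addr_ge0// mulr_ge0//; lra.
have cb := @continuous_bracket_pow al.
have di (w : R) := is_derive1_atan w.
have cinv : continuous (fun w : R => (1 + w ^+ 2)^-1).
  move=> w; apply: cvgV; first by rewrite gt_eqF.
  exact: (@smooth_continuous R _ 0
    (smooth_add (@smooth_cst R 1) (@smooth_exp R _ 2 (@smooth_id R)))).
pose f w := be * bracket_pow al w + (1 + be) * ((1 + w ^+ 2)^-1 * (1 - bracket_pow al w)).
have c1 : continuous (fun w => be * bracket_pow al w).
  by move=> w; apply: cvgM; [exact: cst_continuous|exact: cb].
have cf : continuous f.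
  move=> w; apply: cvgD; first exact: c1.
  apply: cvgM; [exact: cst_continuous|apply: cvgM; [exact: cinv|]].
  by apply: cvgB; [exact: cst_continuous|exact: cb].
rewrite ler_pdivlMr// mulrC -(itgZ _ _ _ cb).
apply: (@le_trans _ _ (itg f A B)).
  apply: itg_le => // w _; rewrite lerDl mulr_ge0//; first by lra.
  by rewrite mulr_ge0 ?invr_ge0 ?(ltW (br_gt0 w))// subr_ge0 bracket_pow_le1.
have hd (w : R) : is_derive w 1 (fun w => -1 * (w * bracket_pow al w) + (1 + be) * atan w) (f w).
  have h := is_derive_add
    (is_derive_scale (-1) (is_derive_mul (is_derive_id w 1) (@is_derive_bracket_pow al w)))
    (is_derive_scale (1 + be) (di w)).
  apply: (is_derive_eq1 h); rewrite /f /be; field.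
  by rewrite gt_eqF.
rewrite (itg_FTC AB cf (fun w _ => hd w)).
have G w : `|w * bracket_pow al w| <= 1.
  rewrite normrM (ger0_norm (expR_ge0 _)); apply: le_trans (norm_bracket_pow _ _) _.
  by apply: bracket_pow_le1; lra.
have := G A; have := G B; rewrite !ler_norml => /andP[g1 g2] /andP[g3 g4].
have a1 := atan_ltpi2 B; have a2 := atan_gtNpi2 A.
have : (1 + be) * (atan B - atan A) <= (1 + be) * pi by rewrite ler_wpM2l//; lra.
move: (B * bracket_pow al B) (A * bracket_pow al A) g1 g2 g3 g4 => u v; lra.
Qed.

Lemma bracket_pow_small al (e : R) : al < -1 -> 0 < e ->
  exists2 W, 0 < W & forall w, W <= `|w| -> `|w| * bracket_pow al w <= e.
Proof.
move=> hal e0; pose be := - al - 1; have be0 : 0 < be by rewrite /be; lra.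
exists (Num.sqrt (expR (- (2 / be * ln e)))) => [|w hw].
  by rewrite sqrtr_gt0 expR_gt0.
apply: le_trans (norm_bracket_pow _ _) _; rewrite /bracket_pow.
have w2 : expR (- (2 / be * ln e)) <= w ^+ 2.
  rewrite -(real_normK (num_real w)) -[leLHS]sqr_sqrtr ?expR_ge0//.
  by apply: lerXn2r => //; rewrite nnegrE// sqrtr_ge0.
have : - (2 / be * ln e) <= ln (1 + w ^+ 2).
  rewrite -[leLHS]expRK ler_ln ?posrE ?expR_gt0//.
  by apply: le_trans w2 _; rewrite lerDr.
rewrite -[X in _ -> _ <= X]lnK ?posrE// ler_expR => h.
have -> : (al + 1) / 2 * ln (1 + w ^+ 2) = - (be / 2 * ln (1 + w ^+ 2)) by rewrite /be; ring.
have -> : ln e = - (be / 2 * - (2 / be * ln e)) by field; rewrite gt_eqF.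
by rewrite lerN2 ler_wpM2l// divr_ge0// ltW.
Qed.

(** Replaces the conditions at infinity by one global bound: the weight |w|^j offsets the faster
    decay of the j-th derivative, and on a compact interval a maximum is absorbed in D. *)
Lemma testT0_bracket phi : testT0 phi -> exists2 al, al < -1 & forall k,
  exists2 D, 0 <= D & forall j w, (j <= k)%N -> `|w| ^+ j * `|phi^[j] w| <= D * bracket_pow al w.
Proof.
move=> [sphi _ _ [al hal hdec]]; exists al => // k.
have one j : exists2 D, 0 <= D & forall w, `|w| ^+ j * `|phi^[j] w| <= D * bracket_pow al w.
  have [C [[w1 [_ h1]] [w2 [_ h2]]]] := hdec j.
  pose W := Num.max 1 (Num.max (w1 + 1) (1 - w2)).
  have [W1 W2 W3] : [/\ 1 <= W, w1 + 1 <= W & 1 - w2 <= W] by rewrite /W !le_max !lexx ?orbT.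
  have W0 : 0 < W by lra.
  have cb : continuous (fun y => phi^[j] y * bump (- W) W 1 y).
    move=> y; apply: cvgM; first exact: (@smooth_continuous R phi j sphi).
    exact: (@smooth_continuous R (bump (- W) W 1) 0 (@smooth_bump R (- W) W 1)).
  have lt01 : (0 : R) < 1 := ltr01.
  have sb := @supp_in_mull R _ _ (phi^[j]) _ (@supp_in_bump R (- W) W 1 lt01).
  have [M M0 hM] := supp_in_bounded cb sb.
  have m0 : 0 < bracket_pow al W := expR_gt0 _.
  pose D1 := W ^+ j * M / bracket_pow al W; pose D2 := `|C| * expR (- (al / 2 * ln 2)).
  have D10 : 0 <= D1 by rewrite divr_ge0 ?(ltW m0)// mulr_ge0// exprn_ge0// ltW.
  have D20 : 0 <= D2 by rewrite mulr_ge0// expR_ge0.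
  exists (D1 + D2) => [|w]; first exact: addr_ge0.
  have bw : 0 <= bracket_pow al w := expR_ge0 _.
  rewrite mulrDl; have [wW|Ww] := leP `|w| W.
    rewrite -[leLHS]addr0; apply: lerD; last exact: mulr_ge0.
    have mono : bracket_pow al W <= bracket_pow al w.
      rewrite ler_expR ler_wnM2l//; first by rewrite ler_pdivrMr// mul0r; lra.
      rewrite ler_ln ?posrE// lerD2l -(real_normK (num_real w)).
      by apply: lerXn2r => //; rewrite nnegrE// ltW.
    apply: le_trans (_ : W ^+ j * M <= _).
      apply: ler_pM => //; first by apply: lerXn2r => //; rewrite nnegrE// ltW.
      by have := hM w; rewrite bump_eq1 ?mulr1//; move: wW; rewrite ler_norml.
    rewrite /D1 mulrAC -mulrA ler_peMr ?mulr_ge0 ?exprn_ge0 ?(ltW W0)//.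
    by rewrite ler_pdivlMr// mul1r.
  rewrite -[leLHS]add0r; apply: lerD; first exact: mulr_ge0.
  have w0 : 0 < `|w| by apply: lt_trans Ww.
  have h : `|phi^[j] w| <= C * `|w| `^ (al - j%:R).
    have [w_ge0|w_lt0] := leP 0 w; first by apply: h1; move: Ww; rewrite ger0_norm//; lra.
    by apply: h2; move: Ww; rewrite ltr0_norm//; lra.
  have hP : `|w| ^+ j * `|w| `^ (al - j%:R) = expR (al * ln `|w|).
    rewrite /powR gt_eqF// -[X in X ^+ j]lnK ?posrE// -expRM_natl -expRD.
    by congr expR; rewrite -mulr_natl; ring.
  apply: le_trans (_ : `|C| * expR (al * ln `|w|) <= _).
    rewrite -hP mulrCA ler_wpM2l ?exprn_ge0//; apply: le_trans h _.
    by rewrite ler_wpM2r ?powR_ge0// ler_norm.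
  rewrite /D2 -(mulrA `|C|) ler_wpM2l// /bracket_pow -expRD ler_expR.
  have hl : ln (1 + w ^+ 2) <= ln 2 + 2 * ln `|w|.
    have -> : 2 * ln `|w| = ln (`|w| ^+ 2) by rewrite lnXn// mulr_natl.
    rewrite -lnM ?posrE ?exprn_gt0// ler_ln ?posrE ?mulr_gt0 ?exprn_gt0//.
    have : 1 <= `|w| ^+ 2 by rewrite exprn_ege1//; lra.
    by rewrite real_normK ?num_real//; lra.
  have : al / 2 * (ln 2 + 2 * ln `|w|) <= al / 2 * ln (1 + w ^+ 2).
    by rewrite ler_wnM2l// ler_pdivrMr// mul0r; lra.
  lra.
elim: k => [|k [D D0 hD]].
  by have [D D0 hD] := one 0%N; exists D => // j w; rewrite leqn0 => /eqP ->.
have [D' D'0 hD'] := one k.+1; exists (D + D') => [|j w]; first exact: addr_ge0.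
have bw : 0 <= bracket_pow al w := expR_ge0 _.
rewrite mulrDl leq_eqVlt ltnS => /orP[/eqP ->|/hD h].
  by apply: le_trans (hD' w) _; rewrite lerDr mulr_ge0.
by apply: le_trans (h w) _; rewrite lerDl mulr_ge0.
Qed.

End Decay.

(** * Means of the k-th derivative at a point of approximation *)

Section MeanEstimate.
Context {R : realType}.
Implicit Types (F p phi chi : R -> R).

(** Bounded integrals of g control the part near x, where the remainder is O(|h|^k); the limit of
    |w| g(w) at infinity controls the rest, even after division by t. *)
Lemma testT0_majorant phi k : testT0 phi -> exists g : R -> R,
  [/\ continuous g, forall w, 0 <= g w,
      forall j w, (j <= k)%N -> `|w| ^+ j * `|phi^[j] w| <= g w,
      exists2 C, 0 <= C & forall A B, A <= B -> itg g A B <= C &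
      forall e, 0 < e -> exists2 W, 0 < W & forall w, W <= `|w| -> `|w| * g w <= e].
Proof.
move=> /testT0_bracket[al hal hk]; have [D D0 hD] := hk k.
have cb := @continuous_bracket_pow R al.
exists (fun w => D * bracket_pow al w); split=> //.
- by move=> w; apply: cvgM; [exact: cst_continuous|exact: cb].
- by move=> w; rewrite mulr_ge0// expR_ge0.
- have [C C0 hC] := @itg_bracket_pow R al hal; exists (D * C) => [|A B AB].
    exact: mulr_ge0.
  by rewrite (itgZ _ _ _ cb) ler_wpM2l//; exact: hC.
- move=> e e0; have D1 : 0 < D + 1 by rewrite ltr_wpDl.
  have [W W0 hW] := bracket_pow_small hal (divr_gt0 e0 D1).
  exists W => // w /hW h; rewrite mulrCA.
  apply: le_trans (_ : D * (e / (D + 1)) <= _); first by rewrite ler_wpM2l.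
  by rewrite mulrCA ler_piMr ?(ltW e0)// ler_pdivrMr// mul1r lerDl.
Qed.

(** The approximant contributes L times a mass close to 1, the remainder at most C d near x and an
    arbitrarily small amount away from it. As C depends only on [phi] and k, a small d gives
    convergence to f_n, and L = 0 with a fixed d gives bounded means. *)
Lemma mean_estimate phi k : testT0 phi -> exists2 C, 0 <= C &
  forall F (x : R) p (L d rho : R) chi, continuous F -> smooth p -> p^[k] = (fun=> L) ->
  0 <= d -> 0 < rho ->
  (forall h, `|h| <= rho -> `|F (x + h) - p (x + h)| <= d * `|h| ^+ k) ->
  test_function chi -> (forall y, 0 <= chi y <= 1) ->
  (forall y, `|y - x| < 2 * rho -> chi y = 1) ->
  forall e, 0 < e -> exists2 t0, 0 < t0 & forall t, 0 < t < t0 ->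
    `|t^-1 * dnth F k (fun y => chi y * phi ((y - x) * t^-1)) - L| <= C * d + e.
Proof.
move=> T0phi; have [g [cg g0 hg [C C0 hC] hgs]] := testT0_majorant k T0phi.
have [sphi phi0 phi1 _] := T0phi.
exists C => // F x p L d rho chi cF sp pL d0 rho0 hF tchi chi01 chi1 e e0.
have cphi : continuous phi := @smooth_continuous R phi 0 sphi.
have cp : continuous p := @smooth_continuous R p 0 sp.
have schi := test_smooth tchi.
have [A A0 hA] := test_supp_in tchi; have [Mc Mc0 hMc] := test_bounded k tchi.
pose P := Num.min (- A) (x - 2 * rho) - 1; pose Q := Num.max A (x + 2 * rho) + 1.
have [P1 P2] : P <= - A - 1 /\ P <= x - 2 * rho - 1 by rewrite /P !lerD2r !ge_min !lexx orbT.
have [Q1 Q2] : A + 1 <= Q /\ x + 2 * rho + 1 <= Q by rewrite /Q !lerD2r !le_max !lexx orbT.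
have PQ : P <= Q by lra.
have cr : continuous (fun y => F y - p y).
  by move=> y; apply: cvgB; [exact: cF|exact: cp].
have crb : continuous (fun y => (F y - p y) * bump P Q 1 y).
  move=> y; apply: cvgM; first exact: cr.
  exact: (@smooth_continuous R (bump P Q 1) 0 (@smooth_bump R P Q 1)).
have lt01 : (0 : R) < 1 := ltr01.
have srb := @supp_in_mull R _ _ (fun y => F y - p y) _ (@supp_in_bump R P Q 1 lt01).
have [Mr Mr0 hMr] := supp_in_bounded crb srb.
have L1 : 0 < `|L| + 1 by rewrite ltr_wpDl.
have e20 : 0 < e / 2 by rewrite divr_gt0.
have [M0 M00 hM0] := itg_mass cphi phi0 phi1 (divr_gt0 e20 L1).
pose S := 1 + rho^-1; have S1 : 1 <= S by rewrite lerDl invr_ge0 ltW.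
have S0 : 0 <= S by lra.
pose Kf := Mr * (2 ^+ k * (Mc * (S ^+ k * rho^-1))) * (Q - P).
have Kf0 : 0 <= Kf.
  by rewrite /Kf !mulr_ge0// ?exprn_ge0// ?invr_ge0 ?subr_ge0// ltW.
have Kf1 : 0 < Kf + 1 by rewrite ltr_wpDl.
pose e2 := e / 2 / (Kf + 1); have e2_0 : 0 < e2 by rewrite divr_gt0.
have [W W0 hW] := hgs _ e2_0.
exists (Num.min (rho / M0) (rho / W)) => [|t /andP[t0]]; first by rewrite lt_min !divr_gt0.
rewrite lt_min => /andP[tM tW]; have tv : 0 < t^-1 by rewrite invr_gt0.
pose ps y := phi ((y - x) * t^-1).
have sps : smooth ps := @smooth_affine R phi x t^-1 sphi.
have spsi : smooth (fun y => chi y * ps y) := smooth_mul schi sps.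
have hsA : supp_in (- A) A (fun y => chi y * ps y) := @supp_in_mulr R _ _ ps _ hA.
have [PA AQ] : P < - A /\ A < Q by clear -P1 Q1; split; lra.
have hs : supp_in P Q (fun y => chi y * ps y) := supp_in_le (ltW PA) (ltW AQ) hsA.
have [zP zQ] : (forall j, (fun y => chi y * ps y)^[j] P = 0) /\
    (forall j, (fun y => chi y * ps y)^[j] Q = 0) := supp_in_derive1n_bounds PA AQ hsA.
rewrite (dnth_split PQ cF sp pL spsi hs zP zQ).
have cps : continuous ps := @smooth_continuous R ps 0 sps.
have cpsi : continuous (fun y => chi y * ps y) := @smooth_continuous R _ 0 spsi.
have mass : 1 - e / 2 / (`|L| + 1) <= t^-1 * itg (fun y => chi y * ps y) P Q <= 1.
  have Mt : M0 <= rho * t^-1 by rewrite ler_pdivlMr// mulrC -ler_pdivlMr// ltW.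
  have scale B B' : B <= B' -> t^-1 * itg ps B B' = itg phi ((B - x) * t^-1) ((B' - x) * t^-1).
    by move=> BB; rewrite (itg_affine _ BB t0 cphi) mulrA mulVf ?gt_eqF// mul1r.
  have [Pr rr rQ] : [/\ P <= x - rho, x - rho <= x + rho & x + rho <= Q].
    by clear -P2 Q2 rho0; split; lra.
  apply/andP; split.
    apply: (@le_trans _ _ (t^-1 * itg ps (x - rho) (x + rho))).
      rewrite (scale _ _ rr); have -> : x - rho - x = - rho by ring.
      have -> : x + rho - x = rho by ring.
      by have := hM0 (- rho * t^-1) (rho * t^-1); rewrite mulNr lerN2 => /(_ Mt Mt) /andP[].
    rewrite ler_wpM2l ?(ltW tv)//.
    rewrite (itg_eq (g := fun y => chi y * ps y)).
      by apply: (itg_subset cpsi _ Pr rr rQ) => y; apply: mulr_ge0; [have /andP[] := chi01 y|exact: phi0].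
    by move=> y /andP[y1 y2]; rewrite chi1 ?mul1r//; clear -y1 y2 rho0; rewrite ltr_norml; apply/andP; split; lra.
  apply: (@le_trans _ _ (t^-1 * itg ps P Q)).
    rewrite ler_wpM2l ?(ltW tv)//; apply: itg_le => // y _.
    by apply: ler_piMl; [exact: phi0|have /andP[] := chi01 y].
  rewrite (scale _ _ PQ).
  have PM : (P - x) * t^-1 <= - M0.
    apply: (@le_trans _ _ (- rho * t^-1)); last by rewrite mulNr lerN2.
    by rewrite ler_pM2r//; clear -Pr; lra.
  have QM : M0 <= (Q - x) * t^-1.
    by apply: le_trans Mt _; rewrite ler_pM2r//; clear -rQ; lra.
  by have /andP[] := hM0 _ _ PM QM.
set J := itg (fun y => (F y - p y) * _) P Q.
pose e3 := Mr * (2 ^+ k * (Mc * (S ^+ k * (e2 / rho)))).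
have e30 : 0 <= e3.
  by rewrite /e3 !mulr_ge0// ?exprn_ge0// ?invr_ge0 ?(ltW e2_0)// ltW.
have cga : continuous (fun y => g ((y - x) * t^-1)) := @continuous_affine R g x t^-1 cg.
have hJ : `|J| <= t * (d * C + e3 * (Q - P)).
  have c1 : continuous (fun y => d * g ((y - x) * t^-1)).
    by move=> y; apply: cvgM; [exact: cst_continuous|exact: cga].
  have c2 : continuous (fun _ : R => t * e3) by move=> y; exact: cst_continuous.
  apply: (@le_trans _ _ (itg (fun y => d * g ((y - x) * t^-1) + t * e3) P Q)); last first.
    rewrite (itgD _ _ c1 c2) (itgZ _ _ _ cga) (itg_affine _ PQ t0 cg) itg_cst//.
    have h : itg g ((P - x) * t^-1) ((Q - x) * t^-1) <= C.
      by apply: hC; rewrite ler_pM2r// lerD2r.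
    have -> z : d * (t * z) + t * e3 * (Q - P) = t * (d * z + e3 * (Q - P)) by ring.
    by rewrite ler_wpM2l ?(ltW t0)// lerD2r ler_wpM2l.
  apply: itg_norm_le => [||y /andP[y1 y2]].
  - exact: continuous_mul_smooth.
  - by move=> y; apply: cvgD; [exact: c1|exact: c2].
  (* At distance at least rho the expansion gives no information; there g <= e2 t / rho, and the
     factor t cancels the normalisation t^-1. *)
  have [far|near] := leP rho `|y - x|.
    rewrite -[leLHS]add0r; apply: lerD; first by rewrite mulr_ge0.
    have yx0 : 0 < `|y - x| := lt_le_trans rho0 far.
    have gw : g ((y - x) * t^-1) <= e2 * (t / rho).
      have hw : `|(y - x) * t^-1| = `|y - x| * t^-1 by rewrite normrM (gtr0_norm tv).
      have := hW ((y - x) * t^-1); rewrite hw => hh.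
      have /hh {hh} : W <= `|y - x| * t^-1.
        rewrite ler_pdivlMr//; apply: le_trans far.
        by rewrite mulrC -ler_pdivlMr// ltW.
      have rt : 0 < rho * t^-1 by rewrite mulr_gt0.
      have gle : rho * t^-1 * g ((y - x) * t^-1) <= `|y - x| * t^-1 * g ((y - x) * t^-1).
        by rewrite ler_wpM2r// ler_pM2r.
      move=> /(le_trans gle); rewrite mulrC -ler_pdivlMr// => h.
      by apply: le_trans h _; rewrite invfM invrK (mulrC _ t) lexx.
    have dps j y' : ps^[j] y' = t^-1 ^+ j * phi^[j] ((y' - x) * t^-1).
      by rewrite /ps (@derive1n_affine R phi x t^-1 j sphi).
    have hps j : (j <= k)%N -> `|ps^[j] y| <= S ^+ k * (e2 * (t / rho)).
      move=> jk; rewrite dps normrM (ger0_norm (x := t^-1 ^+ j)) ?exprn_ge0 ?(ltW tv)//.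
      have -> : t^-1 ^+ j * `|phi^[j] ((y - x) * t^-1)| =
          `|y - x|^-1 ^+ j * (`|(y - x) * t^-1| ^+ j * `|phi^[j] ((y - x) * t^-1)|).
        rewrite normrM (gtr0_norm tv) mulrA exprMn; congr (_ * _).
        by rewrite mulrA -exprMn mulVf ?gt_eqF// expr1n mul1r.
      have h1 : `|y - x|^-1 ^+ j <= S ^+ k.
        apply: (@le_trans _ _ (S ^+ j)); last by rewrite ler_weXn2l.
        apply: lerXn2r; rewrite ?nnegrE ?invr_ge0//.
        apply: (@le_trans _ _ rho^-1); last by rewrite /S lerDr.
        by rewrite lef_pV2 ?posrE.
      have q1 : 0 <= `|y - x|^-1 ^+ j by apply: exprn_ge0; rewrite invr_ge0.
      have q2 : 0 <= `|(y - x) * t^-1| ^+ j * `|phi^[j] ((y - x) * t^-1)|.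
        by apply: mulr_ge0 => //; exact: exprn_ge0.
      exact: (ler_pM q1 q2 h1 (le_trans (hg _ _ jk) gw)).
    have hpsi := derive1n_mul_bound schi sps (fun i ik => hMc i y ik) hps.
    rewrite normrM; have -> : t * e3 = Mr * (2 ^+ k * (Mc * (S ^+ k * (e2 * (t / rho))))).
      by rewrite /e3; ring.
    apply: ler_pM => //.
    by have := hMr y; rewrite bump_eq1 ?mulr1// y1.
  rewrite -[leLHS]addr0; apply: lerD; last by rewrite mulr_ge0// ltW.
  have nearE : \forall z \near y, chi z * ps z = ps z.
    have : \forall z \near y, `|z - y| < rho.
      by apply/nbhs_ballP; exists rho => // z; rewrite /ball/= distrC.
    apply: filterS => z zy; rewrite chi1 ?mul1r//.
    have -> : z - x = (z - y) + (y - x) by ring.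
    by apply: le_lt_trans (ler_normD _ _) _; clear -zy near; lra.
  rewrite (derive1n_near_eq k spsi sps nearE) /ps (@derive1n_affine R phi x t^-1 k sphi).
  rewrite !normrM (ger0_norm (x := t^-1 ^+ k)) ?exprn_ge0 ?(ltW tv)//.
  have := hF (y - x) (ltW near); rewrite (addrC x) subrK => a1.
  apply: (@le_trans _ _ (d * (`|(y - x) * t^-1| ^+ k * `|phi^[k] ((y - x) * t^-1)|))); last first.
    by rewrite ler_wpM2l//; exact: hg.
  have -> : d * (`|(y - x) * t^-1| ^+ k * `|phi^[k] ((y - x) * t^-1)|) =
      d * `|y - x| ^+ k * (t^-1 ^+ k * `|phi^[k] ((y - x) * t^-1)|).
    by rewrite normrM (gtr0_norm tv) exprMn; ring.
  by rewrite ler_wpM2r// mulr_ge0// exprn_ge0// ltW.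
have tJ : `|t^-1 * ((-1) ^+ k * J)| <= C * d + e / 2.
  rewrite !normrM normrX normrN1 expr1n mul1r (gtr0_norm tv) ler_pdivrMl//.
  apply: le_trans hJ _; rewrite ler_wpM2l ?(ltW t0)// (mulrC d) lerD2l.
  have -> : e3 * (Q - P) = e2 * Kf by rewrite /e3 /Kf; ring.
  by rewrite /e2 mulrAC ler_pdivrMr// ler_wpM2l ?(ltW e20)// lerDl.
have -> z : t^-1 * (L * z + (-1) ^+ k * J) - L = L * (t^-1 * z - 1) + t^-1 * ((-1) ^+ k * J) by ring.
apply: le_trans (ler_normD _ _) _.
suff : `|L * (t^-1 * itg (fun y => chi y * ps y) P Q - 1)| <= e / 2.
  by move=> h; clear -h tJ; lra.
rewrite normrM; apply: (@le_trans _ _ ((`|L| + 1) * (e / 2 / (`|L| + 1)))); last first.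
  by rewrite mulrC divfK// gt_eqF.
apply: ler_pM => //; first by rewrite lerDl.
by move: mass => /andP[m1 m2]; clear -m1 m2; rewrite ler_norml; apply/andP; split; lra.
Qed.

End MeanEstimate.

(** * Major and minor pairs *)

Section LimitBounds.
Context {R : realType}.
Implicit Types (f : R -> R) (l x : R).

Lemma limf_esup_le f l d : 0 < d -> (forall t, 0 < t < d -> f t <= l) ->
  (limf_esup (fun t => (f t)%:E) 0^'+ <= l%:E)%E.
Proof.
move=> d0 h; apply: ereal_inf_le; exists (ereal_sup ((fun t => (f t)%:E) @` [set t | 0 < t < d])).
  exists [set t | 0 < t < d] => //; near=> t; apply/andP; split; near: t.
    exact: nbhs_right_gt.
  exact: nbhs_right_lt.
by apply: ge_ereal_sup => _ [t ht <-]; rewrite lee_fin; exact: h.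
Unshelve. all: by end_near. Qed.

Lemma limf_esup_lt f l : (limf_esup (fun t => (f t)%:E) 0^'+ < l%:E)%E ->
  exists2 d, 0 < d & forall t, 0 < t < d -> f t <= l.
Proof.
move=> /ereal_inf_lt[_ [V hV <-] hl].
move: hV => /nbhs_ballP[d /= d0 hd].
exists d => // t /andP[t0 td]; rewrite -lee_fin; apply: le_trans (ltW hl).
by apply: ereal_sup_ubound; exists t => //; apply: hd => //; rewrite /ball/= sub0r normrN gtr0_norm.
Qed.

Lemma limf_einf_ge f l d : 0 < d -> (forall t, 0 < t < d -> l <= f t) ->
  (l%:E <= limf_einf (fun t => (f t)%:E) 0^'+)%E.
Proof.
move=> d0 h; rewrite /limf_einf leeNr; apply: (limf_esup_le (f := fun t => - f t) d0) => t ht.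
by rewrite lerN2; exact: h.
Qed.

Lemma limf_einf_gt f l : (l%:E < limf_einf (fun t => (f t)%:E) 0^'+)%E ->
  exists2 d, 0 < d & forall t, 0 < t < d -> l <= f t.
Proof.
rewrite /limf_einf lteNr => /(@limf_esup_lt (fun t => - f t) (- l))[d d0 h].
by exists d => // t /h; rewrite lerN2.
Qed.

End LimitBounds.

(** * Means of distributions supported in [a, b] *)

Section Means.
Context {R : realType}.
Variables (a b : R) (ab : a < b).
Implicit Types (u : (R -> R) -> R) (phi : R -> R) (x t l : R).

Definition plateau : R -> R := bump (a - 1) (b + 1) 1.

Definition mean u phi x t : R := t^-1 * u (fun y => plateau y * phi ((y - x) * t^-1)).

Lemma plateau_eq1 y : a - 1 <= y <= b + 1 -> plateau y = 1.
Proof. by move=> hy; apply: bump_eq1 => //; exact: ltr01. Qed.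

Lemma test_plateau : test_function plateau.
Proof.
apply: (@supp_in_test R (a - 1 - 1) (b + 1 + 1)); first exact: smooth_bump.
by apply: supp_in_bump; exact: ltr01.
Qed.

Lemma dilate_mean u phi x t : supported_distribution a b u -> smooth phi -> 0 < t ->
  dilate (smooth_pairing u) x t phi = mean u phi x t.
Proof.
move=> su sphi t0; rewrite /dilate (gtr0_norm t0) /mean; congr (_ * _).
have hn y : a <= y <= b -> \forall z \near y, plateau z = 1.
  move=> /andP[y1 y2]; have lt01 : (0 : R) < 1 := ltr01.
  apply/nbhs_ballP; exists 1 => // z; rewrite /ball/= ltr_norml => /andP[h1 h2].
  by apply: plateau_eq1; apply/andP; split; lra.
exact: (smooth_pairingE su test_plateau hn (@smooth_affine R phi x t^-1 sphi)).
Qed.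

Lemma hconv_mean u x t : distribution u -> 0 < t ->
  hconv u plateau 0 x t = mean u gk x t.
Proof.
move=> du t0; rewrite /hconv /mean -(dist_scale _ du); last first.
  by apply: test_mulr test_plateau _; exact: (@smooth_affine R gk x t^-1 (@smooth_gk R)).
by congr u; apply/funext => y; rewrite /hker expr1 mulrCA.
Qed.


Lemma upper_value_le u phi x l : supported_distribution a b u -> smooth phi ->
  (forall e, 0 < e -> exists2 d, 0 < d & forall t, 0 < t < d -> mean u phi x t <= l + e) ->
  (upper_value u phi x <= l%:E)%E.
Proof.
move=> su sphi h; apply/lee_addgt0Pr => e e0; have [d d0 hd] := h e e0.
rewrite -EFinD; apply: (limf_esup_le d0) => t /andP[t0 td].
by rewrite dilate_mean//; apply: hd; rewrite t0.
Qed.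

Lemma lower_value_ge u phi x l : supported_distribution a b u -> smooth phi ->
  (forall e, 0 < e -> exists2 d, 0 < d & forall t, 0 < t < d -> l - e <= mean u phi x t) ->
  (l%:E <= lower_value u phi x)%E.
Proof.
move=> su sphi h; apply/lee_addgt0Pr => e e0; have [d d0 hd] := h e e0.
rewrite -leeBlDr// -EFinB; apply: (limf_einf_ge d0) => t /andP[t0 td].
by rewrite dilate_mean//; apply: hd; rewrite t0.
Qed.

Lemma upper_value_lt u phi x l : supported_distribution a b u -> smooth phi ->
  (upper_value u phi x < l%:E)%E ->
  exists2 d, 0 < d & forall t, 0 < t < d -> mean u phi x t <= l.
Proof.
move=> su sphi /limf_esup_lt[d d0 h]; exists d => // t ht; rewrite -(dilate_mean _ su sphi).
  exact: h.
by case/andP: ht.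
Qed.

Lemma lower_value_gt u phi x l : supported_distribution a b u -> smooth phi ->
  (l%:E < lower_value u phi x)%E ->
  exists2 d, 0 < d & forall t, 0 < t < d -> l <= mean u phi x t.
Proof.
move=> su sphi /limf_einf_gt[d d0 h]; exists d => // t ht; rewrite -(dilate_mean _ su sphi).
  exact: h.
by case/andP: ht.
Qed.

End Means.

(** * Support of a derivative *)

Section Support.
Context {R : realType}.
Implicit Types (F q phi : R -> R).

Lemma fsupport_derive1n phi k y : ~ fsupport phi y -> phi^[k] y = 0.
Proof.
move=> hy; apply: derive1n_near0.
have : open (~` fsupport phi) by rewrite openC; exact: closed_closure.
move=> /(_ y) /(_ hy); rewrite /interior; apply: filterS => z; exact: fsupport_notin.
Qed.

(** To the right of b, F coincides with a function whose k-th derivative is 0, and integration by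
    parts moves the derivatives onto it. *)
Lemma dsupport_dnth F q k (a b : R) : continuous F -> smooth q -> q^[k] = (fun=> 0) ->
  (forall y, y < a -> F y = 0) -> (forall y, b < y -> F y = q y) ->
  dsupport (dnth F k) `<=` `[a, b].
Proof.
move=> cF sq q0 hl hr x hx; rewrite /= in_itv /=; apply: contrapT => hn; apply: hx.
have [xa|ax] := ltP x a.
  exists `]-oo, a[%classic; last by rewrite /= in_itv.
  split; first exact: interval_open.
  move=> phi tphi supp; rewrite /dnth (_ : (fun y => _) = (fun=> 0)).
    by rewrite Rintegral_cst//= mul0r mulr0.
  apply/funext => y; have [ya|ay] := ltP y a; first by rewrite hl// mul0r.
  rewrite (@fsupport_derive1n phi) ?mulr0// => /supp /=.
  by rewrite in_itv/= ltNge ay.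
have bx : b < x by rewrite ltNge; apply/negP => xb; apply: hn; rewrite ax xb.
exists `]b, +oo[%classic; last by rewrite /= in_itv/= bx.
split; first exact: interval_open.
move=> phi tphi supp; have sphi := test_smooth tphi.
have -> : dnth F k phi = dnth q k phi.
  rewrite /dnth; congr (_ * _); apply: eq_Rintegral => y _.
  have [yb|yb] := leP y b; last by rewrite hr.
  rewrite (@fsupport_derive1n phi) ?mulr0// => /supp /=.
  by rewrite in_itv/= andbT ltNge yb.
have [A A0 hA] := test_supp_in tphi.
have AA : - (A + 1) <= A + 1 by lra.
have hA' : supp_in (- (A + 1)) (A + 1) phi by apply: supp_in_le hA; lra.
have [zP zQ] : (forall j, phi^[j] (- (A + 1)) = 0) /\ (forall j, phi^[j] (A + 1) = 0).
  by apply: supp_in_derive1n_bounds hA; lra.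
have cq : continuous q := @smooth_continuous R q 0 sq.
rewrite (dnth_split AA cq sq q0 sphi hA' zP zQ) mul0r add0r.
rewrite (itg_eq (g := fun=> 0)) => [|y _]; last by rewrite subrr mul0r.
by rewrite itg_cst// mul0r mulr0.
Qed.

End Support.

(** * One pair that is both major and minor *)

Section Pair.
Context {R : realType}.
Variables (a b : R) (N : nat) (F g q : R -> R) (gamma : R) (E Z : set R).
Hypothesis ab : a < b.
Hypothesis cE : countable E.
Hypothesis nZ : (@lebesgue_measure R).-negligible Z.
Hypothesis F_approx : forall x, exists p C, [/\ smooth p, p^[N] = (fun=> C) & approx N F x p].
Hypothesis F_a : exists p, [/\ smooth p, p^[N] = (fun=> 0) & approx N F a p].
Hypothesis F_b : exists p, [/\ smooth p, p^[N] = (fun=> gamma) & approx N F b p].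
Hypothesis F_left : forall y, y < a -> F y = 0.
Hypothesis F_right : forall y, b < y -> F y = q y.
Hypothesis sq : smooth q.
Hypothesis q_top : q^[N.+1] = (fun=> 0).
Hypothesis F_ae : forall x, a < x < b -> ~ Z x -> exists p,
  [/\ smooth p, p^[N.+1] = (fun=> g x) & approx N.+1 F x p].
Hypothesis F_big : forall x, a < x < b -> ~ E x -> exists p C r,
  [/\ smooth p, p^[N.+1] = (fun=> 0), 0 < r, 0 <= C &
   forall h, `|h| <= r -> `|F (x + h) - p (x + h)| <= C * `|h| ^+ N.+1].

Let v := dnth F N.+1.
Let V := dnth F N.

Let cF : continuous F.
Proof. by move=> x; have [p [C [sp _ hap]]] := F_approx x; exact: approx_continuous sp hap. Qed.

Let v_supp : supported_distribution a b v.
Proof. by split; [exact: distribution_dnth|exact: dsupport_dnth cF sq q_top F_left F_right]. Qed.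

Let V_loj : Lojasiewicz V.
Proof.
split; first exact: distribution_dnth.
move=> x; have [p [C [sp pC hap]]] := F_approx x; exists C; exact: point_value_near cF sp pC hap.
Qed.

Let V_a : point_value V a 0.
Proof. by have [p [sp p0 hap]] := F_a; exact: point_value_near cF sp p0 hap. Qed.

Let V_b : point_value V b gamma.
Proof. by have [p [sp p0 hap]] := F_b; exact: point_value_near cF sp p0 hap. Qed.

Let plateau01 y : 0 <= plateau a b y <= 1.
Proof. by rewrite bump_ge0 bump_le1. Qed.

Let plateau_near x r : a < x < b -> r <= 2^-1 -> forall y, `|y - x| < 2 * r -> plateau a b y = 1.
Proof.
move=> /andP[ax xb] hr y; rewrite ltr_norml => /andP[h1 h2].
by apply: plateau_eq1; apply/andP; split; lra.
Qed.

Let v_mean x phi : a < x < b -> ~ Z x -> testT0 phi -> forall e, 0 < e ->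
  exists2 d, 0 < d & forall t, 0 < t < d -> `|mean a b v phi x t - g x| <= e.
Proof.
move=> hx nZx tphi e e0; have [C C0 hC] := mean_estimate N.+1 tphi.
have [p [sp pg hap]] := F_ae hx nZx.
have C1 : 0 < C + 1 by rewrite ltr_wpDl.
have d0 : 0 < e / 2 / (C + 1) by rewrite !divr_gt0.
have [r r0 hr] := hap _ d0.
pose r' := Num.min (r / 2) 2^-1.
have r'0 : 0 < r' by rewrite lt_min; apply/andP; split; lra.
have [r1 r2] : r' <= r / 2 /\ r' <= 2^-1 by rewrite /r' !ge_min !lexx orbT.
have hh h : `|h| <= r' -> `|F (x + h) - p (x + h)| <= e / 2 / (C + 1) * `|h| ^+ N.+1.
  by move=> hr'; apply: hr; lra.
have e20 : 0 < e / 2 by rewrite divr_gt0.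
have [t0 t00 ht0] := hC F x p (g x) _ r' (plateau a b) cF sp pg (ltW d0) r'0 hh
  (test_plateau a b) plateau01 (plateau_near hx r2) _ e20.
exists t0 => // t /ht0 h; apply: le_trans h _.
have : C * (e / 2 / (C + 1)) <= e / 2.
  by rewrite mulrCA ler_piMr ?(ltW e20)// ler_pdivrMr// mul1r lerDl.
by lra.
Qed.

(** [mean_estimate] with L = 0: an approximant with vanishing top derivative and a remainder that is
    only O(|h|^(N+1)). *)
Let v_mean_bounded x phi : a < x < b -> ~ E x -> testT0 phi ->
  exists M d, 0 < d /\ forall t, 0 < t < d -> `|mean a b v phi x t| <= M.
Proof.
move=> hx nEx tphi; have [C C0 hC] := mean_estimate N.+1 tphi.
have [p [C' [r [sp p0 r0 C'0 hr]]]] := F_big hx nEx.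
pose r' := Num.min r 2^-1.
have r'0 : 0 < r' by rewrite lt_min r0; lra.
have [r1 r2] : r' <= r /\ r' <= 2^-1 by rewrite /r' !ge_min !lexx orbT.
have hh h : `|h| <= r' -> `|F (x + h) - p (x + h)| <= C' * `|h| ^+ N.+1.
  by move=> hr'; apply: hr; lra.
have lt01 : (0 : R) < 1 := ltr01.
have [t0 t00 ht0] := hC F x p 0 C' r' (plateau a b) cF sp p0 C'0 r'0 hh
  (test_plateau a b) plateau01 (plateau_near hx r2) _ lt01.
by exists (C * C' + 1), t0; split=> // t /ht0; rewrite subr0.
Qed.

(** At a and b only an approximation of order N is assumed; being two points, they are put into both
    exceptional sets. *)
Let ends : set R := [set a; b].

Let countable_union (A B : set R) : countable A -> countable B -> countable (A `|` B).
Proof.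
move=> cA cB; rewrite -bigcup2E; apply: bigcup_countable; first exact: countableP.
by move=> [|[|i]] _ /=.
Qed.

Let cE' : countable (E `|` ends).
Proof. by apply: countable_union => //; apply: finite_set_countable; exact: finite_set2. Qed.

Let nZ' : (@lebesgue_measure R).-negligible (Z `|` ends).
Proof.
apply: negligibleU => //; apply: negligibleU.
  by apply/negligibleP; [exact: measurable_set1|exact: lebesgue_measure_set1].
by apply/negligibleP; [exact: measurable_set1|exact: lebesgue_measure_set1].
Qed.

Let interior (A : set R) x : a <= x <= b -> ~ (A `|` ends) x -> a < x < b /\ ~ A x.
Proof.
move=> /andP[ax xb] hn; split; last by move=> Ax; apply: hn; left.
rewrite !lt_neqAle ax xb !andbT; apply/andP; split; apply/eqP => h; apply: hn; right.
  by left.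
by right.
Qed.

Let major_v : major_pair a b (fun x => (g x)%:E) v V.
Proof.
split=> //; first exact: ddistr_dnth.
exists (E `|` ends), (Z `|` ends); split=> // x phi hx /(interior hx)[hx' nx] tphi.
  have sphi : smooth phi by case: tphi.
  apply: (lower_value_ge v_supp sphi) => e e0.
  have [d d0 hd] := v_mean hx' nx tphi e0; exists d => // t /hd.
  by rewrite ler_norml => /andP[h _]; lra.
have [tphi0 _] := tphi; have sphi : smooth phi by case: tphi0.
have [M [d [d0 hd]]] := v_mean_bounded hx' nx tphi0.
apply: (@lt_le_trans _ _ (- M)%:E); first exact: ltNyr.
apply: (lower_value_ge v_supp sphi) => e e0; exists d => // t /hd.
by rewrite ler_norml => /andP[h _]; lra.
Qed.

Let minor_v : minor_pair a b (fun x => (g x)%:E) v V.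
Proof.
split=> //; first exact: ddistr_dnth.
exists (E `|` ends), (Z `|` ends); split=> // x phi hx /(interior hx)[hx' nx] tphi.
  have sphi : smooth phi by case: tphi.
  apply: (upper_value_le v_supp sphi) => e e0.
  have [d d0 hd] := v_mean hx' nx tphi e0; exists d => // t /hd.
  by rewrite ler_norml => /andP[_ h]; lra.
have [tphi0 _] := tphi; have sphi : smooth phi by case: tphi0.
have [M [d [d0 hd]]] := v_mean_bounded hx' nx tphi0.
apply: (@le_lt_trans _ _ M%:E); last exact: ltry.
apply: (upper_value_le v_supp sphi) => e e0; exists d => // t /hd.
by rewrite ler_norml => /andP[_ h]; lra.
Qed.

(* Monotonicity for the difference of two primitives, one of which is V. *)
Let compare w1 W1 w2 W2 (c1 c2 : R) (E0 Z0 : set R) :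
  supported_distribution a b w1 -> Lojasiewicz W1 -> ddistr W1 w1 ->
  point_value W1 a 0 -> point_value W1 b c1 ->
  supported_distribution a b w2 -> Lojasiewicz W2 -> ddistr W2 w2 ->
  point_value W2 a 0 -> point_value W2 b c2 ->
  countable E0 -> (@lebesgue_measure R).-negligible Z0 ->
  (forall x, a < x < b -> ~ Z0 x -> exists l, forall e, 0 < e -> exists2 d, 0 < d &
     forall t, 0 < t < d -> mean a b w2 gk x t <= l + e /\ l - e <= mean a b w1 gk x t) ->
  (forall x, a < x < b -> ~ E0 x -> exists M d, 0 < d /\
     forall t, 0 < t < d -> mean a b w2 gk x t <= M /\ - M <= mean a b w1 gk x t) ->
  c2 <= c1.
Proof.
move=> [dw1 _] lW1 dW1 pa1 pb1 [dw2 _] lW2 dW2 pa2 pb2 cE0 nZ0 hZ hE.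
pose w phi := w1 phi + -1 * w2 phi; pose W phi := W1 phi - W2 phi.
have dw : distribution w := distribution_add dw1 (distribution_scale (-1) dw2).
have dW : ddistr W w by move=> phi tphi; rewrite /w /W dW1// dW2//; ring.
have lW : Lojasiewicz W.
  split=> [|x]; last first.
    have [_ /(_ x)[l1 h1]] := lW1; have [_ /(_ x)[l2 h2]] := lW2.
    by exists (l1 - l2); exact: point_value_sub.
  have -> : W = (fun phi => W1 phi + -1 * W2 phi) by apply/funext => phi; rewrite /W mulN1r.
  by case: lW1 => dW1' _; case: lW2 => dW2' _; apply: distribution_add => //; exact: distribution_scale.
have pa : point_value W a 0 by have := point_value_sub pa1 pa2; rewrite subrr.
have pb := point_value_sub pb1 pb2.
have wE x t : 0 < t -> hconv w (plateau a b) 0 x t = mean a b w1 gk x t - mean a b w2 gk x t.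
  move=> t0; rewrite (@hconv_mean R a b w x t dw t0) /mean /w; ring.
rewrite -subr_ge0; apply: (monotone ab dw lW dW pa pb (test_plateau a b) _ ltr01 _ cE0 nZ0).
- by move=> y; have /andP[] := plateau01 y.
- exact: plateau_eq1.
- move=> x hx nx e e0; have [l hl] := hZ x hx nx.
  have e20 : 0 < e / 2 by rewrite divr_gt0.
  have [d d0 hd] := hl _ e20; exists d => // t ht; have [h1 h2] := hd t ht.
  by rewrite wE; [lra|case/andP: ht].
- move=> x hx nx; have [M [d [d0 hd]]] := hE x hx nx.
  exists (2 * M), d; split=> // t ht; have [h1 h2] := hd t ht.
  by rewrite wE; [lra|case/andP: ht].
Qed.

Let gkT1 : testT1 (@gk R) := @gk_testT1 R.
Let gkT0 : testT0 (@gk R). Proof. by case: gkT1. Qed.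
Let sgk : smooth (@gk R) := @smooth_gk R.

Let negligible_union (A B : set R) : (@lebesgue_measure R).-negligible A ->
  (@lebesgue_measure R).-negligible B -> (@lebesgue_measure R).-negligible (A `|` B).
Proof. exact: negligibleU. Qed.

Let major_ge u U c : major_pair a b (fun x => (g x)%:E) u U -> point_value U b c -> gamma <= c.
Proof.
move=> [su lU dU pa [E0 [Z0 [cE0 nZ0 hZ0 hE0]]]] pb.
apply: (compare su lU dU pa pb v_supp V_loj (@ddistr_dnth R F N) V_a V_b
  (countable_union cE0 cE) (negligible_union nZ0 nZ)) => x hx nx.
  exists (g x) => e e0.
  have nZ0x : ~ Z0 x by move=> h; apply: nx; left.
  have nZx : ~ Z x by move=> h; apply: nx; right.
  have hx' : a <= x <= b by case/andP: hx => h1 h2; rewrite !ltW.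
  have hl : ((g x - e)%:E < lower_value u gk x)%E.
    apply: lt_le_trans (hZ0 x gk hx' nZ0x gkT0); rewrite lte_fin; lra.
  have [d d0 hd] := lower_value_gt su sgk hl.
  have [d' d'0 hd'] := v_mean hx nZx gkT0 e0.
  exists (Num.min d d') => [|t /andP[t0]]; first by rewrite lt_min d0.
  rewrite lt_min => /andP[h1 h2]; have := hd t; have := hd' t; rewrite t0 h1 h2.
  by move=> /(_ isT); rewrite ler_norml => /andP[_ h3] /(_ isT) h4; split; lra.
have nE0x : ~ E0 x by move=> h; apply: nx; left.
have nEx : ~ E x by move=> h; apply: nx; right.
have hx' : a <= x <= b by case/andP: hx => h1 h2; rewrite !ltW.
(* The lower value may be +oo, in which case any M serves. *)
have [M hl] : exists M : R, ((- M)%:E < lower_value u gk x)%E.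
  have := hE0 x gk hx' nE0x gkT1; case: (lower_value u gk x) => [l _|_|//].
    by exists (1 - l); rewrite lte_fin; lra.
  by exists 0; exact: ltry.
have [d d0 hd] := lower_value_gt su sgk hl.
have [M' [d' [d'0 hd']]] := v_mean_bounded hx nEx gkT0.
exists (Num.max M M'), (Num.min d d'); split=> [|t /andP[t0]]; first by rewrite lt_min d0.
have [m1 m2] : M <= Num.max M M' /\ M' <= Num.max M M' by rewrite !le_max !lexx orbT.
rewrite lt_min => /andP[h1 h2]; have := hd t; have := hd' t; rewrite t0 h1 h2.
by move=> /(_ isT); rewrite ler_norml => /andP[_ h3] /(_ isT) h4; split; lra.
Qed.

Let minor_le u U c : minor_pair a b (fun x => (g x)%:E) u U -> point_value U b c -> c <= gamma.
Proof.
move=> [su lU dU pa [E0 [Z0 [cE0 nZ0 hZ0 hE0]]]] pb.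
apply: (compare v_supp V_loj (@ddistr_dnth R F N) V_a V_b su lU dU pa pb
  (countable_union cE0 cE) (negligible_union nZ0 nZ)) => x hx nx.
  exists (g x) => e e0.
  have nZ0x : ~ Z0 x by move=> h; apply: nx; left.
  have nZx : ~ Z x by move=> h; apply: nx; right.
  have hx' : a <= x <= b by case/andP: hx => h1 h2; rewrite !ltW.
  have hl : (upper_value u gk x < (g x + e)%:E)%E.
    apply: le_lt_trans (hZ0 x gk hx' nZ0x gkT0) _; rewrite lte_fin; lra.
  have [d d0 hd] := upper_value_lt su sgk hl.
  have [d' d'0 hd'] := v_mean hx nZx gkT0 e0.
  exists (Num.min d d') => [|t /andP[t0]]; first by rewrite lt_min d0.
  rewrite lt_min => /andP[h1 h2]; have := hd t; have := hd' t; rewrite t0 h1 h2.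
  by move=> /(_ isT); rewrite ler_norml => /andP[h3 _] /(_ isT) h4; split; lra.
have nE0x : ~ E0 x by move=> h; apply: nx; left.
have nEx : ~ E x by move=> h; apply: nx; right.
have hx' : a <= x <= b by case/andP: hx => h1 h2; rewrite !ltW.
have [M hl] : exists M : R, (upper_value u gk x < M%:E)%E.
  have := hE0 x gk hx' nE0x gkT1; case: (upper_value u gk x) => [l _|//|_].
    by exists (l + 1); rewrite lte_fin; lra.
  by exists 0; exact: ltNyr.
have [d d0 hd] := upper_value_lt su sgk hl.
have [M' [d' [d'0 hd']]] := v_mean_bounded hx nEx gkT0.
exists (Num.max M M'), (Num.min d d'); split=> [|t /andP[t0]]; first by rewrite lt_min d0.
have [m1 m2] : M <= Num.max M M' /\ M' <= Num.max M M' by rewrite !le_max !lexx orbT.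
rewrite lt_min => /andP[h1 h2]; have := hd t; have := hd' t; rewrite t0 h1 h2.
by move=> /(_ isT); rewrite ler_norml => /andP[h3 _] /(_ isT) h4; split; lra.
Qed.

(** The pair (v, V) belongs to both families with value [gamma], and comparison with it shows that
    [gamma] is extremal in each. *)
Lemma dist_integral_nth_derivative :
  dist_integrable a b (fun x => (g x)%:E) /\ dist_integral a b (fun x => (g x)%:E) = gamma.
Proof.
have infE : ereal_inf (major_values a b (fun x => (g x)%:E)) = gamma%:E.
  apply/eqP; rewrite eq_le; apply/andP; split.
    apply: ereal_inf_lbound; exists gamma => //; exists v, V; split; [exact: major_v|exact: V_b].
  apply: le_ereal_inf_tmp => _ [c [u [U [mp pb]]] <-]; rewrite lee_fin; exact: major_ge mp pb.
have supE : ereal_sup (minor_values a b (fun x => (g x)%:E)) = gamma%:E.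
  apply/eqP; rewrite eq_le; apply/andP; split.
    apply: ge_ereal_sup => _ [c [u [U [mp pb]]] <-]; rewrite lee_fin; exact: minor_le mp pb.
  apply: ereal_sup_ubound; exists gamma => //; exists v, V; split; [exact: minor_v|exact: V_b].
split; last by rewrite /dist_integral infE.
split; [by exists v, V; exact: major_v|by exists v, V; exact: minor_v|by rewrite supE infE].
Qed.

End Pair.

(** * Iterated integrals *)

Section OneStep.
Context {R : realType}.
Implicit Types (a b c x y h : R) (f F : R -> R) (dd : nat -> R).

(** The zero pair is major and minor, the whole interval being exceptional. In any pair the value at
    the right end is the normalisation U(a) = 0. *)
Lemma dist_integral_point a (g : R -> \bar R) :
  dist_integrable a a g /\ dist_integral a a g = 0.
Proof.
pose z (phi : R -> R) : R := 0.
have dz : distribution z.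
  split=> [k phi psi _ _|K _]; first by rewrite /z mulr0 addr0.
  by exists 0, 0%N => phi M _ _ _; rewrite /z normr0 mul0r.
have pz x : point_value z x 0.
  move=> phi _; rewrite mul0r.
  have -> : dilate z x ^~ phi = (fun=> 0) by apply/funext => t; rewrite /dilate mulr0.
  exact: cvg_cst.
have sz : supported_distribution a a z.
  by split=> // x hx; exfalso; apply: hx; exists setT => //; split=> //; exact: openT.
have lz : Lojasiewicz z by split=> // x; exists 0.
have ddz : ddistr z z by move=> phi _; rewrite /z oppr0.
have nz : (@lebesgue_measure R).-negligible [set a].
  by apply/negligibleP; [exact: measurable_set1|exact: lebesgue_measure_set1].
have out x : a <= x <= a -> ~ [set a] x -> False.
  by move=> /andP[h1 h2]; apply; apply/eqP; rewrite eq_le h1 h2.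
have major_z : major_pair a a g z z.
  split=> //; exists [set a], [set a]; split=> //.
    by move=> x phi /out h /h.
  by move=> x phi /out h /h.
have minor_z : minor_pair a a g z z.
  split=> //; exists [set a], [set a]; split=> //.
    by move=> x phi /out h /h.
  by move=> x phi /out h /h.
have infE : ereal_inf (major_values a a g) = 0%:E.
  apply/eqP; rewrite eq_le; apply/andP; split.
    by apply: ereal_inf_lbound; exists 0 => //; exists z, z.
  apply: le_ereal_inf_tmp => _ [c [u [U [[_ _ _ pa _] pb]]] <-].
  by rewrite (point_value_unique pb pa).
have supE : ereal_sup (minor_values a a g) = 0%:E.
  apply/eqP; rewrite eq_le; apply/andP; split.
    apply: ge_ereal_sup => _ [c [u [U [[_ _ _ pa _] pb]]] <-].
    by rewrite (point_value_unique pb pa).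
  by apply: ereal_sup_ubound; exists 0 => //; exists z, z.
split; last by rewrite /dist_integral infE.
by split; [exists z, z|exists z, z|rewrite supE infE].
Qed.

(** The expansion of [peano_derivatives] with an explicit radius and with h = 0 included. *)
Definition peano_at a b f k y dd : Prop := forall e, 0 < e -> exists2 d, 0 < d &
  forall h, `|h| < d -> a <= y + h <= b -> `|f (y + h) - tpoly k.+1 dd h| <= e * `|h| ^+ k.

Lemma peano_at_sub a b c f k y dd : c <= b -> peano_at a b f k y dd -> peano_at a c f k y dd.
Proof.
move=> cb hp e e0; have [d d0 hd] := hp e e0; exists d => // h hh /andP[h1 h2].
by apply: hd => //; rewrite h1 (le_trans h2).
Qed.

Lemma peano_at_bigO a b f k y dd : peano_at a b f k.+1 y dd -> exists C d,
  [/\ 0 < d, 0 <= C & forall h, `|h| < d -> a <= y + h <= b ->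
     `|f (y + h) - tpoly k.+1 dd h| <= C * `|h| ^+ k.+1].
Proof.
move=> hp; have [d d0 hd] := hp 1 ltr01; exists (1 + `|dd k.+1|), d; split=> // h hh hab.
have := hd h hh hab; rewrite tpolyS mul1r => h1.
have h2 : `|dd k.+1 * (h ^+ k.+1 / (k.+1)`!%:R)| <= `|dd k.+1| * `|h| ^+ k.+1.
  rewrite normrM ler_wpM2l// normrM normrX ler_piMr ?exprn_ge0//.
  by rewrite normfV normr_nat invf_le1 ?ltr0n ?fact_gt0// ler1n fact_gt0.
rewrite mulrDl mul1r.
have -> : f (y + h) - tpoly k.+1 dd h = (f (y + h) - (tpoly k.+1 dd h + dd k.+1 * (h ^+ k.+1 / (k.+1)`!%:R)))
  + dd k.+1 * (h ^+ k.+1 / (k.+1)`!%:R) by ring.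
by apply: le_trans (ler_normD _ _) _; exact: lerD.
Qed.

(** The top term of an expansion of order k + 1 is O(|h|^(k+1)), hence o(|h|^k). *)
Lemma peano_at_trunc a b f k m y dd : (m <= k)%N -> peano_at a b f k y dd ->
  peano_at a b f m y dd.
Proof.
move=> /subnK <-; elim: (k - m)%N => [//|j IH] hp; apply: IH => e e0.
have [C [d [d0 C0 hd]]] := peano_at_bigO hp.
have C1 : 0 < C + 1 by rewrite ltr_wpDl.
exists (Num.min d (e / (C + 1))) => [|h]; first by rewrite lt_min d0 divr_gt0.
rewrite lt_min => /andP[h1 h2] hab; apply: le_trans (hd h h1 hab) _.
rewrite exprS mulrA ler_wpM2r ?exprn_ge0//.
apply: (@le_trans _ _ ((C + 1) * `|h|)); first by rewrite ler_wpM2r// lerDl.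
by rewrite mulrC -ler_pdivlMr// ltW.
Qed.

(** All derivatives up to order N vanish at a, so f extends by 0 to the left; to the right of c it
    extends by its Taylor polynomial there. Both extensions keep approximations of order N at the
    end points, with top coefficients 0 and d N c. *)
Lemma one_step a c N f (d : nat -> R -> R) (g : R -> R) (E Z : set R) : a < c ->
  (forall j, (j <= N)%N -> d j a = 0) ->
  (forall y, a <= y <= c -> peano_at a c f N y (fun j => d j y)) ->
  countable E -> (@lebesgue_measure R).-negligible Z ->
  (forall y, a < y < c -> ~ Z y -> exists dd, dd N.+1 = g y /\ peano_at a c f N.+1 y dd) ->
  (forall y, a < y < c -> ~ E y -> exists C r, [/\ 0 < r, 0 <= C & forall h, `|h| < r ->
     a <= y + h <= c -> `|f (y + h) - tpoly N.+1 (fun j => d j y) h| <= C * `|h| ^+ N.+1]) ->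
  dist_integrable a c (fun t => (g t)%:E) /\ dist_integral a c (fun t => (g t)%:E) = d N c.
Proof.
move=> ac da hp cE nZ hZ hE.
pose q y := tpoly N.+1 (fun j => d j c) (y - c).
pose F y := if y < a then 0 else if c < y then q y else f y.
have Fin y : a <= y <= c -> F y = f y.
  by move=> /andP[h1 h2]; rewrite /F ltNge h1 ltNge h2.
have Fl y : y < a -> F y = 0 by rewrite /F => ->.
have Fr y : c < y -> F y = q y.
  by move=> cy; rewrite /F cy ltNge (ltW (lt_trans ac cy)).
have margin y : a < y < c -> exists2 r, 0 < r & forall h, `|h| < r -> a <= y + h <= c.
  move=> /andP[ay yc]; exists (Num.min (y - a) (c - y)); first by rewrite lt_min !subr_gt0 ay yc.
  by move=> h; rewrite lt_min !ltr_norml => /andP[/andP[h1 h2] /andP[h3 h4]]; apply/andP; split; lra.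
have inner k y dd : a < y < c -> peano_at a c f k y dd ->
    approx k F y (fun z => tpoly k.+1 dd (z - y)).
  move=> hy hpy e e0; have [r r0 hr] := margin y hy; have [s s0 hs] := hpy e e0.
  exists (Num.min r s) => [|h]; first by rewrite lt_min r0.
  rewrite lt_min => /andP[h1 h2]; rewrite Fin ?hr// (addrC y) addrK addrC.
  by apply: hs => //; exact: hr.
have T0 h : tpoly N.+1 (fun j => d j a) h = 0 by apply: tpoly_eq0 => j; rewrite ltnS; exact: da.
have at_a : approx N F a (fun z => tpoly N.+1 (fun j => d j a) (z - a)).
  move=> e e0; have [|s s0 hs] := hp a _ e e0; first by rewrite lexx ltW.
  exists (Num.min s (c - a)) => [|h]; first by rewrite lt_min s0 subr_gt0.
  rewrite lt_min => /andP[h1 h2]; have [h0|h0] := ltP h 0.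
    rewrite Fl; last by rewrite gtrDl.
    by rewrite T0 subrr normr0 mulr_ge0 ?(ltW e0)// exprn_ge0.
  have hac : a <= a + h <= c by move: h2; rewrite ger0_norm// => h2; apply/andP; split; lra.
  by rewrite (Fin _ hac) (addrC a h) addrK (addrC h); exact: hs.
have at_c : approx N F c q.
  move=> e e0; have [|s s0 hs] := hp c _ e e0; first by rewrite lexx ltW.
  exists (Num.min s (c - a)) => [|h]; first by rewrite lt_min s0 subr_gt0.
  rewrite lt_min => /andP[h1 h2]; have [h0|h0] := ltP 0 h.
    rewrite Fr; last by rewrite ltrDl.
    by rewrite subrr normr0 mulr_ge0 ?(ltW e0)// exprn_ge0.
  have hac : a <= c + h <= c by move: h2; rewrite ler0_norm// => h2; apply/andP; split; lra.
  by rewrite (Fin _ hac) /q (addrC c h) addrK (addrC h); exact: hs.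
have sT k dd y : smooth (fun z => tpoly k dd (z - y)) := @smooth_tpoly R k dd y.
have top y k dd : (fun z => tpoly k.+1 dd (z - y))^[k] = (fun=> dd k) := @derive1n_tpoly_top R k dd y.
have over y k dd : (fun z => tpoly k dd (z - y))^[k] = (fun=> 0) := @derive1n_tpoly_over R k dd y.
apply: (@dist_integral_nth_derivative R a c N F g q (d N c) E Z ac cE nZ) => //.
- move=> x; have [xa|ax|->] := ltgtP x a; last first.
  + exists (fun z => tpoly N.+1 (fun j => d j a) (z - a)), (d N a).
    by split; [exact: sT|exact: top|exact: at_a].
  + have [xc|cx|->] := ltgtP x c; last first.
    * by exists q, (d N c); split; [exact: sT|exact: top|exact: at_c].
    * exists q, (d N c); split; [exact: sT|exact: top|move=> e e0]; exists (x - c) => [|h]; first by rewrite subr_gt0.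
      rewrite ltr_norml => /andP[h1 h2]; rewrite Fr; last by lra.
      by rewrite subrr normr0 mulr_ge0 ?(ltW e0)// exprn_ge0.
    * exists (fun z => tpoly N.+1 (fun j => d j x) (z - x)), (d N x).
      split; [exact: sT|exact: top|].
      by apply: inner; [rewrite ax xc|apply: hp; rewrite !ltW].
  + exists (fun z => tpoly N.+1 (fun j => d j a) (z - a)), (d N a).
    split; [exact: sT|exact: top|move=> e e0].
    exists (a - x) => [|h]; first by rewrite subr_gt0.
    rewrite ltr_norml => /andP[h1 h2]; rewrite Fl; last by lra.
    by rewrite T0 subrr normr0 mulr_ge0 ?(ltW e0)// exprn_ge0.
- exists (fun z => tpoly N.+1 (fun j => d j a) (z - a)).
  by split; [exact: sT|rewrite top da|exact: at_a].
- by exists q; split; [exact: sT|exact: top|exact: at_c].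
- exact: sT.
- exact: over.
- move=> x hx nZx; have [dd [ddg hdd]] := hZ x hx nZx.
  exists (fun z => tpoly N.+2 dd (z - x)).
  by split; [exact: sT|rewrite top ddg|exact: inner].
- move=> x hx nEx; have [C [r [r0 C0 hr]]] := hE x hx nEx.
  have [s s0 hs] := margin x hx; have m0 : 0 < Num.min r s by rewrite lt_min r0.
  exists (fun z => tpoly N.+1 (fun j => d j x) (z - x)), C, (Num.min r s / 2).
  split; [exact: sT|exact: over|by rewrite divr_gt0|exact: C0|].
  move=> h hh; have : `|h| < Num.min r s by lra.
  rewrite lt_min => /andP[h1 h2]; rewrite Fin ?hs// (addrC x) addrK addrC.
  by apply: hr => //; exact: hs.
Qed.

End OneStep.

(** * Normalisation at the left end and induction on the number of integrations *)

Section Assembly.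
Context {R : realType}.
Variables (n : nat) (a b : R) (f : R -> R) (fs : nat -> R -> R) (E : set R).
Hypothesis hn : (1 <= n)%N.
Hypothesis hpeano : forall x, a <= x <= b ->
  peano_derivatives a b f n.-1 x (fun j => fs j x).
Hypothesis hE : countable E.
Hypothesis hO : forall x, a <= x <= b -> ~ E x ->
  exists C : R, \forall h \near increments a b x,
    `|f (x + h) - peano_poly n.-1 (fun j => fs j x) h| <= C * `|h| ^+ n.
Hypothesis hae : {ae @lebesgue_measure R, forall x, a <= x <= b ->
  peano_derivatives a b f n x (fun j => fs j x)}.

Let P (y : R) := tpoly n (fun j => fs j a) (y - a).

(* The Peano derivatives of f - P: subtracting the Taylor polynomial at a makes
   them all vanish there. *)
Let d (j : nat) (y : R) : R := fs j y - tpoly (n - j) (fun i => fs (i + j)%N a) (y - a).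

Let f0 y := f y - P y.

Let n1 : n.-1.+1 = n. Proof. exact: prednK. Qed.

Let f_fs0 x : a <= x <= b -> f x = fs 0%N x.
Proof. by move=> /hpeano[]. Qed.

Let d_a j : (j < n)%N -> d j a = 0.
Proof. by move=> jn; rewrite /d subrr -(prednK (n := n - j)) ?subn_gt0// tpoly0 add0n subrr. Qed.

Let d_0 x : a <= x <= b -> d 0%N x = f0 x.
Proof.
move=> hx; rewrite /d /f0 /P (f_fs0 hx) subn0; congr (_ - tpoly _ _ _).
by apply/funext => i; rewrite addn0.
Qed.

(** The polynomial P has degree below n, so it equals its own expansion at x and leaves the
    remainder unchanged. *)
Let f0_tpoly x h m : (n <= m)%N ->
  f0 (x + h) - tpoly m (fun j => d j x) h = f (x + h) - tpoly m (fun j => fs j x) h.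
Proof.
move=> nm; rewrite /f0 /P (_ : x + h - a = (x - a) + h); last by ring.
rewrite tpoly_taylor tpoly_sub.
have -> : tpoly m (fun j => tpoly (n - j) (fun i => fs (i + j)%N a) (x - a)) h =
    tpoly n (fun j => tpoly (n - j) (fun i => fs (i + j)%N a) (x - a)) h.
  rewrite -(subnKC nm); elim: (m - n)%N => [|k IH]; first by rewrite addn0.
  rewrite addnS tpolyS IH; set z := (tpoly (n - _) _ _).
  have -> : z = 0 by rewrite /z (_ : (n - (n + k) = 0)%N) ?tpoly_eq0//; apply/eqP; rewrite subn_eq0 leq_addr.
  by rewrite mul0r addr0.
by ring.
Qed.

Let increments_ball x (Q : R -> Prop) : (\forall h \near increments a b x, Q h) ->
  exists2 r, 0 < r & forall h, h != 0 -> `|h| < r -> a <= x + h <= b -> Q h.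
Proof.
rewrite /increments near_withinE near_withinE => /nbhs_ballP[r /= r0 hr].
exists r => // h h0 hh hab; apply: hr => //.
by rewrite /ball/= sub0r normrN.
Qed.

(** [increments] leaves out h = 0, which [peano_at] includes; the remainder vanishes there. *)
Let f0_at0 x k : a <= x <= b -> (0 < k)%N -> f0 (x + 0) - tpoly k (fun j => d j x) 0 = 0.
Proof. by case: k => // k hx _; rewrite addr0 tpoly0 d_0// subrr. Qed.

Let peano_f0 x m : a <= x <= b -> (n <= m.+1)%N -> peano_derivatives a b f m x (fun j => fs j x) ->
  peano_at a b f0 m x (fun j => d j x).
Proof.
move=> hx nm [_ hp] e e0; have [r r0 hr] := increments_ball (hp e e0).
exists r => // h hh hab; have [->|h0] := eqVneq h 0.
  by rewrite f0_at0// normr0 mulr_ge0 ?(ltW e0)// exprn_ge0.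
by rewrite f0_tpoly//; exact: hr.
Qed.

Let peano_low x m : a <= x <= b -> (m < n)%N -> peano_at a b f0 m x (fun j => d j x).
Proof.
move=> hx mn; apply: (@peano_at_trunc R a b f0 n.-1); first by rewrite -ltnS n1.
by apply: peano_f0; [|rewrite n1|exact: hpeano].
Qed.

Let iter k := iter_dist_integral a (fs n) k.

(** One more integration lowers the order of the Peano derivative of f - P by one. Nothing is
    assumed on [iter 0], which is f_n and is used only almost everywhere. *)
Let iterS k x : (k < n)%N -> a <= x <= b ->
  (k = 0%N \/ forall y, a <= y <= b -> iter k y = d (n - k) y) ->
  dist_integrable a x (fun t => (iter k t)%:E) /\ iter k.+1 x = d (n - k.+1) x.
Proof.
move=> kn /andP[ax xb] hk; move: ax; rewrite le_eqVlt => /orP[/eqP ax|ax].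
  rewrite -ax d_a ?subnS ?prednK ?subn_gt0 ?leq_subr//.
  exact: dist_integral_point.
have sub y : a < y < x -> a <= y <= b.
  by move=> /andP[h1 h2]; rewrite (ltW h1)/= (le_trans (ltW h2)).
have NS : (n - k.+1).+1 = (n - k)%N by rewrite subnS prednK// subn_gt0.
have Nn : (n - k.+1 < n)%N by rewrite NS leq_subr.
have step1 y : a <= y <= x -> peano_at a x f0 (n - k.+1) y (fun j => d j y).
  move=> /andP[h1 h2]; apply: (peano_at_sub xb); apply: peano_low => //.
  by rewrite h1 (le_trans h2).
have da j : (j <= n - k.+1)%N -> d j a = 0 by move=> hj; apply: d_a; exact: leq_ltn_trans Nn.
(* For the first integral the exceptional sets are E and the null set where f_n fails to exist; the
   later integrands are Peano derivatives at every point, and both sets are empty. *)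
case: k kn hk NS Nn step1 da => [|k] kn hk NS Nn step1 da.
  have hZ : (@lebesgue_measure R).-negligible
    [set y | ~ (a <= y <= b -> peano_derivatives a b f n y (fun j => fs j y))] by exact: hae.
  apply: (one_step ax da step1 hE hZ) => y hy hny; rewrite ?NS ?subn0.
    exists (fun j => d j y); split.
      (* P has degree below n, so f and [f0] have the same n-th Peano derivative. *)
      by rewrite /d subnn /tpoly big_ord0 subr0.
    apply: (peano_at_sub xb); apply: peano_f0 (sub y hy) (leqnSn n) _.
    by apply: contrapT => h; apply: hny => hh; apply: h; exact: hh (sub y hy).
  have [C hC] := hO (sub y hy) hny; have [r r0 hr] := increments_ball hC.
  exists (Num.max 0 C), r; split=> //; first by rewrite le_max lexx.
  move=> h hh /andP[h1 h2]; have hab : a <= y + h <= b by rewrite h1 (le_trans h2).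
  have [->|h0] := eqVneq h 0; first by rewrite (f0_at0 (sub y hy) hn) normr0 mulr_ge0 ?exprn_ge0// le_max lexx.
  rewrite f0_tpoly//; have := hr h h0 hh hab; rewrite /peano_poly n1 => h3.
  by apply: le_trans h3 _; rewrite ler_wpM2r ?exprn_ge0// le_max lexx orbT.
have {}hk : forall y, a <= y <= b -> iter k.+1 y = d (n - k.+1) y by case: hk.
have low y : a < y < x -> peano_at a x f0 (n - k.+2).+1 y (fun j => d j y).
  move=> hy; rewrite NS; apply: (peano_at_sub xb); apply: peano_low; first exact: sub.
  by rewrite ltn_subrL (leq_trans _ hn).
have n0 : (@lebesgue_measure R).-negligible set0 by exact: negligible_set0.
apply: (one_step ax da step1 (countable0 R) n0) => y hy _.
  by exists (fun j => d j y); rewrite hk ?NS; [split=> //; rewrite -NS; exact: low|exact: sub].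
exact: peano_at_bigO (low y hy).
Qed.

Let iterE k : (k < n)%N -> forall x, a <= x <= b ->
  dist_integrable a x (fun t => (iter k t)%:E) /\ iter k.+1 x = d (n - k.+1) x.
Proof.
elim: k => [|k IH] kn x hx; first by apply: iterS => //; left.
by apply: iterS => //; right => y hy; have [] := IH (ltnW kn) y hy.
Qed.

Lemma iter_dist_integrable k x : (k < n)%N -> a <= x <= b ->
  dist_integrable a x (fun t => (iter_dist_integral a (fs n) k t)%:E).
Proof. by move=> kn hx; have [] := iterE kn hx. Qed.

Lemma taylor_iter_dist_integral x : a <= x <= b ->
  f x = \sum_(j < n) fs j a / j`!%:R * (x - a) ^+ j + iter_dist_integral a (fs n) n x.
Proof.
move=> hx; have nn : (n.-1 < n)%N by rewrite n1.
have [_] := iterE nn hx; rewrite n1 subnn /iter => ->; rewrite d_0// /f0 /P.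
have -> : \sum_(j < n) fs j a / j`!%:R * (x - a) ^+ j = tpoly n (fun j => fs j a) (x - a).
  by apply: eq_bigr => j _; ring.
by ring.
Qed.

End Assembly.

(** [one_step] for the zero function, with N = 0: off Z the integrand is its first Peano
    derivative. *)
Lemma dist_integral_eq0 (R : realType) (a x : R) (g : R -> R) (Z : set R) : a <= x ->
  (@lebesgue_measure R).-negligible Z -> (forall y, a < y < x -> ~ Z y -> g y = 0) ->
  dist_integral a x (fun t => (g t)%:E) = 0.
Proof.
rewrite le_eqVlt => /orP[/eqP <-|ax] nZ hg.
  by have [_] := dist_integral_point a (fun t => (g t)%:E).
have T0 m h : tpoly m (fun=> 0 : R) h = 0 by exact: tpoly_eq0.
have hp k y : peano_at a x (fun=> 0) k y (fun=> 0).
  move=> e e0; exists 1 => // h _ _.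
  by rewrite T0 subrr normr0 mulr_ge0 ?(ltW e0)// exprn_ge0.
have hZ y : a < y < x -> ~ Z y -> exists dd : nat -> R, dd 1%N = g y /\ peano_at a x (fun=> 0) 1 y dd.
  by move=> hy nZy; exists (fun=> 0); split; [rewrite hg|exact: hp].
have big y : a < y < x -> ~ (@set0 R) y -> exists C r : R, [/\ 0 < r, 0 <= C &
    forall h, `|h| < r -> a <= y + h <= x -> `|0 - tpoly 1 (fun=> 0) h| <= C * `|h| ^+ 1].
  by move=> _ _; exists 0, 1; split=> // h _ _; rewrite T0 subrr normr0 mul0r.
by have [_] := one_step (d := fun _ _ => 0) ax (fun _ _ => erefl) (fun y _ => hp 0%N y)
  (countable0 R) nZ hZ big.
Qed.

(** The null set enters only in the first integral; after it the integrand vanishes at every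
    point. *)
Lemma iter_dist_integral_eq0 (R : realType) (a b : R) (g : R -> R) k x :
  {ae @lebesgue_measure R, forall x, a <= x <= b -> g x = 0} -> a <= x <= b ->
  iter_dist_integral a g k.+1 x = 0.
Proof.
move=> hg; elim: k x => [|k IH] x /andP[ax xb].
  have nZ : (@lebesgue_measure R).-negligible [set y | ~ (a <= y <= b -> g y = 0)] by exact: hg.
  apply: (dist_integral_eq0 ax nZ) => y /andP[h1 h2] nZy; apply: contrapT => h; apply: nZy => hh.
  by apply: h; apply: hh; rewrite (ltW h1) (le_trans (ltW h2)).
apply: (dist_integral_eq0 ax (negligible_set0 _)) => y /andP[h1 h2] _.
by apply: IH; rewrite (ltW h1) (le_trans (ltW h2)).
Qed.

Lemma taylor_polynomial (R : realType) (n : nat) (c : nat -> R) (a : R) :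
  exists p : {poly R}, (size p <= n)%N /\
    forall x, p.[x] = \sum_(j < n) c j * (x - a) ^+ j.
Proof.
exists (\sum_(j < n) c j *: ('X - a%:P) ^+ j); split.
  apply: leq_trans (size_sum _ _ _) _; apply/bigmax_leqP => j _.
  by apply: leq_trans (size_scale_leq _ _) _; rewrite size_exp_XsubC.
move=> x; rewrite horner_sum; apply: eq_bigr => j _.
by rewrite hornerZ horner_exp hornerXsubC.
Qed.

Theorem theorem6p8 (R : realType) (n : nat) (a b : R) (f : R -> R)
    (fs : nat -> R -> R) (E : set R)
    (hn : (1 <= n)%N) (hab : a < b)
    (hf : {within `[a, b], continuous f})
    (hpeano : forall x, a <= x <= b ->
       peano_derivatives a b f n.-1 x (fun j => fs j x))
    (hE : countable E)
    (hO : forall x, a <= x <= b -> ~ E x ->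
       exists C : R, \forall h \near increments a b x,
         `|f (x + h) - peano_poly n.-1 (fun j => fs j x) h| <= C * `|h| ^+ n)
    (hae : {ae @lebesgue_measure R, forall x, a <= x <= b ->
       peano_derivatives a b f n x (fun j => fs j x)}) :
  [/\ dist_integrable a b (fun x => (fs n x)%:E),
      forall (k : nat) (x : R), (k < n)%N -> a <= x <= b ->
        dist_integrable a x (fun t => (iter_dist_integral a (fs n) k t)%:E),
      forall x, a <= x <= b ->
        f x = \sum_(j < n) fs j a / j`!%:R * (x - a) ^+ j
              + iter_dist_integral a (fs n) n x &
      {ae @lebesgue_measure R, forall x, a <= x <= b -> fs n x = 0} ->
        exists p : {poly R}, (size p <= n)%N /\
          forall x, a <= x <= b -> f x = p.[x]].
Proof.
split.
- have hb : a <= b <= b by rewrite (ltW hab) lexx.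
  exact: (iter_dist_integrable hn hpeano hE hO hae (k := 0) hn hb).
- by move=> k x kn hx; exact: (iter_dist_integrable hn hpeano hE hO hae kn hx).
- by move=> x hx; exact: (taylor_iter_dist_integral hn hpeano hE hO hae hx).
move=> hfn; have [p [psize hp]] := taylor_polynomial n (fun j => fs j a / j`!%:R) a.
exists p; split=> // x hx; rewrite hp (taylor_iter_dist_integral hn hpeano hE hO hae hx).
rewrite -[X in iter_dist_integral _ _ X _](prednK hn).
by rewrite (iter_dist_integral_eq0 _ hfn hx) addr0.
Qed.
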